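(* Let $\mathfrak l$ be a Lie algebra, $(\rho,\mathfrak a,\langle\cdot,\cdot\rangle_{\mathfrak a})$ an orthogonal $\mathfrak l$-module and $(\alpha,\gamma)\in\mathcal Z^2_Q(\mathfrak l,\mathfrak a)$. If $\rho$ is semi-simple, then $\mathfrak a=\mathfrak a^{\mathfrak l}\oplus\rho(\mathfrak l)\mathfrak a$, and there is a corresponding decomposition $\alpha=\alpha_0+\alpha_1$. In this case consider the following conditions. $(A_0)$ Let $L_0\in\mathfrak z(\mathfrak l)\cap\ker\rho$ be such that there exist $A_0\in\mathfrak a$ and $Z_0\in\mathfrak l^*$ satisfying for all $L\in\mathfrak l$: (i) $\alpha(L,L_0)=\rho(L)A_0$; (ii) $\gamma(L,L_0,\cdot)=-\langle A_0,\alpha(L,\cdot)\rangle_{\mathfrak a}+\langle Z_0,[L,\cdot]_{\mathfrak l}\rangle$ as an element of $\mathfrak l^*$. Then $L_0=0$. $(B_0)$ The subspace $\alpha_0(\ker[\cdot,\cdot]_{\mathfrak l})\subset\mathfrak a^{\mathfrak l}$ is non-degenerate. $(B_0')$ $\alpha_0(\ker[\cdot,\cdot]_{\mathfrak l})=\mathfrak a^{\mathfrak l}$. $(A_k)$ ($k\ge1$) Let $\mathfrak k\subset S(\mathfrak l)\cap R_k(\mathfrak l)$ be an ideal of $\mathfrak l$ such that there exist $\Phi_1\in\mathrm{Hom}(\mathfrak k,\mathfrak a)$ and $\Phi_2\in\mathrm{Hom}(\mathfrak k,R_k(\mathfrak l)^* )$ satisfying for all $L\in\mathfrak l$, $K\in\mathfrak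 k$: (i) $\alpha(L,K)=\rho(L)\Phi_1(K)-\Phi_1([L,K]_{\mathfrak l})$; (ii) $\gamma(L,K,\cdot)=-\langle\Phi_1(K),\alpha(L,\cdot)\rangle_{\mathfrak a}+\langle\Phi_2(K),[L,\cdot]_{\mathfrak l}\rangle+\langle\Phi_2([L,K]_{\mathfrak l}),\cdot\rangle$ as an element of $R_k(\mathfrak l)^*$. Then $\mathfrak k=0$. $(B_k)$ ($k\ge1$) Let $\mathfrak b_k\subset\mathfrak a$ be the maximal submodule such that the system of equations $\langle\alpha(L,K),B\rangle_{\mathfrak a}=\langle\rho(L)\Phi(K)-\Phi([L,K]_{\mathfrak l}),B\rangle_{\mathfrak a}$, $L\in\mathfrak l$, $K\in R_k(\mathfrak l)$, $B\in\mathfrak b_k$, has a solution $\Phi\in\mathrm{Hom}(R_k(\mathfrak l),\mathfrak a)$. Then $\mathfrak b_k$ is non-degenerate. Let $m$ be such that $R_{m+1}(\mathfrak l)=0$. Then the quadratic extension $\mathfrak d_{\alpha,\gamma}(\mathfrak l,\mathfrak a,\rho)$ is balanced if and only if $\rho$ is semi-simple and the conditions $(A_k)$ and $(B_k)$ hold for all $0\le k\le m$. The assertion remains true if ''balanced'' is replaced by ''regularly balanced'' and $(B_0)$ by $(B_0')$.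
   Context: All Lie algebras and modules are real and finite-dimensional. A metric Lie algebra is a Lie algebra with a non-degenerate invariant symmetric bilinear form. An orthogonal $\mathfrak l$-module is a representation $\rho$ of $\mathfrak l$ on $\mathfrak a$ by skew-symmetric maps with respect to a non-degenerate (possibly indefinite) symmetric bilinear form $\langle\cdot,\cdot\rangle_{\mathfrak a}$. $\mathfrak a^{\mathfrak l}$ denotes the invariants, $\mathfrak z(\mathfrak l)$ the centre, $\alpha_0$ the $\mathfrak a^{\mathfrak l}$-component and $\alpha_1$ the $\rho(\mathfrak l)\mathfrak a$-component of $\alpha$. $\ker[\cdot,\cdot]_{\mathfrak l}$ is the kernel of the linear map $\bigwedge^2\mathfrak l\to\mathfrak l$ given by the bracket, and $\alpha_0$ is viewed as a linear map $\bigwedge^2\mathfrak l\to\mathfrak a^{\mathfrak l}$. A subspace of $\mathfrak a$ is non-degenerate if the form restricted to it is non-degenerate (the zero subspace is non-degenerate). Cochains: $C^p(\mathfrak l,\mathfrak a)=\mathrm{Hom}(\bigwedge^p\mathfrak l,\mathfrak a)$ with Chevalley–Eilenberg differential $d$; $C^p(\mathfrak l)$ is the case of trivial coefficients $\mathbb R$; $\langle\alpha\wedge\tau\rangle$ is the wedge product of $\mathfrak a$-valued forms (sum over shuffles with signs) composed with $\langle\cdot,\cdot\rangle_{\mathfrak a}$. $\mathcal Z^2_Q(\mathfrak l,\mathfrak a)=\{(\alpha,\gamma)\in C^2(\mathfrak l,\mathfrak a)\oplus C^3(\mathfrak l): d\alpha=0,\ d\gamma=\frac12\langle\alpha\wedge\alpha\rangle\}$.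 Socles and radicals: for a finite-dimensional $\mathfrak g$-module $V$, $S(V)$ is the maximal semi-simple submodule, $R(V)$ the minimal submodule with $V/R(V)$ semi-simple; $S_0(V)=0$, $S_k(V)$ is the preimage in $V$ of $S(V/S_{k-1}(V))$; $R_0(V)=V$, $R_k(V)=R(R_{k-1}(V))$. For a Lie algebra $\mathfrak g$, $S_k(\mathfrak g),R_k(\mathfrak g)$ refer to the adjoint module, $S=S_1$, $R=R_1$. Put $\mathfrak i(\mathfrak g)=\sum_{k\ge1}R_k(\mathfrak g)\cap S_k(\mathfrak g)$. Standard model: $\mathfrak d_{\alpha,\gamma}(\mathfrak l,\mathfrak a,\rho)$ is the metric Lie algebra $\mathfrak l^*\oplus\mathfrak a\oplus\mathfrak l$ with inner product $\langle Z_1+A_1+L_1,Z_2+A_2+L_2\rangle=\langle A_1,A_2\rangle_{\mathfrak a}+Z_1(L_2)+Z_2(L_1)$ and bracket determined by $[L_1,L_2]=\gamma(L_1,L_2,\cdot)+\alpha(L_1,L_2)+[L_1,L_2]_{\mathfrak l}$, $[L,A]=\rho(L)A-\langle A,\alpha(L,\cdot)\rangle$, $[L,Z]=-Z([L,\cdot]_{\mathfrak l})$, $[A_1,A_2]=\langle\rho(\cdot)A_1,A_2\rangle$, $[\mathfrak a,\mathfrak l^*]=[\mathfrak l^*,\mathfrak l^*]=0$. It is regarded as a quadratic extension of $\mathfrak l$ by $\mathfrak a$ with distinguished isotropic ideal $\mathfrak l^*$. It is called balanced if $\mathfrak l^*=\mathfrak i(\mathfrak d)$ for $\mathfrak d=\mathfrak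 d_{\alpha,\gamma}(\mathfrak l,\mathfrak a,\rho)$, and regularly balanced if in addition $\mathfrak z(\mathfrak d)\subset[\mathfrak d,\mathfrak d]$. *)

(* Defs.v *)
From HB Require Import structures.
From mathcomp Require Import all_boot all_order all_algebra.
From mathcomp Require Import boolp classical_sets reals.

Set Implicit Arguments.
Unset Strict Implicit.
Unset Printing Implicit Defensive.

Import GRing.Theory.
Local Open Scope ring_scope.

(* Bilinear and trilinear maps are curried: 'Hom(U, 'Hom(V, W)) is the space  *)
(* of bilinear maps U x V -> W.  For X x Y : l and a cochain gamma, the term  *)
(* gamma X Y is then literally the element gamma(X, Y, .) of the dual of l.   *)

Notation dualv V := 'Hom(V, (_^o)%type).

Section Extremal.
Variables (K : fieldType) (V : vectType K).

(* The greatest and the least subspace with a given property; the value is    *)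
(* the junk subspace 0 when there is none.  They do exist in the uses below:  *)
(* the properties are stable under sums (resp. intersections), for b_ when    *)
(* rho is semisimple, the only case in which cond_B is considered.            *)
Definition greatest (P : {vspace V} -> Prop) : {vspace V} :=
  xget 0%VS [set U : {vspace V} | P U /\ forall W, P W -> (W <= U)%VS].

Definition least (P : {vspace V} -> Prop) : {vspace V} :=
  xget 0%VS [set U : {vspace V} | P U /\ forall W, P W -> (U <= W)%VS].

End Extremal.

Section Modules.
Variables (K : fieldType) (g : Type).

(* A module structure on V enters through the operators f x : V -> V.         *)

Definition submodule (V : vectType K) (f : g -> 'End(V)) (U : {vspace V}) :=
  forall x v, v \in U -> f x v \in U.

Definition semisimple (V : vectType K) (f : g -> 'End(V)) :=
  forall U, submodule f U ->
  exists W, [/\ submodule f W, (U + W = fullv)%VS & (U :&: W = 0)%VS].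

Section SubQuotient.
Variables (V : vectType K) (f : g -> 'End(V)) (U : {vspace V}).

Definition sub_incl : 'Hom(subvs_of U, V) := linfun vsval.

Definition sub_act (x : g) : 'End(subvs_of U) :=
  (linfun (vsproj U) \o f x \o sub_incl)%VF.

(* The quotient space V / U is modelled on the complement U^C, the canonical  *)
(* map V -> V / U being the projection along U, whose kernel is U.  The       *)
(* induced action below is the quotient action when U is a submodule.         *)
Definition quotv : vectType K := subvs_of (U^C)%VS.

Definition quot_proj : 'Hom(V, quotv) :=
  (linfun (vsproj (U^C)%VS) \o daddv_pi (U^C)%VS U)%VF.

Definition quot_act (x : g) : 'End(quotv) :=
  (quot_proj \o f x \o linfun (vsval : quotv -> V))%VF.

End SubQuotient.

Definition socle (V : vectType K) (f : g -> 'End(V)) : {vspace V} :=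
  greatest (fun U => submodule f U /\ semisimple (sub_act f U)).

Definition radical (V : vectType K) (f : g -> 'End(V)) : {vspace V} :=
  least (fun U => submodule f U /\ semisimple (quot_act f U)).

Fixpoint socle_series (V : vectType K) (f : g -> 'End(V)) (k : nat) :
    {vspace V} :=
  if k is j.+1 then
    let U := socle_series f j in
    (quot_proj U @^-1: socle (quot_act f U))%VS
  else 0%VS.

Fixpoint radical_series (V : vectType K) (f : g -> 'End(V)) (k : nat) :
    {vspace V} :=
  if k is j.+1 then
    let U := radical_series f j in
    (sub_incl U @: radical (sub_act f U))%VS
  else fullv.

(* a^l and rho(l)a *)
Definition invariants (V : vectType K) (f : g -> 'End(V)) : {vspace V} :=
  greatest (fun U => forall x v, v \in U -> f x v = 0).

Definition act_image (V : vectType K) (f : g -> 'End(V)) : {vspace V} :=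
  least (fun U => forall x v, f x v \in U).

End Modules.

Section ExteriorSquare.
Variables (K : fieldType) (V : vectType K).

(* The exterior square of V, in coordinates with respect to the basis         *)
(* (e_i /\ e_j), i < j, attached to the basis e = vbasis fullv of V.          *)
Definition ext2_index := {p : 'I_(\dim {:V}) * 'I_(\dim {:V}) | (p.1 < p.2)%N}.

Definition ext2 : vectType K := {ffun ext2_index -> K^o}.

(* The linear map on the exterior square induced by an alternating bilinear   *)
(* map b, i.e. e_i /\ e_j |-> b e_i e_j.                                      *)
Definition ext2_map (W : vectType K) (b : 'Hom(V, 'Hom(V, W))) :
    'Hom(ext2, W) :=
  linfun (fun w : ext2 =>
    \sum_(p : ext2_index)
      (w p : K) *: b (vbasis {:V})`_(val p).1 (vbasis {:V})`_(val p).2).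

End ExteriorSquare.

Section LieAlgebras.
Variables (R : realType) (g : vectType R).
Implicit Types (br : 'Hom(g, 'End(g))) (form : 'Hom(g, dualv g)).

Definition lie_bracket br :=
  (forall x, br x x = 0) /\
  (forall x y z, br x (br y z) + br y (br z x) + br z (br x y) = 0).

Definition symmetric_form (V : vectType R) (b : 'Hom(V, dualv V)) :=
  forall v w, b v w = b w v.

Definition nondegenerate_on (V : vectType R) (b : 'Hom(V, dualv V))
    (U : {vspace V}) :=
  forall v, v \in U -> (forall w, w \in U -> b v w = 0) -> v = 0.

Definition metric_lie_algebra br form :=
  [/\ lie_bracket br, symmetric_form form, nondegenerate_on form fullv
    & forall x y z, form (br x y) z = form x (br y z)].

Definition orthogonal_module br (V : vectType R) (rho : 'Hom(g, 'End(V)))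
    (b : 'Hom(V, dualv V)) :=
  [/\ forall x y v, rho (br x y) v = rho x (rho y v) - rho y (rho x v),
      symmetric_form b, nondegenerate_on b fullv
    & forall x v w, b (rho x v) w = - b v (rho x w)].

(* The centre of g is the kernel lker br of the adjoint representation br.    *)

Definition derived br : {vspace g} :=
  least (fun U => forall x y, br x y \in U).

(* sum over k >= 1 of the intersections of R_k and S_k *)
Definition canonical_ideal br : {vspace g} :=
  least (fun U => forall k, (0 < k)%N ->
    (radical_series br k :&: socle_series br k <= U)%VS).

End LieAlgebras.

Section QuadraticCohomology.
Variables (R : realType) (l a : vectType R).
Variables (br : 'Hom(l, 'End(l))) (rho : 'Hom(l, 'End(a))).
Variable form : 'Hom(a, dualv a).
Implicit Types (alpha beta : 'Hom(l, 'Hom(l, a))).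
Implicit Types (gamma : 'Hom(l, 'Hom(l, dualv l))).

Definition alternating2 alpha := forall x, alpha x x = 0.

Definition alternating3 gamma :=
  forall x y, [/\ gamma x x y = 0, gamma x y x = 0 & gamma y x x = 0].

(* Chevalley-Eilenberg differential C^2(l, a) -> C^3(l, a) *)
Definition ce_d2 alpha (x y z : l) : a :=
  rho x (alpha y z) - rho y (alpha x z) + rho z (alpha x y)
  - alpha (br x y) z + alpha (br x z) y - alpha (br y z) x.

(* Chevalley-Eilenberg differential C^3(l) -> C^4(l), trivial coefficients *)
Definition ce_d3 gamma (x y z t : l) : R :=
  - gamma (br x y) z t + gamma (br x z) y t - gamma (br x t) y z
  - gamma (br y z) x t + gamma (br y t) x z - gamma (br z t) x y.

(* <alpha /\ beta> for 2-forms: the signed sum over the six (2,2)-shuffles *)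
Definition wedge22 alpha beta (x y z t : l) : R :=
  form (alpha x y) (beta z t) - form (alpha x z) (beta y t)
  + form (alpha x t) (beta y z) + form (alpha y z) (beta x t)
  - form (alpha y t) (beta x z) + form (alpha z t) (beta x y).

Definition quadratic_cocycle alpha gamma :=
  [/\ alternating2 alpha, alternating3 gamma,
      forall x y z, ce_d2 alpha x y z = 0
    & forall x y z t, ce_d3 gamma x y z t = 2^-1 * wedge22 alpha alpha x y z t].

End QuadraticCohomology.

Section StandardModel.
Variables (R : realType) (l a : vectType R).
Variables (br : 'Hom(l, 'End(l))) (rho : 'Hom(l, 'End(a))).
Variable form : 'Hom(a, dualv a).
Variables (alpha : 'Hom(l, 'Hom(l, a))) (gamma : 'Hom(l, 'Hom(l, dualv l))).

(* d = l^* + a + l, an element being a triple (Z, A, L) *)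
Definition stdmodel : vectType R := (dualv l * a * l)%type.

Definition std_bracket_fun (u v : stdmodel) : stdmodel :=
  let: (Z1, A1, L1) := u in
  let: (Z2, A2, L2) := v in
  (gamma L1 L2
     - (form A2 \o alpha L1)%VF + (form A1 \o alpha L2)%VF
     - (Z2 \o br L1)%VF + (Z1 \o br L2)%VF
     + linfun (fun L => form (rho L A1) A2),
   alpha L1 L2 + rho L1 A2 - rho L2 A1,
   br L1 L2).

Definition std_bracket : 'Hom(stdmodel, 'End(stdmodel)) :=
  linfun (fun u => linfun (std_bracket_fun u)).

Definition std_form_fun (u v : stdmodel) : R :=
  let: (Z1, A1, L1) := u in
  let: (Z2, A2, L2) := v in
  form A1 A2 + Z1 L2 + Z2 L1.

Definition std_form : 'Hom(stdmodel, dualv stdmodel) :=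
  linfun (fun u => linfun (std_form_fun u : stdmodel -> R^o)).

(* the subspace l^* of d *)
Definition std_dual_ideal : {vspace stdmodel} :=
  limg (linfun (fun Z : dualv l => (Z, 0, 0) : stdmodel)).

Definition balanced := std_dual_ideal = canonical_ideal std_bracket.

Definition regularly_balanced :=
  balanced /\ (lker std_bracket <= derived std_bracket)%VS.

End StandardModel.

Section Conditions.
Variables (R : realType) (l a : vectType R).
Variables (br : 'Hom(l, 'End(l))) (rho : 'Hom(l, 'End(a))).
Variable form : 'Hom(a, dualv a).
Variables (alpha : 'Hom(l, 'Hom(l, a))) (gamma : 'Hom(l, 'Hom(l, dualv l))).

Local Notation Rad k := (radical_series br k).

(* The components of alpha; meaningful when a = a^l + rho(l)a is a direct sum *)
Definition alpha_0 : 'Hom(l, 'Hom(l, a)) :=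
  linfun (fun L => (daddv_pi (invariants rho) (act_image rho) \o alpha L)%VF).

Definition alpha_1 : 'Hom(l, 'Hom(l, a)) :=
  linfun (fun L => (daddv_pi (act_image rho) (invariants rho) \o alpha L)%VF).

(* alpha_0(ker [.,.]) *)
Definition alpha_0_ker : {vspace a} :=
  (ext2_map alpha_0 @: lker (ext2_map br))%VS.

Definition cond_A0 :=
  forall L0, L0 \in (lker br :&: lker rho)%VS ->
  (exists (A0 : a) (Z0 : dualv l), forall L,
     alpha L L0 = rho L A0 /\
     gamma L L0 = - (form A0 \o alpha L)%VF + (Z0 \o br L)%VF) ->
  L0 = 0.

Definition cond_B0 := nondegenerate_on form alpha_0_ker.

Definition cond_B0' := alpha_0_ker = invariants rho.

(* vsproj U restricted to U is the identification of U with subvs_of U *)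
Definition cond_A (k : nat) :=
  forall I : {vspace l}, submodule br I -> (I <= socle br :&: Rad k)%VS ->
  (exists (Phi1 : 'Hom(subvs_of I, a))
          (Phi2 : 'Hom(subvs_of I, dualv (subvs_of (Rad k)))),
     forall L K, K \in I ->
       alpha L K = rho L (Phi1 (vsproj I K)) - Phi1 (vsproj I (br L K)) /\
       (forall X, X \in Rad k ->
          gamma L K X =
            - form (Phi1 (vsproj I K)) (alpha L X)
            + Phi2 (vsproj I K) (vsproj (Rad k) (br L X))
            + Phi2 (vsproj I (br L K)) (vsproj (Rad k) X))) ->
  I = 0%VS.

Definition b_ (k : nat) : {vspace a} :=
  greatest (fun b => submodule rho b /\
    exists Phi : 'Hom(subvs_of (Rad k), a),
      forall L K B, K \in Rad k -> B \in b ->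
        form (alpha L K) B =
        form (rho L (Phi (vsproj (Rad k) K))
              - Phi (vsproj (Rad k) (br L K))) B).

Definition cond_B (k : nat) := nondegenerate_on form (b_ k).

End Conditions.

(* Main.v *)
(* The ideal l^* of d is isotropic with orthogonal l^* + a, and a is the module
   (l^* + a) / l^*.  By invariance of the form, R_k(d) and S_k(d) are mutually
   orthogonal complements, so the orthogonal of i(d) is the intersection of the
   R_k + S_k, which is the sum of the layers R_k /\ S_(k+1).  Thus l^* = i(d)
   means that a is semisimple, R_k /\ S_(k+1) lies in l^* + a and
   R_(k+1) /\ S_(k+1) lies in l^*, for all k.  The image in l of a layer
   R_k /\ S_(k+1) is an ideal which lifts to d modulo the part S_k of l^*; such
   lifts are excluded by (A_k).  The module b_k is the projection to a of
   S_(k+1) /\ (l^* + a), and its orthogonal is that of R_(k+1) /\ (l^* + a).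
   For k = 0 the centre of d replaces its socle, because the nilpotent ideal
   l^* + a acts trivially on the socle.
   For k >= 1 one needs that R_1(l) acts trivially on a semisimple l-module V.
   Let n be the kernel of the trace form of V on l.  Then [l, n] acts trivially
   (Cartan, Engel), and the intersection of R_1 + n with its orthogonal is n,
   whence R_1 + n = n.  So R_1, which lies in [l, l], acts on V by central sums
   of commutators; these are nilpotent, hence zero. *)

Require Import Defs.
From HB Require Import structures.
From mathcomp Require Import all_boot all_order all_algebra.
From mathcomp Require Import boolp classical_sets reals.
From mathcomp Require Import complex ring lra.

Set Implicit Arguments.
Unset Strict Implicit.
Unset Printing Implicit Defensive.

Import GRing.Theory Num.Theory VectorInternalTheory.
Local Open Scope ring_scope.

(** * Extremal subspaces *)

(** Quotients are modelled on complements, so they are eliminated early: semisimplicity of B / A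
    becomes a statement [ss_quotient A B] on the submodules between A and B, and the modular law
    does the work of the isomorphism theorems. Orthogonality reverses this lattice. The equations of
    (A_k) and (B_k) are read on R_k(l) only, because an element Z of l^* lies in S_k(d) exactly when
    it vanishes on R_k(l); so they describe lifts modulo S_k. A solution gives an ideal of d only if
    the bracket terms rho(K), rho(X) and [X, K] with K, X in R_k(l) vanish, whence the restriction k
    >= 1 and the result on R_1(l). That result needs trace criteria for nilpotency. Real eigenvalues
    do not suffice: over the complex numbers, with D the conjugate of the semisimple part of x, the
    trace of x D is the sum of the squared moduli of the eigenvalues, so its vanishing makes x
    nilpotent. No condition is required beyond m, since there R_k(l) = 0 already puts R_k(d) inside
    l^* + a. *)

Section ExtremalSubspaces.
Variables (K : fieldType) (V : vectType K).
Implicit Types (U W : {vspace V}) (P : {vspace V} -> Prop).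

Lemma dimv_le_fullv U : (\dim U <= \dim {:V})%N.
Proof. exact: dimvS (subvf U). Qed.

(** A member U of least dimension works: its intersection with any other member is again a member
    and cannot be smaller than U. *)
Lemma ex_least_subspace P U0 : P U0 ->
  (forall U W, P U -> P W -> P (U :&: W)%VS) ->
  exists U, P U /\ forall W, P W -> (U <= W)%VS.
Proof.
move=> P0 Pcap.
have exn : exists n, `[< exists U, P U /\ \dim U = n >].
  by exists (\dim U0); apply/asboolP; exists U0.
case: (ex_minnP exn) => n /asboolP[U [PU dU]] nmin.
exists U; split=> // W PW; apply/capv_idPl/eqP; rewrite eqEdim capvSl dU.
by apply: nmin; apply/asboolP; exists (U :&: W)%VS; split => //; exact: Pcap.
Qed.

Lemma ex_greatest_subspace P U0 : P U0 ->
  (forall U W, P U -> P W -> P (U + W)%VS) ->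
  exists U, P U /\ forall W, P W -> (W <= U)%VS.
Proof.
move=> P0 Padd.
have exn : exists n, `[< exists U, P U /\ \dim U = n >].
  by exists (\dim U0); apply/asboolP; exists U0.
case: (@ex_maxnP _ (\dim {:V}) exn) => [n /asboolP[U [_ <-]]|n].
  exact: dimv_le_fullv.
move=> /asboolP[U [PU dU]] nmax.
exists U; split=> // W PW; apply/addv_idPl/eqP.
rewrite eq_sym eqEdim addvSl dU.
by apply: nmax; apply/asboolP; exists (U + W)%VS; split => //; exact: Padd.
Qed.

Lemma leastP P U0 : P U0 ->
  (forall U W, P U -> P W -> P (U :&: W)%VS) ->
  P (least P) /\ forall W, P W -> (least P <= W)%VS.
Proof.
move=> P0 Pcap; case: (ex_least_subspace P0 Pcap) => U HU.
exact: (@xgetPex _ 0%VS [set U | P U /\ forall W, P W -> (U <= W)%VS]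
  (ex_intro _ U HU)).
Qed.

Lemma greatestP P U0 : P U0 ->
  (forall U W, P U -> P W -> P (U + W)%VS) ->
  P (greatest P) /\ forall W, P W -> (W <= greatest P)%VS.
Proof.
move=> P0 Padd; case: (ex_greatest_subspace P0 Padd) => U HU.
exact: (@xgetPex _ 0%VS [set U | P U /\ forall W, P W -> (W <= U)%VS]
  (ex_intro _ U HU)).
Qed.

(** Asks for no stability under sums. This serves for [b_], whose greatest element is exhibited
    directly. *)
Lemma greatest_eq P U : P U -> (forall W, P W -> (W <= U)%VS) -> greatest P = U.
Proof.
move=> PU Umax.
have [PG Gmax] : P (greatest P) /\ forall W, P W -> (W <= greatest P)%VS.
  exact: (@xgetPex _ 0%VS [set U | P U /\ forall W, P W -> (W <= U)%VS]
    (ex_intro _ U (conj PU Umax))).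
by apply/eqP; rewrite eqEsubv Umax ?Gmax.
Qed.

(** Turns a linear condition on vectors into a subspace; orthogonals, graphs of lifts and spaces cut
    out by brackets or traces are all obtained this way. *)
Definition subspace (P : V -> Prop) : {vspace V} :=
  greatest (fun U => forall u, u \in U -> P u).

Lemma mem_subspace (P : V -> Prop) :
  P 0 -> (forall k u v, P u -> P v -> P (k *: u + v)) ->
  forall v, (v \in subspace P) <-> P v.
Proof.
move=> P0 Plin v.
have [PG Gmax] := @greatestP (fun U => forall u, u \in U -> P u) 0%VS
  ltac:(by move=> u; rewrite memv0 => /eqP->)
  ltac:(by move=> U W PU PW u /memv_addP[x xU [y yW ->]];
           rewrite -(scale1r x); apply: Plin; [exact: PU|exact: PW]).
split; first exact: PG.
move=> Pv; rewrite memvE; apply: Gmax => u /vlineP[k ->].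
by rewrite -[_ *: v]addr0; apply: Plin.
Qed.

Lemma sub_capr U W X : (X <= U)%VS -> (X <= W)%VS -> (X <= U :&: W)%VS.
Proof. by move=> h1 h2; rewrite subv_cap h1 h2. Qed.

Lemma sub_addl U W X : (U <= X)%VS -> (W <= X)%VS -> (U + W <= X)%VS.
Proof. by move=> h1 h2; rewrite subv_add h1 h2. Qed.

Lemma subv_eq U W : (U <= W)%VS -> (W <= U)%VS -> U = W.
Proof. by move=> h1 h2; apply/eqP; rewrite eqEsubv h1 h2. Qed.

End ExtremalSubspaces.

(** * The lattice of submodules and semisimple subquotients *)

Section SubmoduleLattice.
Variables (K : fieldType) (g : Type) (V : vectType K) (f : g -> 'End(V)).
Implicit Types (A B C D U W X P Q : {vspace V}).

Local Notation subm := (submodule f).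

Lemma submodule_add U W : subm U -> subm W -> subm (U + W)%VS.
Proof.
move=> sU sW x v /memv_addP[u uU [w wW ->]].
by rewrite linearD memv_add ?sU ?sW.
Qed.

Lemma submodule_cap U W : subm U -> subm W -> subm (U :&: W)%VS.
Proof. by move=> sU sW x v; rewrite !memv_cap => /andP[/sU-> /sW->]. Qed.

Lemma submodule_full : subm fullv.
Proof. by move=> *; exact: memvf. Qed.

Lemma submodule_0 : subm 0%VS.
Proof. by move=> x v; rewrite !memv0 => /eqP->; rewrite linear0. Qed.

Local Hint Resolve submodule_add submodule_cap submodule_full submodule_0 : core.

(* [ss_quotient A B]: the subquotient B / A is a semisimple module. *)
Definition ss_quotient A B := forall W, subm W -> (A <= W)%VS -> (W <= B)%VS ->
  exists X, [/\ subm X, (A <= X)%VS, (X <= B)%VS, (W + X = B)%VS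
              & (W :&: X = A)%VS].

Local Notation ss := ss_quotient.

Lemma ss_quotient_refl A : ss A A.
Proof.
move=> W sW AW WA; have -> : W = A by exact: subv_eq.
by exists A; rewrite addvv capvv; split => //; have <- : W = A by exact: subv_eq.
Qed.

(** From a complement X of W in B / A, the modular law makes [X :&: B' + A'] a complement in B' /
    A'. *)
Lemma ss_quotient_sub A B A' B' : subm A' -> subm B' ->
  (A <= A')%VS -> (A' <= B')%VS -> (B' <= B)%VS -> ss A B -> ss A' B'.
Proof.
move=> sA' sB' AA' A'B' B'B hs W sW A'W WB'.
have [X [sX AX XB eWX cWX]] := hs W sW (subv_trans AA' A'W) (subv_trans WB' B'B).
exists (X :&: B' + A')%VS; split; auto.
- exact: addvSr.
- by rewrite subv_add capvSr.
- rewrite addvA (vspace_modl _ WB') eWX (capv_idPr B'B); exact/addv_idPl.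
- apply: subv_eq; last by apply: sub_capr => //; exact: addvSr.
  rewrite -(vspace_modr _ A'W); apply: sub_addl => //.
  by rewrite capvA cWX; apply: subv_trans (capvSl _ _) AA'.
Qed.

(** The second isomorphism theorem P / (P :&: Q) = (P + Q) / Q, read from left to right;
    [ss_quotient_addr] is the other direction. *)
Lemma ss_quotient_capl P Q : subm P -> subm Q ->
  ss (P :&: Q)%VS P -> ss Q (P + Q)%VS.
Proof.
move=> sP sQ hs W sW QW WPQ.
have [|||X [sX AX XP eWX cWX]] := hs (W :&: P)%VS; auto.
- by apply: sub_capr; [apply: subv_trans (capvSr _ _) QW|exact: capvSl].
- exact: capvSr.
exists (X + Q)%VS; split; auto.
- exact: addvSr.
- by apply: addvS.
- apply: subv_eq; first by apply: sub_addl => //; apply: addvS.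
  apply: sub_addl; last by apply: subv_trans (addvSr _ _); exact: addvSr.
  rewrite -{1}eWX addvA; apply: subv_trans (addvSl _ _).
  by apply: addvS => //; exact: capvSl.
- apply: subv_eq; last by apply: sub_capr => //; exact: addvSr.
  rewrite -(vspace_modr _ QW); apply: sub_addl => //.
  apply: (@subv_trans _ _ (P :&: Q)%VS); last exact: capvSr.
  by rewrite -cWX; apply: sub_capr; [apply: sub_capr;
    [exact: capvSl|apply: subv_trans (capvSr _ _) XP]|exact: capvSr].
Qed.

Lemma ss_quotient_addr P Q : subm P -> subm Q ->
  ss Q (P + Q)%VS -> ss (P :&: Q)%VS P.
Proof.
move=> sP sQ hs W sW QW WP.
have [|||X [sX AX XP eWX cWX]] := hs (W + Q)%VS; auto.
- exact: addvSr.
- by apply: addvS.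
exists (X :&: P)%VS; split; auto.
- by rewrite capvC; apply: capvS.
- exact: capvSr.
- rewrite (vspace_modl _ WP); apply/capv_idPr.
  suff -> : (W + X = P + Q)%VS by exact: addvSl.
  by rewrite -eWX -addvA; congr (_ + _)%VS; apply/esym/addv_idPr.
- apply: subv_eq; last first.
    by rewrite !subv_cap QW capvSl (subv_trans (capvSr _ _) AX).
  rewrite capvA capvC; apply: sub_capr; first exact: capvSl.
  by rewrite -cWX; apply: subv_trans (capvSr _ _) _;
    apply: capvS => //; exact: addvSl.
Qed.

(** The new subquotient embeds in B / A; dually, the one of [ss_quotient_add] is a quotient of B /
    A. *)
Lemma ss_quotient_cap A B C : subm A -> subm B -> subm C -> (A <= B)%VS ->
  ss A B -> ss (A :&: C)%VS (B :&: C)%VS.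
Proof.
move=> sA sB sC AB hs.
have -> : (A :&: C = (B :&: C) :&: A)%VS.
  by rewrite -capvA [(C :&: A)%VS]capvC capvA (capv_idPr AB).
apply: ss_quotient_addr; auto.
apply: (ss_quotient_sub _ _ _ _ _ hs); auto.
- exact: addvSr.
- by apply: sub_addl => //; exact: capvSl.
Qed.

Lemma ss_quotient_add A B C : subm A -> subm B -> subm C -> (A <= B)%VS ->
  ss A B -> ss (A + C)%VS (B + C)%VS.
Proof.
move=> sA sB sC AB hs.
have -> : (B + C = B + (A + C))%VS by rewrite addvA (addv_idPl AB).
apply: ss_quotient_capl; auto.
apply: (ss_quotient_sub _ _ _ _ _ hs); auto.
- by apply: sub_capr => //; exact: addvSl.
- exact: capvSl.
Qed.

(** The complement of W is built in two stages: X1 inside B1 against W, then X2 inside B2 against W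
    + X1. *)
Lemma ss_quotient_addB A B1 B2 : subm A -> subm B1 -> subm B2 ->
  (A <= B1)%VS -> (A <= B2)%VS -> ss A B1 -> ss A B2 -> ss A (B1 + B2)%VS.
Proof.
move=> sA sB1 sB2 AB1 AB2 h1 h2 W sW AW WB.
have [|||X1 [sX1 AX1 XB1 e1 c1]] := h1 (W :&: B1)%VS; auto.
- exact: sub_capr.
- exact: capvSr.
have [|||X2 [sX2 AX2 XB2 e2 c2]] := h2 ((W + X1) :&: B2)%VS; auto.
- by apply: sub_capr => //; apply: subv_trans AW (addvSl _ _).
- exact: capvSr.
exists (X1 + X2)%VS; split; auto.
- by apply: subv_trans AX1 (addvSl _ _).
- by apply: addvS.
- apply: subv_eq; first by apply: sub_addl => //; apply: addvS.
  rewrite addvA; apply: sub_addl.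
    by rewrite -{1}e1; apply: subv_trans (addvSl _ _);
       apply: addvS => //; exact: capvSl.
  by rewrite -{1}e2; apply: addvS => //; exact: capvSl.
- apply: subv_eq; last by apply: sub_capr => //; apply: subv_trans AX1 (addvSl _ _).
  have c2' : (X2 :&: (W + X1) <= A)%VS.
    rewrite -c2; apply: sub_capr; last exact: capvSl.
    by apply: sub_capr; [exact: capvSr|apply: subv_trans (capvSl _ _) XB2].
  have s1 : (W :&: (X1 + X2) <= X1)%VS.
    apply: (@subv_trans _ _ ((X1 + X2) :&: (W + X1))%VS).
      by rewrite capvC; apply: capvS => //; exact: addvSl.
    rewrite -vspace_modl ?addvSr//; apply: sub_addl => //.
    exact: subv_trans c2' AX1.
  rewrite -c1; apply: sub_capr => //; apply: sub_capr; first exact: capvSl.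
  exact: subv_trans s1 XB1.
Qed.

(** The order dual of [ss_quotient_addB]: X1 over A1 against W, then X2 over A2 against [W :&: X1],
    and the two are intersected. *)
Lemma ss_quotient_capA A1 A2 B : subm A1 -> subm A2 -> subm B ->
  (A1 <= B)%VS -> (A2 <= B)%VS -> ss A1 B -> ss A2 B -> ss (A1 :&: A2)%VS B.
Proof.
move=> sA1 sA2 sB AB1 AB2 h1 h2 W sW AW WB.
have [|||X1 [sX1 AX1 XB1 e1 c1]] := h1 (W + A1)%VS; auto.
- exact: addvSr.
- exact: sub_addl.
have [|||X2 [sX2 AX2 XB2 e2 c2]] := h2 ((W :&: X1) + A2)%VS; auto.
- exact: addvSr.
- by apply: sub_addl => //; apply: subv_trans (capvSl _ _) WB.
have e1' : (W + X1 = B)%VS by rewrite -e1 -addvA (addv_idPr AX1).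
have e2' : (W :&: X1 + X2 = B)%VS by rewrite -e2 -addvA (addv_idPr AX2).
exists (X1 :&: X2)%VS; split; auto.
- by apply: capvS.
- by apply: subv_trans (capvSl _ _) XB1.
- have x1 : (X1 <= W + X1 :&: X2)%VS.
    rewrite -{1}(capv_idPr XB1) -e2' -vspace_modl ?capvSr//.
    by rewrite [(X2 :&: _)%VS]capvC; apply: addvS => //; exact: capvSl.
  apply: subv_eq.
    by apply: sub_addl => //; apply: subv_trans (capvSl _ _) XB1.
  by rewrite -{1}e1'; apply: sub_addl => //; exact: addvSl.
- apply: subv_eq; last by apply: sub_capr => //; apply: capvS.
  apply: sub_capr.
    rewrite -c1; apply: capvS; [exact: addvSl|exact: capvSl].
  rewrite -c2 capvA; apply: capvS => //; exact: addvSl.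
Qed.

Lemma submodule_big (I : Type) (r : seq I) (F : I -> {vspace V}) :
  (forall i, subm (F i)) -> subm (\sum_(i <- r) F i)%VS.
Proof.
by move=> h; elim/big_rec: _ => // i x _ hx; apply: submodule_add.
Qed.

Lemma ss_quotient_big (I : Type) (r : seq I) A (F : I -> {vspace V}) : subm A ->
  (forall i, subm (F i)) ->
  (forall i, ss A (A + F i)%VS) -> ss A (A + \sum_(i <- r) F i)%VS.
Proof.
move=> sA sF h; elim: r => [|i r IH]; first by rewrite big_nil addv0;
  exact: ss_quotient_refl.
have sS := @submodule_big _ r _ sF.
rewrite big_cons (_ : (A + _ = (A + F i) + (A + \sum_(j <- r) F j))%VS).
  by apply: ss_quotient_addB; auto; exact: addvSl.
by rewrite -addvA [(F i + (A + _))%VS]addvA [(F i + A)%VS]addvC -addvA [RHS]addvA addvv.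
Qed.

(** A proper submodule of greatest dimension has a simple quotient: between M and B there are only M
    and B. *)
Lemma ex_maximal_submodule A B : subm A -> subm B -> (A <= B)%VS -> A <> B ->
  exists M, [/\ subm M, (A <= M)%VS, (M <= B)%VS, M <> B & ss M B].
Proof.
move=> sA sB AB nAB.
pose P n := `[< exists M, [/\ subm M, (A <= M)%VS, (M <= B)%VS, M <> B
                          & \dim M = n] >].
have exn : exists n, P n by exists (\dim A); apply/asboolP; exists A.
case: (@ex_maxnP P (\dim {:V}) exn) => [n /asboolP[U [_ _ _ _ <-]]|n].
  exact: dimv_le_fullv.
move=> /asboolP[M [sM AM MB nMB dM]] nmax; exists M; split=> // W sW MW WB.
have [eWB|/eqP nWB] := eqVneq W B.
  exists M; split=> //; first by rewrite eWB; apply/addv_idPl.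
  by apply/capv_idPr.
exists B; split=> //; first exact/addv_idPr.
rewrite (capv_idPl WB); apply: subv_eq => //.
have /eqP -> // : M == W.
rewrite eqEdim MW dM; apply: nmax; apply/asboolP.
by exists W; split => //; exact: subv_trans AM MW.
Qed.

End SubmoduleLattice.

(** * Socle and radical series *)

Section Transport.
Variables (K : fieldType) (g g' : Type) (V V' : vectType K).
Variables (f : g -> 'End(V)) (f' : g' -> 'End(V')) (h : 'Hom(V, V')).
Hypothesis fh : forall x, exists x', forall v, h (f x v) = f' x' (h v).
Hypothesis hf : forall x', exists x, forall v, h (f x v) = f' x' (h v).
Implicit Types (A B W : {vspace V}).

Lemma limgK A : (lker h <= A)%VS -> (h @^-1: (h @: A) = A)%VS.
Proof.
move=> kA; apply: subv_eq; apply/subvP => v; rewrite -memv_preim; last exact: memv_img.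
move=> /memv_imgP[u uA e]; rewrite -(subrK u v) memvD //.
by apply: (subvP kA); rewrite memv_ker linearB /= e subrr.
Qed.

Lemma lker_sub_preim (W : {vspace V'}) : (lker h <= h @^-1: W)%VS.
Proof. by rewrite -lpreim0 lpreimS // sub0v. Qed.

Lemma submodule_img W : submodule f W -> submodule f' (h @: W)%VS.
Proof.
move=> sW x' _ /memv_imgP[v vW ->]; have [x e] := hf x'.
by rewrite -e memv_img // sW.
Qed.

Lemma submodule_preim (W : {vspace V'}) :
  submodule f' W -> submodule f (h @^-1: W)%VS.
Proof.
move=> sW x v; rewrite -!memv_preim => vW; have [x' ->] := fh x.
exact: sW.
Qed.

Lemma limg_cap_ker A B : (lker h <= A)%VS ->
  (h @: (A :&: B) = h @: A :&: h @: B)%VS.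
Proof.
move=> kA; apply: subv_eq; first exact: limg_cap.
apply/subvP => w; rewrite memv_cap => /andP[hA /memv_imgP[b bB e]].
have bA : b \in A by rewrite -(limgK kA) -memv_preim -e.
rewrite e {hA e}.
by rewrite memv_img // memv_cap bA.
Qed.

(** Correspondence theorem: as A contains the kernel of h, image and preimage match the submodules
    between A and B with those between their images. The acting sets g and g' may differ, as for d
    acting on l through d -> l; only the families of operators must correspond. *)
Lemma ss_quotient_img A B : submodule f A -> submodule f B ->
  (lker h <= A)%VS -> (A <= B)%VS ->
  ss_quotient f A B -> ss_quotient f' (h @: A)%VS (h @: B)%VS.
Proof.
move=> sA sB kA AB hs W sW AW WB.
have kB := subv_trans kA AB.
have WE : (h @: (h @^-1: W) = W)%VS.
  by apply: lpreimK; apply: subv_trans WB _; apply: limgS; exact: subvf.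
have [|||X [sX AX XB e c]] := hs (h @^-1: W)%VS.
- exact: submodule_preim.
- by rewrite -(limgK kA) lpreimS.
- by rewrite -(limgK kB) lpreimS.
exists (h @: X)%VS; split; try exact: limgS.
- exact: submodule_img.
- by rewrite -e limgD WE.
- by rewrite -c limg_cap_ker ?WE // lker_sub_preim.
Qed.

Lemma ss_quotient_preim A B : submodule f A -> submodule f B ->
  (lker h <= A)%VS -> (A <= B)%VS ->
  ss_quotient f' (h @: A)%VS (h @: B)%VS -> ss_quotient f A B.
Proof.
move=> sA sB kA AB hs W sW AW WB.
have kB := subv_trans kA AB; have kW := subv_trans kA AW.
have [|||X [sX AX XB e c]] := hs (h @: W)%VS; try exact: limgS.
  exact: submodule_img.
have XE : (h @: (h @^-1: X) = X)%VS.
  by apply: lpreimK; apply: subv_trans XB _; apply: limgS; exact: subvf.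
exists (h @^-1: X)%VS; split.
- exact: submodule_preim.
- by rewrite -(limgK kA) lpreimS.
- by rewrite -(limgK kB) lpreimS.
- rewrite -(limgK kB) -e -{2}XE -limgD limgK //.
  by apply: subv_trans kW _; exact: addvSl.
- rewrite -(limgK kA) -c -{2}XE -limg_cap_ker // limgK //.
  by apply: sub_capr => //; exact: lker_sub_preim.
Qed.

End Transport.

(** * Submodules and quotients as modules in their own right *)

Section SubQuotientModules.
Variables (K : fieldType) (g : Type) (V : vectType K) (f : g -> 'End(V)).
Implicit Types (A B U W : {vspace V}).

Local Notation subm := (submodule f).
Local Notation ss := (ss_quotient f).

Lemma sub_inclE U (w : subvs_of U) : sub_incl U w = vsval w.
Proof. by rewrite /sub_incl lfunE. Qed.

Lemma lker_sub_incl U : lker (sub_incl U) = 0%VS.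
Proof.
by apply/eqP/lker0P => u v; rewrite !sub_inclE; exact: subvs_inj.
Qed.

Lemma limg_sub_incl U : limg (sub_incl U) = U.
Proof.
apply: subv_eq; apply/subvP => v.
  by move=> /memv_imgP[w _ ->]; rewrite sub_inclE subvsP.
by move=> vU; rewrite -(vsprojK vU) -sub_inclE memv_img // memvf.
Qed.

Lemma sub_actE U x (w : subvs_of U) : subm U ->
  vsval (sub_act f U x w) = f x (vsval w).
Proof.
move=> sU; rewrite /sub_act !comp_lfunE sub_inclE lfunE /= vsprojK //.
by apply: sU; exact: subvsP.
Qed.

Lemma sub_act_equivariant U x : subm U ->
  forall w : subvs_of U, sub_incl U (sub_act f U x w) = f x (sub_incl U w).
Proof. by move=> sU w; rewrite !sub_inclE sub_actE. Qed.

Lemma quot_projE U v : vsval (quot_proj U v) = daddv_pi (U^C)%VS U v.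
Proof. by rewrite /quot_proj comp_lfunE lfunE /= vsprojK // memv_pi. Qed.

Lemma sub_quot_proj U v : v - vsval (quot_proj U v) \in U.
Proof.
have cU : (U^C :&: U = 0)%VS by rewrite capvC capv_compl.
have vUU : v \in (U^C + U)%VS by rewrite addvC addv_complf memvf.
rewrite quot_projE -{1}(daddv_pi_add cU vUU) addrC addKr.
exact: memv_pi.
Qed.

Lemma lker_quot_proj U : lker (quot_proj U) = U.
Proof.
apply: subv_eq; apply/subvP => v.
  rewrite memv_ker => /eqP e; have := sub_quot_proj U v.
  by rewrite e linear0 addr0.
move=> vU; rewrite memv_ker; apply/eqP/subvs_inj; rewrite linear0.
have h : vsval (quot_proj U v) \in U.
  by rewrite -[vsval _](subKr v) memvB // sub_quot_proj.
have := subvsP (quot_proj U v).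
by move=> h'; apply/eqP; rewrite -memv0 -(capv_compl U) memv_cap h.
Qed.

Lemma limg_quot_proj U : limg (quot_proj U) = fullv.
Proof.
apply: subv_eq; first exact: subvf.
apply/subvP => w _; have -> : w = quot_proj U (vsval w).
  apply: subvs_inj; rewrite quot_projE daddv_pi_id //; last exact: subvsP.
  by rewrite capvC capv_compl.
by rewrite memv_img // memvf.
Qed.

Lemma quot_act_equivariant U x : subm U ->
  forall v, quot_proj U (f x v) = quot_act f U x (quot_proj U v).
Proof.
move=> sU v; rewrite /quot_act comp_lfunE [in RHS]comp_lfunE [linfun vsval _]lfunE /=.
apply/eqP; rewrite -subr_eq0 -(linearB (quot_proj U)).
by rewrite -(linearB (f x)) -memv_ker lker_quot_proj sU // sub_quot_proj.
Qed.

Lemma semisimpleE : semisimple f <-> ss 0%VS fullv.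
Proof.
split=> h U sU.
  move=> _ _; have [X [sX e c]] := h U sU.
  by exists X; split => //; [exact: sub0v|exact: subvf].
have [||X [sX _ _ e c]] := h U sU; [exact: sub0v|exact: subvf|by exists X].
Qed.

End SubQuotientModules.

(** * Socle and radical as extremal submodules *)

Section SocleRadical.
Variables (K : fieldType) (g : Type) (V : vectType K) (f : g -> 'End(V)).
Implicit Types (A B U W : {vspace V}).

Local Notation subm := (submodule f).
Local Notation ss := (ss_quotient f).

Lemma semisimple_sub U : subm U -> semisimple (sub_act f U) <-> ss 0%VS U.
Proof.
move=> sU; rewrite semisimpleE.
have -> : ss 0%VS U <-> ss (sub_incl U @: 0)%VS (sub_incl U @: fullv)%VS.
  by rewrite limg0 limg_sub_incl.
have [eq1 eq2] : (forall x, exists x', forall v, sub_incl U (sub_act f U x v)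
    = f x' (sub_incl U v)) /\ (forall x', exists x, forall v,
    sub_incl U (sub_act f U x v) = f x' (sub_incl U v)).
  by split=> x; exists x => v; exact: sub_act_equivariant.
split.
  apply: (ss_quotient_img eq1 eq2); [exact: submodule_0|exact: submodule_full| |].
    by rewrite lker_sub_incl subvv.
  exact: sub0v.
apply: (ss_quotient_preim eq1 eq2); [exact: submodule_0|exact: submodule_full| |].
  by rewrite lker_sub_incl subvv.
exact: sub0v.
Qed.

Lemma quot_act_fh U : subm U ->
  (forall x, exists x', forall v, quot_proj U (f x v)
    = quot_act f U x' (quot_proj U v)) /\ (forall x', exists x, forall v,
    quot_proj U (f x v) = quot_act f U x' (quot_proj U v)).
Proof. by move=> sU; split=> x; exists x => v; exact: quot_act_equivariant. Qed.

Lemma semisimple_quot U : subm U -> semisimple (quot_act f U) <-> ss U fullv.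
Proof.
move=> sU; rewrite semisimpleE.
have -> : ss_quotient (quot_act f U) 0%VS fullv <->
    ss_quotient (quot_act f U) (quot_proj U @: U)%VS (quot_proj U @: fullv)%VS.
  rewrite limg_quot_proj; have /eqP -> // : (quot_proj U @: U == 0)%VS.
  by rewrite -lkerE lker_quot_proj.
have [eq1 eq2] := quot_act_fh sU.
split.
  apply: (ss_quotient_preim eq1 eq2) => //; [exact: submodule_full| |exact: subvf].
  by rewrite lker_quot_proj.
apply: (ss_quotient_img eq1 eq2) => //; [exact: submodule_full| |exact: subvf].
by rewrite lker_quot_proj.
Qed.

Lemma socleP : [/\ subm (socle f), ss 0%VS (socle f)
  & forall U, subm U -> ss 0%VS U -> (U <= socle f)%VS].
Proof.
have [[h1 h2] h3] := @greatestP _ _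
  (fun U => subm U /\ semisimple (sub_act f U)) 0%VS
  ltac:(by split; [exact: submodule_0|apply/semisimple_sub;
     [exact: submodule_0|exact: ss_quotient_refl]])
  ltac:(move=> U W [sU hU] [sW hW]; have sUW := submodule_add sU sW; split=> //;
   by apply/semisimple_sub => //; apply: ss_quotient_addB => //;
    [exact: submodule_0|exact: sub0v|exact: sub0v|exact/semisimple_sub
    |exact/semisimple_sub]).
split=> //; first exact/semisimple_sub.
by move=> U sU hU; apply: h3; split=> //; apply/semisimple_sub.
Qed.

Lemma radicalP : [/\ subm (radical f), ss (radical f) fullv
  & forall U, subm U -> ss U fullv -> (radical f <= U)%VS].
Proof.
have [[h1 h2] h3] := @leastP _ _
  (fun U => subm U /\ semisimple (quot_act f U)) fullv
  ltac:(by split; [exact: submodule_full|apply/semisimple_quot;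
     [exact: submodule_full|exact: ss_quotient_refl]])
  ltac:(move=> U W [sU hU] [sW hW]; have sUW := submodule_cap sU sW; split=> //;
   by apply/semisimple_quot => //; apply: ss_quotient_capA => //;
    [exact: submodule_full|exact: subvf|exact: subvf|exact/semisimple_quot
    |exact/semisimple_quot]).
split=> //; first exact/semisimple_quot.
by move=> U sU hU; apply: h3; split=> //; apply/semisimple_quot.
Qed.

End SocleRadical.

Section Series.
Variables (K : fieldType) (g : Type) (V : vectType K) (f : g -> 'End(V)).
Implicit Types (A B U W : {vspace V}).

Local Notation subm := (submodule f).
Local Notation ss := (ss_quotient f).
Local Notation Soc := (socle_series f).
Local Notation Rad := (radical_series f).

Lemma submodule_socle_series k : subm (Soc k).
Proof.
elim: k => [|k IH]; first exact: submodule_0.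
have [eq1 eq2] := quot_act_fh IH.
apply: (submodule_preim eq1); by case: (socleP (quot_act f (Soc k))).
Qed.

(** Characterises S_(k+1) inside V, without quotient spaces; with [radical_seriesP] for R_(k+1),
    this is the form in which the two series are used from here on. *)
Lemma socle_seriesP k : [/\ (Soc k <= Soc k.+1)%VS, ss (Soc k) (Soc k.+1)
  & forall U, subm U -> (Soc k <= U)%VS -> ss (Soc k) U -> (U <= Soc k.+1)%VS].
Proof.
have sk := @submodule_socle_series k; have sk1 := @submodule_socle_series k.+1.
have [eq1 eq2] := quot_act_fh sk.
have [h1 h2 h3] := socleP (quot_act f (Soc k)).
have le : (Soc k <= Soc k.+1)%VS by rewrite -{1}(lker_quot_proj (Soc k)) /=
  lker_sub_preim.
have img0 : (quot_proj (Soc k) @: Soc k = 0)%VS.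
  by apply/eqP; rewrite -lkerE lker_quot_proj.
split=> //.
  apply: (ss_quotient_preim eq1 eq2) => //; first by rewrite lker_quot_proj.
  by rewrite img0 /= lpreimK // limg_quot_proj subvf.
move=> U sU kU hU.
have kU' : (lker (quot_proj (Soc k)) <= U)%VS by rewrite lker_quot_proj.
rewrite -(limgK kU') /=; apply: lpreimS; apply: h3.
  exact: (submodule_img eq2).
by rewrite -img0; apply: (ss_quotient_img eq1 eq2) => //; rewrite lker_quot_proj.
Qed.

Lemma submodule_radical_series k : subm (Rad k).
Proof.
elim: k => [|k IH]; first exact: submodule_full.
apply: (@submodule_img _ g g _ _ (sub_act f (Rad k))).
  by move=> x; exists x => v; exact: sub_act_equivariant.
by case: (radicalP (sub_act f (Rad k))).
Qed.

Lemma radical_seriesP k : [/\ (Rad k.+1 <= Rad k)%VS, ss (Rad k.+1) (Rad k)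
  & forall U, subm U -> (U <= Rad k)%VS -> ss U (Rad k) -> (Rad k.+1 <= U)%VS].
Proof.
have sk := @submodule_radical_series k; have sk1 := @submodule_radical_series k.+1.
have [eq1 eq2] : (forall x, exists x', forall v, sub_incl (Rad k)
    (sub_act f (Rad k) x v) = f x' (sub_incl (Rad k) v)) /\
    (forall x', exists x, forall v,
    sub_incl (Rad k) (sub_act f (Rad k) x v) = f x' (sub_incl (Rad k) v)).
  by split=> x; exists x => v; exact: sub_act_equivariant.
have [h1 h2 h3] := radicalP (sub_act f (Rad k)).
have le : (Rad k.+1 <= Rad k)%VS.
  by rewrite -[X in (_ <= X)%VS]limg_sub_incl /=; apply: limgS; exact: subvf.
split=> //.
  rewrite -[X in ss _ X]limg_sub_incl /=; apply: (ss_quotient_img eq1 eq2) => //.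
  - exact: submodule_full.
  - by rewrite lker_sub_incl sub0v.
  - exact: subvf.
move=> U sU kU hU.
have UE : (sub_incl (Rad k) @: (sub_incl (Rad k) @^-1: U) = U)%VS.
  by apply: lpreimK; rewrite limg_sub_incl.
rewrite -UE /=; apply: limgS; apply: h3.
  exact: (submodule_preim eq1).
apply: (ss_quotient_preim eq1 eq2) => //.
- exact: (submodule_preim eq1).
- exact: submodule_full.
- by rewrite lker_sub_incl sub0v.
- exact: subvf.
- by rewrite UE limg_sub_incl.
Qed.

Lemma socle_series_homo i j : (i <= j)%N -> (Soc i <= Soc j)%VS.
Proof.
move=> /subnK <-; elim: (_ - _)%N => [|n IH]; first by rewrite add0n.
by rewrite addSn; apply: subv_trans IH _; case: (socle_seriesP (n + i)).
Qed.

Lemma radical_series_homo i j : (i <= j)%N -> (Rad j <= Rad i)%VS.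
Proof.
move=> /subnK <-; elim: (_ - _)%N => [|n IH]; first by rewrite add0n.
by rewrite addSn; apply: subv_trans _ IH; case: (radical_seriesP (n + i)).
Qed.

(** A nonzero module has a maximal proper submodule, whose quotient is simple; the radical lies in
    it. *)
Lemma radical_series_lt k : Rad k <> 0%VS -> (\dim (Rad k.+1) < \dim (Rad k))%N.
Proof.
move=> nz; have [le _ least] := radical_seriesP k.
have sk := @submodule_radical_series k.
have [M [sM _ MR nMR hM]] :=
  ex_maximal_submodule (@submodule_0 _ _ _ f) sk (sub0v _) (nesym nz).
have := least M sM MR hM => /dimvS/leq_ltn_trans; apply.
by rewrite ltn_neqAle dimvS // andbT; apply/eqP => e; apply: nMR; apply/eqP;
  rewrite eqEdim MR e leqnn.
Qed.

Lemma radical_series_eq0 : exists n, Rad n = 0%VS.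
Proof.
suff h n : (\dim (Rad n) <= \dim {:V} - n)%N.
  exists (\dim {:V}); apply/eqP; rewrite -dimv_eq0 -leqn0.
  by apply: leq_trans (h _) _; rewrite subnn.
elim: n => [|n IH]; first by rewrite subn0.
have [e|/eqP nz] := eqVneq (Rad n) 0%VS.
  have [le _ _] := radical_seriesP n.
  by have := dimvS le; rewrite e dimv0 leqn0 => /eqP->.
by rewrite subnS -ltnS; apply: leq_trans (radical_series_lt nz) _;
  apply: leq_trans IH _; rewrite leqSpred.
Qed.

End Series.

Section SeriesImage.
Variables (K : fieldType) (g g' : Type) (V V' : vectType K).
Variables (f : g -> 'End(V)) (f' : g' -> 'End(V')) (h : 'Hom(V, V')).
Hypothesis fh : forall x, exists x', forall v, h (f x v) = f' x' (h v).
Hypothesis hf : forall x', exists x, forall v, h (f x v) = f' x' (h v).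

(** The image of R_k / R_(k+1) is semisimple, which gives one inclusion; the preimage of R'_(k+1)
    cut by R_k has a semisimple quotient in R_k, which gives the other. Socles have no such
    property. *)
Lemma limg_radical_series k : limg h = fullv ->
  (h @: radical_series f k)%VS = radical_series f' k.
Proof.
move=> hT; elim: k => [|k IH] //.
have [le1 s1 m1] := radical_seriesP f k; have [le2 s2 m2] := radical_seriesP f' k.
have sk := @submodule_radical_series _ _ _ f k; have sk1 := @submodule_radical_series _ _ _ f k.+1.
have sk' := @submodule_radical_series _ _ _ f' k.
have sk1' := @submodule_radical_series _ _ _ f' k.+1.
have sker : submodule f (lker h).
  by rewrite -lpreim0; apply: (submodule_preim fh); exact: submodule_0.
have kerimg : (h @: lker h = 0)%VS by apply/eqP; rewrite -lkerE subvv.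
apply: subv_eq; last first.
  apply: m2; first exact: (submodule_img hf).
    by rewrite -IH limgS.
  have := ss_quotient_add sk1 sk sker le1 s1.
  move=> /(ss_quotient_img fh hf); rewrite !limgD kerimg !addv0 IH; apply.
  - exact: submodule_add.
  - exact: submodule_add.
  - exact: addvSr.
  - exact: addvS.
have sQ := submodule_preim fh sk1'.
have preimk : (h @^-1: radical_series f' k = radical_series f k + lker h)%VS.
  by rewrite -(@limgK _ _ _ h (_ + _)%VS) ?addvSr // limgD kerimg addv0 IH.
have ssQ : ss_quotient f (h @^-1: radical_series f' k.+1)%VS
                         (h @^-1: radical_series f' k)%VS.
  apply: (ss_quotient_preim fh hf) => //.
  - exact: (submodule_preim fh).
  - exact: lker_sub_preim.
  - exact: lpreimS.
  - by rewrite !lpreimK // hT subvf.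
have Rle : (radical_series f k.+1 <= (h @^-1: radical_series f' k.+1)
             :&: radical_series f k)%VS.
  apply: m1; [exact: submodule_cap|exact: capvSr|].
  have := ss_quotient_cap sQ (submodule_preim fh sk') sk (lpreimS _ le2) ssQ.
  by rewrite preimk (capv_idPr (addvSl _ _)).
apply: subv_trans (limgS _ Rle) _; apply: subv_trans (limg_cap _ _ _) _.
by apply: subv_trans (capvSl _ _) _; rewrite lpreimK // hT subvf.
Qed.

End SeriesImage.

(** * Duality and orthogonality *)

Section LinearAlgebra.
Variable K : fieldType.

Lemma linfunE (U W : vectType K) (h : U -> W) : linear h -> linfun h =1 h.
Proof.
move=> hl; pose hL : {linear U -> W} := HB.pack h (GRing.isLinear.Build K U W _ h hl).
exact: (lfunE hL).
Qed.

Lemma dim_dualv (V : vectType K) : \dim {: dualv V} = \dim {:V}.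
Proof. by rewrite !dimvf [LHS]muln1. Qed.

Definition dual_restr (V : vectType K) (U : {vspace V}) :
    'Hom(dualv V, dualv (subvs_of U)) :=
  linfun (fun phi : dualv V => (phi \o sub_incl U)%VF).

Lemma dual_restrE (V : vectType K) (U : {vspace V}) (phi : dualv V) w :
  dual_restr U phi w = phi (vsval w).
Proof.
rewrite /dual_restr linfunE ?comp_lfunE ?sub_inclE //.
by move=> k u v; rewrite comp_lfunDl -comp_lfunZl.
Qed.

Lemma mem_lker_dual_restr (V : vectType K) (U : {vspace V}) (phi : dualv V) :
  (phi \in lker (dual_restr U)) <-> forall u, u \in U -> phi u = 0.
Proof.
rewrite memv_ker; split=> [/eqP e u uU|h].
  by rewrite -(vsprojK uU) -dual_restrE e zero_lfunE.
by apply/eqP/lfunP => w; rewrite dual_restrE zero_lfunE h // subvsP.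
Qed.

Lemma dim_annihilator (V : vectType K) (U : {vspace V}) :
  (\dim U + \dim (lker (dual_restr U)) = \dim {:V})%N.
Proof.
have := limg_ker_dim (dual_restr U) fullv; rewrite capfv dim_dualv.
suff -> : limg (dual_restr U) = fullv by rewrite dim_dualv dimvf addnC.
apply: subv_eq; first exact: subvf.
apply/subvP => psi _.
have -> : psi = dual_restr U (psi \o linfun (vsproj U))%VF.
  by apply/lfunP => w; rewrite dual_restrE comp_lfunE lfunE /= vsvalK.
by rewrite memv_img // memvf.
Qed.

(** Otherwise U and [U + <[w]>] would have the same annihilator, against the dimension count. *)
Lemma ex_functional (V : vectType K) (U : {vspace V}) w : w \notin U ->
  exists phi : dualv V, (forall u, u \in U -> phi u = 0) /\ phi w != 0.
Proof.
move=> wU; apply: contrapT => nphi.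
pose W := (U + <[w]>)%VS.
have UW : (U <= W)%VS by exact: addvSl.
have : (lker (dual_restr U) <= lker (dual_restr W))%VS.
  apply/subvP => phi /mem_lker_dual_restr h; apply/mem_lker_dual_restr => x.
  move=> /memv_addP[u uU [_ /vlineP[k ->] ->]]; rewrite linearD linearZ /= h // add0r.
  have [->|nz] := eqVneq (phi w) 0; first by rewrite scaler0.
  by case: nphi; exists phi; split.
move=> /dimvS le; have e1 := dim_annihilator U; have e2 := dim_annihilator W.
have dWU : (\dim W <= \dim U)%N.
  by rewrite -(leq_add2r (\dim (lker (dual_restr W)))) e2 -e1 leq_add2l.
have /eqP e : U == W by rewrite eqEdim UW.
move/negP: wU; apply; rewrite e; apply: (subvP (addvSr _ _)); exact: memv_line.
Qed.

Lemma lfun_factor (E U W : vectType K) (T : 'Hom(E, U)) (h : 'Hom(E, W)) :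
  (lker T <= lker h)%VS -> exists s : 'Hom(U, W), forall x, h x = s (T x).
Proof.
move=> le; exists (h \o T^-1)%VF => x; rewrite comp_lfunE.
apply/eqP; rewrite -subr_eq0 -linearB -memv_ker; apply: (subvP le).
by rewrite memv_ker linearB /= subr_eq0 limg_lfunVK // memv_img // memvf.
Qed.

Lemma vbasis_ind (V : vectType K) (P : V -> Prop) :
  P 0 -> (forall k (u v : V), P u -> P v -> P (k *: u + v)) ->
  (forall i : 'I_(\dim {:V}), P (vbasis {:V})`_i) -> forall v : V, P v.
Proof.
move=> P0 Plin Pb v; rewrite (coord_vbasis (memvf v)).
apply: (big_ind P) => // [x y hx hy|i _]; first by rewrite -[x]scale1r; exact: Plin.
by rewrite -[_ *: _]addr0; exact: Plin.
Qed.

(** The section is linear but in general not equivariant. If U is a submodule, its defect of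
    equivariance lies in U and in the kernel of h; lifts are compared in this way below. *)
Lemma ex_section (V W : vectType K) (h : 'Hom(V, W)) (U : {vspace V}) :
  exists s : 'Hom(W, V), forall x : W, x \in (h @: U)%VS -> s x \in U /\ h (s x) = x.
Proof.
pose hU := (h \o sub_incl U)%VF.
exists (sub_incl U \o hU^-1)%VF => X XU; rewrite comp_lfunE sub_inclE subvsP; split=> //.
rewrite -sub_inclE -comp_lfunE limg_lfunVK // /hU limg_comp limg_sub_incl //.
Qed.

End LinearAlgebra.

Section Orthogonal.
Variables (K : fieldType) (V : vectType K) (b : 'Hom(V, dualv V)).
Hypothesis bC : forall v w, b v w = b w v.
Implicit Types (U W : {vspace V}).

(** The form may be degenerate: besides the forms on a and d this is applied to a trace form, hence
    the hypotheses [lker b <= U] below. *)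
Definition orthv U : {vspace V} :=
  subspace (fun v => forall u, u \in U -> b v u = 0).

Lemma mem_orthv U v : (v \in orthv U) <-> forall u, u \in U -> b v u = 0.
Proof.
apply: mem_subspace => [u _|k x y hx hy u uU]; first by rewrite linear0 zero_lfunE.
by rewrite linearP add_lfunE scale_lfunE hx // hy // scaler0 addr0.
Qed.

Lemma orthvS U W : (U <= W)%VS -> (orthv W <= orthv U)%VS.
Proof.
move=> UW; apply/subvP => v /mem_orthv h; apply/mem_orthv => u uU.
by apply: h; exact: (subvP UW).
Qed.

Lemma orthv_sub U W : (U <= orthv W)%VS -> (W <= orthv U)%VS.
Proof.
move=> h; apply/subvP => w wW; apply/mem_orthv => u uU.
by rewrite bC; have /mem_orthv := subvP h _ uU; apply.
Qed.

Lemma orthvD U W : (orthv (U + W) = orthv U :&: orthv W)%VS.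
Proof.
apply: subv_eq; first by apply: sub_capr; apply: orthvS; [exact: addvSl|exact: addvSr].
apply/subvP => v; rewrite memv_cap => /andP[/mem_orthv hU /mem_orthv hW].
by apply/mem_orthv => _ /memv_addP[u uU [w wW ->]]; rewrite linearD /= hU // hW // addr0.
Qed.

Lemma ker_orthv U : (lker b <= orthv U)%VS.
Proof.
apply/subvP => v; rewrite memv_ker => /eqP e; apply/mem_orthv => u _.
by rewrite e zero_lfunE.
Qed.

Lemma form_represent (phi : dualv V) :
  (forall u, u \in lker b -> phi u = 0) -> exists v, b v = phi.
Proof.
move=> h; have h' : phi \in lker (dual_restr (lker b)) by apply/mem_lker_dual_restr.
suff e : limg b = lker (dual_restr (lker b)).
  by move: h'; rewrite -e => /memv_imgP[v _ ->]; exists v.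
apply/eqP; rewrite eqEdim; apply/andP; split.
  apply/subvP => _ /memv_imgP[v _ ->]; apply/mem_lker_dual_restr => u.
  by rewrite memv_ker bC => /eqP->; rewrite zero_lfunE.
have := limg_ker_dim b fullv; rewrite capfv => e1.
by rewrite -(leq_add2l (\dim (lker b))) dim_annihilator e1.
Qed.

(** A vector outside U is separated from U by a functional; this vanishes on the kernel of b, so it
    is b v for some v orthogonal to U. *)
Lemma orthvK U : (lker b <= U)%VS -> orthv (orthv U) = U.
Proof.
move=> kU; apply: subv_eq; last by apply: orthv_sub.
apply/subvP => w /mem_orthv hw; apply: contrapT => /negP wU.
have [phi [h nz]] := ex_functional wU.
have [v e] : exists v, b v = phi.
  by apply: form_represent => u uk; apply: h; exact: (subvP kU).
move/negP: nz; apply; apply/eqP; rewrite -e bC; apply: hw.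
by apply/mem_orthv => u uU; rewrite e h.
Qed.

Lemma orthv_cap U W : (lker b <= U)%VS -> (lker b <= W)%VS ->
  (orthv (U :&: W) = orthv U + orthv W)%VS.
Proof.
move=> kU kW; rewrite -{1}(orthvK kU) -{1}(orthvK kW) -orthvD orthvK //.
by apply: subv_trans (addvSl _ _); exact: ker_orthv.
Qed.

Lemma orthv0 : orthv 0%VS = fullv.
Proof.
apply: subv_eq; first exact: subvf.
by apply/subvP => v _; apply/mem_orthv => u; rewrite memv0 => /eqP->; rewrite linear0.
Qed.

Lemma orthvf : orthv fullv = lker b.
Proof.
apply: subv_eq; last exact: ker_orthv.
apply/subvP => v /mem_orthv h; rewrite memv_ker; apply/eqP/lfunP => u.
by rewrite h ?memvf // zero_lfunE.
Qed.

Lemma nondegenerate_lker : (forall v, (forall w, b v w = 0) -> v = 0) -> lker b = 0%VS.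
Proof.
move=> nd; apply: subv_eq; last exact: sub0v.
apply/subvP => v; rewrite memv_ker memv0 => /eqP e; apply/eqP; apply: nd => w.
by rewrite e zero_lfunE.
Qed.

Section Action.
Variables (g : Type) (f : g -> 'End(V)).
Hypothesis skew : forall x v w, b (f x v) w = - b v (f x w).

Lemma submodule_orthv U : submodule f U -> submodule f (orthv U).
Proof.
move=> sU x v /mem_orthv h; apply/mem_orthv => u uU.
by rewrite skew h ?oppr0 // sU.
Qed.

(** On submodules containing the kernel of b, taking orthogonals reverses inclusions and exchanges
    sums with intersections, so it carries complements to complements. *)
Lemma ss_quotient_orthv A B : submodule f A -> submodule f B -> (lker b <= A)%VS ->
  (A <= B)%VS -> ss_quotient f A B -> ss_quotient f (orthv B) (orthv A).
Proof.
move=> sA sB kA AB hs W sW BW WA.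
have kB := subv_trans kA AB.
have kW : (lker b <= W)%VS by apply: subv_trans BW; exact: ker_orthv.
have [|||X [sX AX XB e c]] := hs (orthv W).
- exact: submodule_orthv.
- exact: orthv_sub.
- by rewrite -(orthvK kB); apply: orthvS.
have kX : (lker b <= X)%VS by apply: subv_trans kA AX.
have kOW : (lker b <= orthv W)%VS by exact: ker_orthv.
exists (orthv X); split.
- exact: submodule_orthv.
- exact: orthvS.
- exact: orthvS.
- by rewrite -c orthv_cap // orthvK.
- by rewrite -e orthvD orthvK.
Qed.

Lemma orthv_radical_series : lker b = 0%VS -> forall k,
  orthv (radical_series f k) = socle_series f k.
Proof.
move=> k0; elim=> [|k IH]; first by rewrite /= orthvf.
have b0 U : (lker b <= U)%VS by rewrite k0 sub0v.
have [le1 s1 m1] := radical_seriesP f k; have [le2 s2 m2] := socle_seriesP f k.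
have sRk := @submodule_radical_series _ _ _ f k.
have sR := @submodule_radical_series _ _ _ f k.+1.
have sS := @submodule_socle_series _ _ _ f k.+1.
have sSk := @submodule_socle_series _ _ _ f k.
apply: subv_eq.
  apply: m2; [exact: submodule_orthv|by rewrite -IH orthvS|].
  by rewrite -IH; exact: ss_quotient_orthv.
apply: orthv_sub; apply: m1; first exact: submodule_orthv.
  by rewrite -(orthvK (b0 (radical_series f k))) IH orthvS.
by rewrite -(orthvK (b0 (radical_series f k))) IH; exact: ss_quotient_orthv.
Qed.

End Action.
End Orthogonal.

(** * Cartan's criterion *)

Section MatrixCartan.
Variable C : numClosedFieldType.

(** Chinese remainder theorem for the pairwise coprime moduli [('X - x%:P) ^+ m]. *)
Lemma interpolation (s : seq C) (m : nat) (v : C -> C) : uniq s ->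
  exists Q : {poly C}, forall x, x \in s -> ('X - x%:P) ^+ m %| Q - (v x)%:P.
Proof.
elim: s => [|x s IH] /=; first by exists 0.
move=> /andP[xs /IH[Q HQ]].
pose M := \prod_(y <- s) ('X - y%:P) ^+ m.
have cop : coprimep M (('X - x%:P) ^+ m).
  rewrite /M coprimep_expr // coprimep_XsubC rootE horner_prod.
  rewrite prodf_seq_neq0; apply/allP => y ys /=.
  rewrite horner_exp hornerXsubC expf_eq0 subr_eq0 negb_and.
  by apply/orP; right; apply: contraNneq xs => ->.
have /Bezout_eq1_coprimepP[[u w] /= e] := cop.
(* By the Bezout relation [u * M] is 0 modulo M and 1 modulo the new factor, so Q is corrected at x
   only. *)
exists (Q + ((v x)%:P - Q) * (u * M)) => y; rewrite inE => /orP[/eqP->|ys].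
  have -> : Q + ((v x)%:P - Q) * (u * M) - (v x)%:P
      = (Q - (v x)%:P) * w * ('X - x%:P) ^+ m.
    have -> : u * M = 1 - w * ('X - x%:P) ^+ m by rewrite -e addrK.
    by move: (_ ^+ m) (v x)%:P => G c; ring.
  exact: dvdp_mulIr.
have dM : ('X - y%:P) ^+ m %| M.
  rewrite /M; elim: (s) ys => // z t IHt; rewrite inE big_cons => /orP[/eqP->|/IHt].
    exact: dvdp_mulIl.
  by move=> h; apply: dvdp_mull.
rewrite addrAC; apply: dvdp_add; first exact: HQ.
by rewrite mulrA; apply: dvdp_mull.
Qed.

Lemma trig_mulmx_diag n (A B : 'M[C]_n) : is_trig_mx A -> is_trig_mx B ->
  is_trig_mx (A *m B) /\ forall i, (A *m B) i i = A i i * B i i.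
Proof.
move=> /is_trig_mxP tA /is_trig_mxP tB; split.
  apply/is_trig_mxP => i j ij; rewrite mxE big1 // => k _.
  have [ik|ki] := ltnP i k; first by rewrite tA ?mul0r.
  by rewrite tB ?mulr0 //; exact: leq_ltn_trans ki ij.
move=> i; rewrite mxE (bigD1 i) //= big1 ?addr0 // => k; rewrite neq_ltn => /orP[ki|ik].
  by rewrite tB ?mulr0.
by rewrite tA ?mul0r.
Qed.

Lemma trig_horner_mx n (A : 'M[C]_n.+1) (P : {poly C}) : is_trig_mx A ->
  is_trig_mx (horner_mx A P) /\ forall i, (horner_mx A P) i i = P.[A i i].
Proof.
move=> tA; elim/poly_ind: P => [|P c [tP dP]].
  rewrite rmorph0; split; first exact: mx0_is_trig.
  by move=> i; rewrite mxE horner0.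
have [tPA dPA] := trig_mulmx_diag tP tA.
rewrite rmorphD rmorphM /= horner_mx_X horner_mx_C; split.
  apply/is_trig_mxP => i j ij; rewrite mxE (is_trig_mxP tPA) // add0r.
  by rewrite mxE -val_eqE /= ltn_eqF // mulr0n.
by move=> i; rewrite mxE dPA dP !mxE eqxx mulr1n hornerD hornerMX hornerC.
Qed.

(** After Schur triangularisation the trace is the sum of |t|^2 over the diagonal entries t. If it
    vanishes, they are all 0 and Cayley-Hamilton gives nilpotency. *)
Lemma nilpotent_of_trace n (X : 'M[C]_n.+1) (P : {poly C}) :
  (forall x, root (char_poly X) x -> P.[x] = x^*) ->
  \tr (X *m horner_mx X P) = 0 -> X ^+ n.+1 = 0.
Proof.
move=> HP tr0; have [|U Uu tT] := @Schur C n.+1 X => //.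
have Uunit : U \in unitmx by exact: unitarymx_unit.
rewrite /simmx_to_for /= in tT; set T := conjmx U X in tT.
have TE : T = U *m X *m invmx U by rewrite /T conjumx.
have rootT i : root (char_poly X) (T i i).
  rewrite -root_mxminpoly -(mxminpoly_uconj _ Uunit) root_mxminpoly -/T.
  rewrite char_poly_trig // rootE horner_prod; apply/prodf_eq0.
  by exists i => //; rewrite hornerXsubC subrr.
have [tTP dTP] := trig_horner_mx P tT.
have trT : \tr (T *m horner_mx T P) = 0.
  rewrite TE horner_mx_uconj // -!mulmxA mulKmx // mxtrace_mulC -!mulmxA.
  by rewrite mulVmx // mulmx1.
have [_ dT] := trig_mulmx_diag tT tTP.
have T0 i : T i i = 0.
  apply/eqP; rewrite -normr_eq0 -sqrf_eq0 normCK; apply/eqP.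
  have sum0 : \sum_i T i i * (T i i)^* = 0.
    rewrite -[RHS]trT /mxtrace; refine (eq_bigr _ _) => j _.
    by rewrite [RHS]dT dTP HP //; exact: rootT.
  by apply: (psumr_eq0P _ sum0) => // j _; rewrite mul_conjC_ge0.
have Tn : T ^+ n.+1 = 0.
  have := Cayley_Hamilton T; rewrite char_poly_trig //.
  rewrite (eq_bigr (fun=> 'X)) => [|i _]; last by rewrite T0 subr0.
  by rewrite prodr_const card_ord rmorphXn /= horner_mx_X.
have XE : X = invmx U *m T *m U by rewrite TE !mulmxA mulVmx // mul1mx mulmxKV.
rewrite -(horner_mx_X X) -rmorphXn /= XE horner_mx_uconjC //.
by rewrite rmorphXn /= horner_mx_X Tn mulmx0 mul0mx.
Qed.

Lemma row_gen_eigen n (A : 'M[C]_n.+1) (v : 'rV_n.+1) x c m (Q : {poly C}) :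
  ('X - x%:P) ^+ m %| Q - c%:P -> v *m (A - x%:M) ^+ m = 0 ->
  v *m horner_mx A Q = c *: v.
Proof.
move=> /dvdpP[S e] v0; apply/eqP; rewrite -subr_eq0.
have -> : c *: v = v *m horner_mx A c%:P by rewrite horner_mx_C mul_mx_scalar.
rewrite -mulmxBr -rmorphB /= e mulrC rmorphM rmorphXn rmorphB /= horner_mx_X horner_mx_C.
by rewrite mulmxA v0 mul0mx.
Qed.

Lemma horner_mx_sum n (A : 'M[C]_n.+1) (Q : {poly C}) :
  horner_mx A Q = \sum_(k < size Q) Q`_k *: A ^+ k.
Proof.
rewrite -{1}(coefK Q) poly_def linear_sum; apply: eq_bigr => k _.
by rewrite linearZ /= rmorphXn /= horner_mx_X.
Qed.

Lemma dvdp_prod_XsubC (s : seq C) m (p : {poly C}) : uniq s ->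
  (forall x, x \in s -> ('X - x%:P) ^+ m %| p) ->
  \prod_(x <- s) ('X - x%:P) ^+ m %| p.
Proof.
elim: s => [|x s IH] /=; first by rewrite big_nil dvd1p.
move=> /andP[xs us] h; rewrite big_cons Gauss_dvdp.
  by rewrite h ?mem_head //= IH // => y ys; rewrite h // inE ys orbT.
rewrite coprimep_expl // coprimep_sym coprimep_XsubC rootE horner_prod.
rewrite prodf_seq_neq0; apply/allP => y ys /=.
rewrite horner_exp hornerXsubC expf_eq0 subr_eq0 negb_and.
by apply/orP; right; apply: contraNneq xs => ->.
Qed.

(** The exponent n.+1 bounds every multiplicity, so a polynomial as in the last clause is a multiple
    of the characteristic polynomial. *)
Lemma ex_eigenvalues n (X : 'M[C]_n.+1) : exists s : seq C, [/\ uniq s,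
  forall x, (x \in s) = root (char_poly X) x
  & forall p, (forall x, x \in s -> ('X - x%:P) ^+ n.+1 %| p) -> horner_mx X p = 0].
Proof.
have [r e] := closed_field_poly_normal (char_poly X).
have := char_poly_monic X; rewrite monicE => /eqP lc; rewrite lc scale1r in e.
exists (undup r); split; first exact: undup_uniq.
  by move=> x; rewrite mem_undup e root_prod_XsubC.
move=> p h; have := dvdp_prod_XsubC (undup_uniq r) h.
have sr : size r = n.+1.
  by have := size_char_poly X; rewrite e size_prod_XsubC => -[].
suff d : char_poly X %| \prod_(x <- undup r) ('X - x%:P) ^+ n.+1.
  move=> /(dvdp_trans d)/dvdpP[q ->].
  by rewrite rmorphM /= Cayley_Hamilton mulr0.
rewrite e -big_undup_iterop_count; elim: (undup r) => [|x s IH].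
  by rewrite !big_nil dvd1p.
rewrite !big_cons dvdp_mul //=; apply: (@dvdp_exp2l _ ('X - x%:P)).
by rewrite -sr count_size.
Qed.

Definition mxad n (X W : 'M[C]_n) := X *m W - W *m X.

Lemma mxad_is_linear n (X : 'M[C]_n) : linear (mxad X).
Proof.
move=> k U W; rewrite /mxad mulmxDr mulmxDl -scalemxAr -scalemxAl.
by rewrite scalerBr opprD addrACA.
Qed.

HB.instance Definition _ n (X : 'M[C]_n) :=
  GRing.isLinear.Build C 'M[C]_n 'M[C]_n _ (mxad X) (mxad_is_linear X).

Lemma mxvec_mxad n (X W : 'M[C]_n.+1) (A := lin_mx (mxad X) : 'M[C]_((n + n * n.+1)%N.+1)) k :
  mxvec W *m A ^+ k = mxvec (iter k (mxad X) W).
Proof.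
elim: k => [|k IH]; first by rewrite expr0 mulmx1.
rewrite exprSr mulmxA IH; exact: (mul_vec_lin (mxad X)).
Qed.

Lemma subrBB (U : zmodType) (p q r t : U) : (p - q) - (r - t) = (p - r) - (q - t).
Proof. by rewrite !opprB addrACA [RHS]addrACA [- q - r]addrC. Qed.

(** Applying U |-> a U - U b adds one factor a on the left or one factor b on the right. After
    enough steps every term has m factors on one of the two sides. *)
Lemma mxad_shift_nilp n (a b W : 'M[C]_n.+1) m :
  a ^+ m *m W = 0 -> W *m b ^+ m = 0 ->
  forall k i j, (m + m <= i + j + k)%N ->
  iter k (fun U => a *m U - U *m b) (a ^+ i *m W *m b ^+ j) = 0.
Proof.
move=> a0 b0; have a0' i : (m <= i)%N -> a ^+ i *m W = 0.
  by move=> /subnK <-; rewrite exprD -mulmxA a0 mulmx0.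
have b0' i : (m <= i)%N -> W *m b ^+ i = 0.
  by move=> /subnK <-; rewrite addnC exprD mulmxA b0 mul0mx.
pose F (U : 'M[C]_n.+1) := a *m U - U *m b.
have FB k U U' : iter k F (U - U') = iter k F U - iter k F U'.
  by elim: k U U' => // k IH U U' /=; rewrite IH /F mulmxBr mulmxBl subrBB.
elim=> [|k IH] i j.
  rewrite addn0 /= => le; have [mi|mi] := leqP m i; first by rewrite a0' // mul0mx.
  rewrite -mulmxA b0' ?mulmx0 //.
  by rewrite -(leq_add2l i); apply: leq_trans le; rewrite leq_add2r ltnW.
move=> le; rewrite iterSr -[LHS]/(iter k F (F (a ^+ i *m W *m b ^+ j))).
have -> : F (a ^+ i *m W *m b ^+ j)
   = a ^+ i.+1 *m W *m b ^+ j - a ^+ i *m W *m b ^+ j.+1.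
  by rewrite /F exprS exprSr !mulmxA.
by rewrite FB /F !IH ?subr0 // ?addSn ?addnS ?addSn; move: le; rewrite addnS.
Qed.

(* With P interpolating conjugation at the eigenvalues of X, P(X) is the
   conjugate of the semisimple part of X; ad P(X) is a polynomial in ad X. *)
Lemma conj_semisimple_part n (X : 'M[C]_n.+1) : exists P Q : {poly C},
  (forall x, root (char_poly X) x -> P.[x] = x^*) /\
  forall Z, mxad (horner_mx X P) Z = \sum_(k < size Q) Q`_k *: iter k (mxad X) Z.
Proof.
have [s [us rs ks]] := ex_eigenvalues X.
have [P HP] := interpolation n.+1 Num.conj us.
(* The eigenvalues of ad X are the differences x - y. On the block of (x, y), ad X - (x - y)
   vanishes to the power 2(n + 1), hence the exponent. *)
have [Q HQ] := interpolation (n.+1 + n.+1) Num.conj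
  (undup_uniq [seq x - y | x <- s, y <- s]).
(* E x evaluated at X is the projection onto the generalised eigenspace of x. *)
have /choice[E HE] : forall x, exists Ex : {poly C}, forall y, y \in s ->
    ('X - y%:P) ^+ n.+1 %| Ex - (((y == x)%:R : C))%:P.
  by move=> x; exact: (interpolation n.+1 (fun y => (y == x)%:R) us).
exists P, Q; split.
  move=> x rx; have := HP x; rewrite rs => /(_ rx).
  move=> /(dvdp_trans (dvdp_exp2l _ (ltn0Sn n))); rewrite expr1.
  by rewrite dvdp_XsubCl rootE hornerD hornerN hornerC subr_eq0 => /eqP.
have sumE : \sum_(x <- s) horner_mx X (E x) = 1%:M.
  have e1 : horner_mx X 1 = 1%:M := rmorph1 _.
  apply/eqP; rewrite -linear_sum -subr_eq0 -e1 -rmorphB /=.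
  apply/eqP/ks => y ys; rewrite (bigD1_seq y) //=.
  rewrite addrAC; apply: dvdp_add.
    by have := HE y y ys; rewrite eqxx.
  apply: (big_ind (fun p => ('X - y%:P) ^+ n.+1 %| p)) => [|p q|x /negPf nxy].
  - exact: dvdp0.
  - exact: dvdp_add.
  - by have := HE x y ys; rewrite eq_sym nxy polyC0 subr0.
have hM p q : horner_mx X p *m horner_mx X q = horner_mx X (p * q).
  by rewrite [RHS]rmorphM.
have hX x k : (X - x%:M) ^+ k = horner_mx X (('X - x%:P) ^+ k).
  by rewrite rmorphXn rmorphB /= horner_mx_X horner_mx_C.
have Ekill x : x \in s -> (X - x%:M) ^+ n.+1 *m horner_mx X (E x) = 0.
  move=> xs; rewrite hX hM.
  apply: ks => y ys; have [->|nxy] := eqVneq y x; first exact: dvdp_mulIl.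
  by apply: dvdp_mull; have := HE x y ys; rewrite (negPf nxy) polyC0 subr0.
have EP x : x \in s -> horner_mx X P *m horner_mx X (E x) = x^* *: horner_mx X (E x).
  move=> xs; apply/eqP; rewrite -subr_eq0 -mul_scalar_mx -(horner_mx_C X) -mulmxBl.
  rewrite -rmorphB hM; apply/eqP/ks => y ys.
  have [->|nxy] := eqVneq y x; first by apply: dvdp_mulr; exact: HP.
  by apply: dvdp_mull; have := HE x y ys; rewrite (negPf nxy) polyC0 subr0.
have comm p q : horner_mx X p *m horner_mx X q = horner_mx X q *m horner_mx X p.
  exact: comm_horner_mx2.
pose A : 'M[C]_((n + n * n.+1)%N.+1) := lin_mx (mxad X).
have actE Z : mxvec (\sum_(k < size Q) Q`_k *: iter k (mxad X) Z)
    = mxvec Z *m horner_mx A Q.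
  rewrite horner_mx_sum mulmx_sumr linear_sum; apply: eq_bigr => k _.
  by rewrite linearZ /= -mxvec_mxad -scalemxAr.
move=> Z; apply: (can_inj mxvecK); rewrite actE.
(* Each block E_x Z E_y is a generalised eigenvector of ad X for x - y, where both sides act as the
   scalar conj x - conj y. *)
have -> : Z = \sum_(x <- s) \sum_(y <- s) horner_mx X (E x) *m Z *m horner_mx X (E y).
  under eq_bigr do rewrite -mulmx_sumr sumE mulmx1.
  by rewrite -mulmx_suml sumE mul1mx.
rewrite !(linear_sum, mulmx_suml); apply: eq_big_seq => x xs.
rewrite !(linear_sum, mulmx_suml); apply: eq_big_seq => y ys.
set W := _ *m _ *m _.
rewrite (@row_gen_eigen _ A _ (x - y) (x - y)^* (n.+1 + n.+1)).
- transitivity (mxvec ((x - y)^* *: W)); last by rewrite linearZ.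
  congr mxvec; rewrite /= /mxad rmorphB /= scalerBl /W !mulmxA EP //.
  by rewrite -!mulmxA (comm (E y) P) EP // -!scalemxAl -!scalemxAr.
- by apply: HQ; rewrite mem_undup; apply/allpairsP; exists (x, y).
have eA (U : 'M[C]_n.+1) k :
    (mxvec U : 'rV_((n + n * n.+1)%N.+1)) *m (A - (x - y)%:M) ^+ k =
    mxvec (iter k (fun U => (X - x%:M) *m U - U *m (X - y%:M)) U).
  elim: k => [|k IH]; first by rewrite expr0 mulmx1.
  rewrite exprSr mulmxA IH /=; move: (iter _ _ _) => U'.
  rewrite mulmxBr (mul_vec_lin (mxad X) U' : _ *m A = _) mul_mx_scalar.
  transitivity (mxvec (mxad X U' - (x - y) *: U')).
    by rewrite [RHS]linearB [in RHS]linearZ.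
  suff -> : mxad X U' - (x - y) *: U' = (X - x%:M) *m U' - U' *m (X - y%:M) by [].
  rewrite /mxad mulmxBl mulmxBr mul_scalar_mx mul_mx_scalar scalerBl.
  by rewrite subrBB.
have W1 : W = (X - x%:M) ^+ 0 *m W *m (X - y%:M) ^+ 0.
  exact: esym (etrans (mulmx1 _) (mul1mx _)).
rewrite /= eA W1 (@mxad_shift_nilp _ _ _ _ n.+1) ?linear0 //.
- by rewrite /W !mulmxA Ekill // !mul0mx.
- rewrite /W -!mulmxA (_ : horner_mx X (E y) *m _ = 0) ?mulmx0 //.
  by rewrite -(Ekill y ys) hX comm.
Qed.

(** Powers are written as iterated products in order to include matrices of size 0, that is V =
    0. *)
Lemma conj_semisimple_part_gen n (X : 'M[C]_n) : exists (D : 'M[C]_n) (p Q : {poly C}),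
  [/\ D = \sum_(k < size p) p`_k *: iter k (mulmx X) 1%:M,
      forall Z, mxad D Z = \sum_(k < size Q) Q`_k *: iter k (mxad X) Z
    & \tr (X *m D) = 0 -> exists k, iter k (mulmx X) 1%:M = 0].
Proof.
case: n X => [|n] X.
  exists 0, 0, 0; split; first by rewrite [RHS]flatmx0.
    by move=> Z; rewrite (flatmx0 (mxad _ _)) [RHS]flatmx0.
  by exists 0; rewrite /= (flatmx0 1%:M).
have powE k : X ^+ k = iter k (mulmx X) 1%:M.
  by elim: k => [|k IH]; rewrite ?expr0 // exprS IH.
have [P [Q [HP HQ]]] := conj_semisimple_part X.
exists (horner_mx X P), P, Q; split=> //.
  by rewrite horner_mx_sum; under eq_bigr do rewrite powE.
by move=> /(nilpotent_of_trace HP) <-; exists n.+1; rewrite powE.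
Qed.

End MatrixCartan.

(** * Trace criteria for nilpotent endomorphisms of a real space *)

Section TraceNilpotent.
Variables (R : realType) (V : vectType R).
Implicit Types (x y z w : 'End(V)).

Lemma v2r_lfun x (u : V) : v2r (x u) = v2r u *m f2mx x.
Proof. by rewrite unlock /= r2vK. Qed.

Lemma f2mx_unique x (A : 'M[R]_(dim V)) : (forall u, v2r (x u) = v2r u *m A) -> f2mx x = A.
Proof.
move=> h; apply/row_matrixP => i; rewrite !rowE.
by rewrite -[delta_mx 0 i]r2vK -v2r_lfun h.
Qed.

Lemma f2mx_comp x y : f2mx (x \o y)%VF = f2mx y *m f2mx x.
Proof.
by apply: f2mx_unique => u; rewrite comp_lfunE !v2r_lfun mulmxA.
Qed.

Lemma f2mxP k x y : f2mx (k *: x + y) = k *: f2mx x + f2mx y.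
Proof.
apply: f2mx_unique => u; rewrite add_lfunE scale_lfunE linearP /= !v2r_lfun.
by rewrite mulmxDr scalemxAr.
Qed.

Lemma f2mxB x y : f2mx (x - y) = f2mx x - f2mx y.
Proof. by rewrite addrC -scaleN1r f2mxP scaleN1r addrC. Qed.

Definition trl x : R := \tr (f2mx x).

Lemma trlP k x y : trl (k *: x + y) = k * trl x + trl y.
Proof. by rewrite /trl f2mxP mxtraceD mxtraceZ. Qed.

Lemma trlB x y : trl (x - y) = trl x - trl y.
Proof. by rewrite /trl f2mxB linearB. Qed.

Lemma trl0 : trl 0 = 0.
Proof. by rewrite -(subrr 0) trlB subrr. Qed.

Lemma trlC x y : trl (x \o y)%VF = trl (y \o x)%VF.
Proof. by rewrite /trl !f2mx_comp mxtrace_mulC. Qed.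

Definition lad x w : 'End(V) := ((x \o w) - (w \o x))%VF.

Definition lpow x k : 'End(V) := iter k (fun w => (w \o x)%VF) \1%VF.

Definition lnilpotent x := exists k, forall v, iter k x v = 0.

Local Notation M x := (map_mx (real_complex R) (f2mx x)).

Lemma cmx_comp x y : M (x \o y)%VF = M y *m M x.
Proof. by rewrite f2mx_comp map_mxM. Qed.

Lemma cmx_lpow x k : M (lpow x k) = iter k (mulmx (M x)) 1%:M.
Proof.
elim: k => [|k IH] /=; last by rewrite cmx_comp IH.
rewrite (_ : f2mx \1%VF = 1%:M) ?map_mx1 //.
by apply: f2mx_unique => u; rewrite id_lfunE mulmx1.
Qed.

Lemma trace_cmx x y : \tr (M y *m M x) = (real_complex R) (trl (x \o y)%VF).
Proof. by rewrite -cmx_comp /trl trace_map_mx. Qed.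

Lemma lpowE x k v : lpow x k v = iter k x v.
Proof.
elim: k v => [|k IH] v /=; first by rewrite id_lfunE.
by rewrite comp_lfunE IH -iterSr.
Qed.

Lemma lnilpotent_cmx x k : iter k (mulmx (M x)) 1%:M = 0 -> lnilpotent x.
Proof.
rewrite -cmx_lpow => /eqP; rewrite map_mx_eq0 => /eqP h; exists k => v.
by rewrite -lpowE; apply: v2r_inj; rewrite v2r_lfun h mulmx0 linear0.
Qed.

(** D is a polynomial in x, so the trace of x D is a combination of the traces of the x^(k+1). *)
Lemma lnilpotent_trace x : (forall k, trl (lpow x k.+1) = 0) -> lnilpotent x.
Proof.
move=> h; have [D [p [Q [DE _ tr0]]]] := conj_semisimple_part_gen (M x).
have [|k /lnilpotent_cmx //] := tr0.
rewrite DE mulmx_sumr linear_sum big1 // => k _.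
rewrite -scalemxAr linearZ /= -cmx_lpow trace_cmx.
by rewrite [trl _](h k) rmorph0 mulr0.
Qed.

(* Cartan's criterion, for x in the span of the commutators [y, z], G y z. *)
Lemma lnilpotent_cartan (G : 'End(V) -> 'End(V) -> Prop) x :
  (forall y z, G y z -> forall k, trl (y \o iter k (lad x) z)%VF = 0) ->
  (forall U : {vspace 'End(V)}, (forall y z, G y z -> lad y z \in U) -> x \in U) ->
  lnilpotent x.
Proof.
move=> h1 h2; have [D [p [Q [_ DE tr0]]]] := conj_semisimple_part_gen (M x).
have [|k /lnilpotent_cmx //] := tr0.
(* The condition to be proved for x is linear in w, so it is enough to check it on the commutators
   [y, z]. *)
have mem w : (w \in subspace (fun w => \tr (M w *m D) = 0)) <-> \tr (M w *m D) = 0.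
  apply: (@mem_subspace _ _ (fun w => \tr (M w *m D) = 0)).
    by rewrite -(subrr 0) f2mxB subrr map_mx0 mul0mx mxtrace0.
  move=> k u v hu hv; rewrite f2mxP map_mxD map_mxZ mulmxDl -scalemxAl.
  by rewrite mxtraceD mxtraceZ hu hv mulr0 addr0.
apply/mem/h2 => y z Gyz; apply/mem.
have -> : M (lad y z) = M z *m M y - M y *m M z.
  by rewrite /lad f2mxB map_mxB -!cmx_comp.
(* The trace moves the commutator onto D, where ad D is a polynomial in ad x. *)
have -> : \tr ((M z *m M y - M y *m M z) *m D) = \tr (M y *m mxad D (M z)).
  rewrite /mxad mulmxBl mulmxBr !linearB /=; congr (_ - _); last by rewrite mulmxA.
  by rewrite -mulmxA mxtrace_mulC mulmxA.
rewrite DE mulmx_sumr linear_sum big1 // => k _.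
(* Matrices act on row vectors and reverse products, so [mxad] corresponds to minus [lad]; e is the
   resulting sign. *)
have [e eE] : exists e : R[i], iter k (mxad (M x)) (M z) = e *: M (iter k (lad x) z).
  elim: (k : nat) => [|j [e IH]] /=; first by exists 1; rewrite scale1r.
  exists (- e); rewrite IH linearZ scaleNr -scalerN; congr (_ *: _).
  by rewrite /= [in RHS]/lad f2mxB map_mxB opprB /mxad -!cmx_comp.
rewrite eE scalerA -scalemxAr linearZ /= trace_cmx trlC.
by rewrite (h1 _ _ Gyz) rmorph0 mulr0.
Qed.

End TraceNilpotent.

(** * Engel's theorem *)

Section Engel.
Variables (R : realType) (L : vectType R) (br : 'Hom(L, 'End(L))).
Hypothesis lie : lie_bracket br.

Lemma lie_anti x y : br x y = - br y x.
Proof.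
case: lie => alt _; apply/eqP; rewrite -addr_eq0; apply/eqP.
have := alt (x + y); rewrite !linearD /= !add_lfunE !alt addr0 add0r.
by rewrite addrC.
Qed.

Lemma lie_jacobi x y z : br (br x y) z = br x (br y z) - br y (br x z).
Proof.
case: lie => _ /(_ x y z)/eqP; rewrite addr_eq0 => /eqP e.
by rewrite [LHS]lie_anti -e (lie_anti z x) linearN.
Qed.

Definition rep_on (m : {vspace L}) (W : vectType R) (f : 'Hom(L, 'End(W))) :=
  forall x y u, x \in m -> y \in m -> f (br x y) u = f x (f y u) - f y (f x u).

(** Engel's theorem for the subquotient U2 / U1, so that the induction on the dimension of m can use
    the adjoint action on m modulo a subalgebra without forming a quotient. Nilpotency of [br x] is
    assumed for that use. *)
Lemma engel_flag d (m : {vspace L}) : (\dim m <= d)%N ->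
  (forall x y, x \in m -> y \in m -> br x y \in m) ->
  (forall x, x \in m -> lnilpotent (br x)) ->
  forall (W : vectType R) (f : 'Hom(L, 'End(W))) (U1 U2 : {vspace W}),
  rep_on m f -> (forall x, x \in m -> lnilpotent (f x)) ->
  (forall x u, x \in m -> u \in U1 -> f x u \in U1) ->
  (forall x u, x \in m -> u \in U2 -> f x u \in U2) ->
  (U1 <= U2)%VS -> U1 <> U2 ->
  exists u, [/\ u \in U2, u \notin U1 & forall x, x \in m -> f x u \in U1].
Proof.
elim: d m => [|d IH] m dm mm mn W f U1 U2 fm fn s1 s2 U12 nU.
  have m0 : m = 0%VS by apply/eqP; rewrite -dimv_eq0 -leqn0.
  have /subvPn[u u2 u1] : ~~ (U2 <= U1)%VS.
    by apply/negP => h; apply: nU; exact: subv_eq.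
  exists u; split=> // x; rewrite m0 memv0 => /eqP->.
  by rewrite linear0 zero_lfunE mem0v.
have [m0|/eqP mnz] := eqVneq m 0%VS.
  by apply: (IH m) => //; rewrite m0 dimv0.
pose P k := `[< exists m' : {vspace L}, [/\ (m' <= m)%VS, m' <> m,
  forall x y, x \in m' -> y \in m' -> br x y \in m' & \dim m' = k] >].
have exP : exists k, P k.
  exists 0; apply/asboolP; exists 0%VS; split; rewrite ?sub0v ?dimv0 //.
    by move=> h; apply: mnz.
  by move=> x y; rewrite !memv0 => /eqP-> _; rewrite linear0 zero_lfunE.
case: (@ex_maxnP P (\dim m) exP) => [k /asboolP[m' [m'm _ _ <-]]|k]; first exact: dimvS.
move=> /asboolP[m' [m'm nm' cm' dm']] kmax.
have subm x : x \in m' -> x \in m by exact: (subvP m'm).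
have ltm : (\dim m' <= d)%N.
  rewrite -ltnS; apply: leq_trans dm; rewrite ltn_neqAle dimvS // andbT.
  by apply/eqP => e; apply: nm'; apply/eqP; rewrite eqEdim m'm e leqnn.
(* With m' a maximal proper subalgebra, the induction hypothesis for its adjoint action on m / m'
   yields x outside m' normalising m'. *)
have [||||x [xm xm' xn]] := IH m' ltm cm' _ L br m' m _ _ cm' _ m'm nm'.
- by move=> x /subm; exact: mn.
- by move=> x y u _ _; rewrite lie_jacobi.
- by move=> x /subm; exact: mn.
- by move=> x u /subm xm um; exact: mm.
(* The sum is a subalgebra strictly larger than m', so maximality makes it all of m. *)
have mE : (m' + <[x]> = m)%VS.
  apply: contrapT => nE.
  have le : (m' + <[x]> <= m)%VS by rewrite subv_add m'm -memvE.
  have lt : (m' <= m' + <[x]>)%VS by exact: addvSl.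
  have : (k >= \dim (m' + <[x]>)%VS)%N.
    apply: kmax; apply/asboolP; exists (m' + <[x]>)%VS; split=> //.
    move=> _ _ /memv_addP[y yI [_ /vlineP[c ->] ->]] /memv_addP[z zI [_ /vlineP[e ->] ->]].
    apply: (subvP lt); rewrite !linearD !linearZ /= !add_lfunE !scale_lfunE.
    have xx : br x x = 0 by case: lie.
    have xz : br x z \in m' by rewrite lie_anti memvN xn.
    rewrite xx scaler0 addr0.
    apply: memvD; first by apply: memvD; [exact: cm'|exact: memvZ].
    by rewrite memvZ // xn.
  rewrite -dm' => h; have /eqP e : m' == (m' + <[x]>)%VS by rewrite eqEdim lt.
  by move/negP: xm'; apply; rewrite e; apply: (subvP (addvSr _ _)); exact: memv_line.
(* The vectors killed by m' modulo U1 are stable under x because x normalises m'. *)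
pose inT u := u \in U2 /\ forall y, y \in m' -> f y u \in U1.
have [|||||u0 [u02 u01 u0T]] := IH m' ltm cm' _ W f U1 U2 _ _ _ _ U12 nU.
- by move=> y /subm; exact: mn.
- by move=> y z u /subm ym /subm zm; exact: fm.
- by move=> y /subm; exact: fn.
- by move=> y u /subm ym; exact: s1.
- by move=> y u /subm ym; exact: s2.
have Tx u : inT u -> inT (f x u).
  move=> [u2 hu]; split; first exact: s2.
  move=> y ym'; have -> : f y (f x u) = f x (f y u) + f (br y x) u.
    by rewrite (fm y x u (subm _ ym') xm) addrC subrK.
  by apply: memvD; [apply: s1 => //; exact: hu|apply: hu; exact: xn].
have [j jn] := fn x xm.
have exj : exists j, iter j (f x) u0 \in U1 by exists j; rewrite jn mem0v.
(* The last iterate of x on u0 that is still outside U1 is killed by x as well as by m', modulo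
   U1. *)
case: (ex_minnP exj) => [[|i]] iU imin; first by rewrite iU in u01.
have inTi : inT (iter i (f x) u0).
  by elim: (i) => [|i' IHi] /=; [split|exact: Tx].
exists (iter i (f x) u0); split; first by case: inTi.
  by apply/negP => /imin; rewrite ltnn.
move=> z; rewrite -mE => /memv_addP[y ym' [_ /vlineP[c ->] ->]].
rewrite linearD linearZ /= add_lfunE scale_lfunE memvD //; first by case: inTi => _; exact.
by rewrite memvZ.
Qed.

End Engel.

Section EngelEnd.
Variables (R : realType) (V : vectType R).
Implicit Types x y z w : 'End(V).

Lemma ladE x y v : lad x y v = x (y v) - y (x v).
Proof. by rewrite /lad add_lfunE opp_lfunE !comp_lfunE. Qed.

Lemma lad_linear x : linear (lad x).
Proof.
move=> k y z; apply/lfunP => v; rewrite !(ladE, add_lfunE, scale_lfunE) linearP /=.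
by rewrite scalerBr opprD addrACA.
Qed.

Definition ladl x : 'End('End(V)) := linfun (lad x).

Lemma ladl_linear : linear ladl.
Proof.
move=> k x y; apply/lfunP => w; rewrite add_lfunE scale_lfunE /ladl !linfunE; try exact: lad_linear.
apply/lfunP => v; rewrite !(ladE, add_lfunE, scale_lfunE) linearP /=.
by rewrite scalerBr opprD addrACA.
Qed.

Definition end_bracket : 'Hom('End(V), 'End('End(V))) := linfun ladl.

Lemma end_bracketE x y : end_bracket x y = lad x y.
Proof. by rewrite /end_bracket linfunE ?linfunE //; [exact: lad_linear|exact: ladl_linear]. Qed.

Lemma zmod_jacobi (U : zmodType) (a b c d e f : U) :
  (a - b + (- c - - d)) + (c - e + (- f - - b)) + (f - d + (- a - - e)) = 0.
Proof.
rewrite !opprK ![- _ + _]addrC [a - b + _]addrC [d - c + _ + _]addrACA !subrKA.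
rewrite [f - d + _]addrC addrACA.
by rewrite !subrKA subrr.
Qed.

Lemma end_bracket_lie : lie_bracket end_bracket.
Proof.
split=> [x|x y z]; rewrite !end_bracketE; first by rewrite /lad subrr.
apply/lfunP => v; rewrite !(ladE, add_lfunE, zero_lfunE) !linearB /=.
exact: zmod_jacobi.
Qed.

(** If x^k = 0, each term of (ad x)^(2k) w has at least k factors x on one side of w. *)
Lemma lnilpotent_lad x : lnilpotent x -> lnilpotent (end_bracket x).
Proof.
move=> [k xk]; exists (k + k)%N => w; apply/lfunP => v; rewrite zero_lfunE.
have xk' j u : (k <= j)%N -> iter j x u = 0.
  by move=> /subnK <-; rewrite addnC iterD xk; elim: (_ - _)%N => //= i ->; rewrite linear0.
suff h n i j : (k + k <= i + j + n)%N ->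
    iter n (end_bracket x) (lpow x i \o w \o lpow x j)%VF v = 0.
  by have := h (k + k)%N 0 0 (leqnn _); rewrite /lpow /= comp_lfun1l comp_lfun1r.
have lB m y z : iter m (end_bracket x) (y - z)
    = iter m (end_bracket x) y - iter m (end_bracket x) z.
  by elim: m => //= m ->; rewrite linearB.
elim: n i j => [|n IH] i j le /=.
  rewrite !comp_lfunE !lpowE; have [ki|ik] := leqP k i; first by rewrite xk'.
  rewrite (xk' j) ?linear0 -?lpowE ?linear0 //.
  by rewrite -(leq_add2l i); rewrite addn0 in le; apply: leq_trans le; rewrite leq_add2r ltnW.
rewrite -iterS iterSr.
have -> : end_bracket x (lpow x i \o w \o lpow x j)%VF =
    ((lpow x i.+1 \o w \o lpow x j) - (lpow x i \o w \o lpow x j.+1))%VF.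
  apply/lfunP => u; rewrite end_bracketE ladE add_lfunE opp_lfunE !comp_lfunE !lpowE.
  by rewrite -!iterSr.
by rewrite lB add_lfunE opp_lfunE !IH ?subrr //; move: le; rewrite ?addSn ?addnS ?addSn.
Qed.

End EngelEnd.

(** * The nilpotent radical and semisimple modules *)

Section TrivialAction.
Variables (K : fieldType) (g : Type) (V : vectType K) (f : g -> 'End(V)).

(** Every subspace between A and B is a submodule, so any linear complement will do. *)
Lemma ss_quotient_trivial (A B : {vspace V}) : (A <= B)%VS ->
  (forall x v, v \in B -> f x v \in A) -> ss_quotient f A B.
Proof.
move=> AB triv W sW AW WB; exists (A + (B :\: W))%VS.
have DB : (A + (B :\: W) <= B)%VS by rewrite subv_add AB diffvSl.
split=> //.
- by move=> x v /(subvP DB) vB; apply: (subvP (addvSl _ _)); exact: triv.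
- exact: addvSl.
- apply: subv_eq; first exact: sub_addl.
  rewrite -{1}(addv_diff_cap B W); apply: sub_addl.
    by apply: subv_trans (addvSr W _); exact: addvSr.
  by apply: subv_trans (addvSl _ _); exact: capvSr.
- apply: subv_eq; last by apply: sub_capr => //; exact: addvSl.
  by rewrite capvC -vspace_modl // capv_diff addv0.
Qed.

End TrivialAction.

Section RadicalActsTrivially.
Variables (R : realType) (l V : vectType R) (br : 'Hom(l, 'End(l))).
Variable rho : 'Hom(l, 'End(V)).
Hypothesis lie : lie_bracket br.
Hypothesis rep : forall x y v, rho (br x y) v = rho x (rho y v) - rho y (rho x v).
Hypothesis ssV : semisimple rho.
Implicit Types (x y z w : l) (A B E U W : {vspace l}).

Local Notation ideal := (submodule br).

Lemma rep_lad x y : rho (br x y) = lad (rho x) (rho y).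
Proof. by apply/lfunP => v; rewrite rep ladE. Qed.

(** The vectors killed by E form a submodule F because E is an ideal. On a nonzero complement of F,
    Engel's theorem would give another vector killed by E. *)
Lemma nil_ideal_trivial E : ideal E -> (forall x, x \in E -> lnilpotent (rho x)) ->
  forall x, x \in E -> rho x = 0.
Proof.
move=> sE nE.
pose F := subspace (fun v => forall x, x \in E -> rho x v = 0).
have memF v : (v \in F) <-> forall x, x \in E -> rho x v = 0.
  apply: (@mem_subspace _ _ (fun v => forall x, x \in E -> rho x v = 0)) => [x _|k u w hu hw x xE].
    by rewrite linear0.
  by rewrite linearP /= hu // hw // scaler0 addr0.
have sF : submodule rho F.
  move=> x v /memF hv; apply/memF => y yE.
  have -> : rho y (rho x v) = rho x (rho y v) - rho (br x y) v.
    by rewrite rep opprB addrC subrK.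
  by rewrite (hv y) // (hv (br x y)) ?linear0 ?linear0 ?addr0 //; exact: sE.
have [W [sW eW cW]] := ssV sF.
have [W0|/eqP nW] := eqVneq W 0%VS.
  move=> x xE; apply/lfunP => v; rewrite zero_lfunE.
  have /memF : v \in F by rewrite -[F]addv0 -W0 eW memvf.
  exact.
pose m := (rho @: E)%VS.
have mP X : X \in m -> exists2 x, x \in E & X = rho x by move=> /memv_imgP.
have [||||||||u [uW u0 uk]] := @engel_flag _ _ (@end_bracket _ V) (@end_bracket_lie _ V)
    (\dim m) m (leqnn _) _ _ V \1%VF 0%VS W; try exact: sub0v.
- move=> _ _ /mP[x xE ->] /mP[y yE ->]; rewrite end_bracketE -rep_lad.
  by rewrite memv_img // sE.
- by move=> _ /mP[x xE ->]; apply: lnilpotent_lad; exact: nE.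
- by move=> X Y v _ _; rewrite !id_lfunE end_bracketE ladE.
- by move=> _ /mP[x xE ->]; rewrite id_lfunE; exact: nE.
- by move=> X v _; rewrite !memv0 => /eqP->; rewrite linear0.
- by move=> _ v /mP[x xE ->]; rewrite id_lfunE; exact: sW.
- exact: nesym.
have : u \in (F :&: W)%VS.
  rewrite memv_cap uW andbT; apply/memF => x xE.
  by apply/eqP; rewrite -memv0 -[rho x]id_lfunE uk // memv_img.
by rewrite cW (negPf u0).
Qed.

(** The line of y together with the kernel of rho is an ideal acting nilpotently. *)
Lemma central_nilpotent_trivial y : (forall z, rho (br z y) = 0) ->
  lnilpotent (rho y) -> rho y = 0.
Proof.
move=> cy [k ky]; apply: (@nil_ideal_trivial (<[y]> + lker rho)%VS).
- move=> z _ /memv_addP[_ /vlineP[c ->] [w wK ->]].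
  apply: (subvP (addvSr _ _)); rewrite memv_ker linearD linearZ /= linearD linearZ /=.
  rewrite cy scaler0 add0r; apply/eqP/lfunP => v; rewrite rep.
  by move: wK; rewrite memv_ker => /eqP->; rewrite !zero_lfunE linear0 subr0.
- move=> _ /memv_addP[_ /vlineP[c ->] [w wK ->]]; exists k => v.
  move: wK; rewrite memv_ker linearD linearZ /= => /eqP->; rewrite addr0.
  suff -> : iter k (c *: rho y) v = c ^+ k *: iter k (rho y) v by rewrite ky scaler0.
  elim: (k) => [|j IH] /=; first by rewrite expr0 scale1r.
  by rewrite IH scale_lfunE linearZ /= scalerA exprS.
- by apply: (subvP (addvSl _ _)); exact: memv_line.
Qed.

Definition bracket_space A B : {vspace l} :=
  least (fun U => forall x y, x \in A -> y \in B -> br x y \in U).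

Lemma bracket_spaceP A B :
  (forall x y, x \in A -> y \in B -> br x y \in bracket_space A B) /\
  forall U, (forall x y, x \in A -> y \in B -> br x y \in U) -> (bracket_space A B <= U)%VS.
Proof.
apply: (@leastP _ _ (fun U => forall x y, x \in A -> y \in B -> br x y \in U) fullv).
  by move=> x y _ _; exact: memvf.
by move=> U W hU hW x y xA yB; rewrite memv_cap hU ?hW.
Qed.

Lemma bracket_space_ideal A B : ideal A -> ideal B -> ideal (bracket_space A B).
Proof.
move=> sA sB z; have [h1 h2] := bracket_spaceP A B.
pose P v := br z v \in bracket_space A B.
have memP v : v \in subspace P <-> P v.
  apply: mem_subspace; rewrite /P; first by rewrite linear0 mem0v.
  by move=> k u w hu hw; rewrite linearP memvD ?memvZ.
move=> v vE; apply/memP; apply: (subvP (h2 _ _) v vE) => x y xA yB; apply/memP.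
rewrite /P; have -> : br z (br x y) = br (br z x) y + br x (br z y).
  by rewrite lie_jacobi // subrK.
by rewrite memvD ?h1 // ?sA ?sB.
Qed.

(** Under rho, u commutes with every y in B, so the trace of [x, y] u^k, which is that of x
    [y, u^k], vanishes; by linearity so does that of u^(k+1). *)
Lemma lnilpotent_bracket A B u : u \in bracket_space A B ->
  (forall y, y \in B -> rho (br y u) = 0) -> lnilpotent (rho u).
Proof.
move=> uE cu; apply: lnilpotent_trace => k.
have [h1 h2] := bracket_spaceP A B.
pose P v := trl (rho v \o lpow (rho u) k)%VF = 0.
have memP v : v \in subspace P <-> P v.
  apply: mem_subspace; rewrite /P; first by rewrite linear0 comp_lfun0l trl0.
  by move=> c a b ha hb; rewrite linearP comp_lfunDl -comp_lfunZl trlP ha hb mulr0 addr0.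
rewrite /= trlC; apply/memP; apply: (subvP (h2 _ _) u uE) => x y xA yB; apply/memP.
have com : (lpow (rho u) k \o rho y = rho y \o lpow (rho u) k)%VF.
  apply/lfunP => v; rewrite !comp_lfunE !lpowE.
  have c v' : rho u (rho y v') = rho y (rho u v').
    by apply/eqP; rewrite eq_sym -subr_eq0 -rep cu // zero_lfunE.
  by elim: k {h1 h2 P memP} => //= j ->; rewrite c.
rewrite /P rep_lad /lad comp_lfunDl comp_lfunNl trlB -comp_lfunA -com.
by rewrite -[(_ \o rho x \o _)%VF]comp_lfunA [trl (rho y \o _)%VF]trlC -comp_lfunA subrr.
Qed.

Definition trace_form : 'Hom(l, dualv l) :=
  linfun (fun x => linfun (fun y => trl (rho x \o rho y)%VF : R^o)).

Lemma trace_formE x y : trace_form x y = trl (rho x \o rho y)%VF.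
Proof.
have lin2 z : linear (fun y => trl (rho z \o rho y)%VF : R^o).
  by move=> k u w; rewrite linearP comp_lfunDr -comp_lfunZr trlP.
rewrite /trace_form linfunE ?linfunE // => k u w; apply/lfunP => v.
rewrite add_lfunE scale_lfunE !linfunE //.
by rewrite linearP comp_lfunDl -comp_lfunZl trlP.
Qed.

Lemma trace_formC x y : trace_form x y = trace_form y x.
Proof. by rewrite !trace_formE trlC. Qed.

Lemma trace_form_skew z x y : trace_form (br z x) y = - trace_form x (br z y).
Proof.
rewrite !trace_formE !rep_lad /lad comp_lfunDl comp_lfunDr comp_lfunNl comp_lfunNr.
by rewrite !trlB opprB !comp_lfunA -[in LHS]comp_lfunA trlC.
Qed.

Lemma mem_lker_trace_form x : (x \in lker trace_form) <-> forall y, trace_form x y = 0.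
Proof.
rewrite memv_ker; split=> [/eqP -> y|h]; first by rewrite zero_lfunE.
by apply/eqP/lfunP => y; rewrite h zero_lfunE.
Qed.

Lemma lker_trace_form_ideal : ideal (lker trace_form).
Proof.
by rewrite -orthvf; apply: submodule_orthv (@trace_form_skew) _ _; exact: submodule_full.
Qed.

Lemma trace_form_kernel_central z x : x \in lker trace_form -> rho (br z x) = 0.
Proof.
move=> xn; pose E := bracket_space fullv (lker trace_form).
have sE : ideal E.
  apply: bracket_space_ideal; [exact: submodule_full|exact: lker_trace_form_ideal].
have [h1 h2] := bracket_spaceP fullv (lker trace_form).
apply: (nil_ideal_trivial sE); last by apply: h1 => //; exact: memvf.
(* Cartan's criterion applies to [l, n], n the kernel of the trace form: n is an ideal, so (ad u)^k
   keeps z in n, which is orthogonal to y. *)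
move=> u uE; pose G Y Z := exists y z, [/\ z \in lker trace_form, Y = rho y & Z = rho z].
apply: (@lnilpotent_cartan _ _ G).
  move=> _ _ [y [w [wn -> ->]]] k.
  have -> : iter k (lad (rho u)) (rho w) = rho (iter k (br u) w).
    by elim: k => //= k ->; rewrite -rep_lad.
  have wn' : iter k (br u) w \in lker trace_form.
    by elim: k => //= k IH; exact: lker_trace_form_ideal.
  by rewrite trlC -trace_formE; move/mem_lker_trace_form: wn'; apply.
move=> U hU; rewrite memv_preim; apply: (subvP (h2 _ _) u uE) => y w _ wn.
by rewrite -memv_preim rep_lad; apply: hU; exists y, w.
Qed.

Lemma radical1_derived : (radical_series br 1 <= bracket_space fullv fullv)%VS.
Proof.
have [h1 _] := bracket_spaceP fullv fullv; have [_ _ m1] := radical_seriesP br 0.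
apply: m1; [|exact: subvf|].
  by apply: bracket_space_ideal; exact: submodule_full.
by apply: ss_quotient_trivial => [|x v _]; [exact: subvf|apply: h1; exact: memvf].
Qed.

(* [radical_series br 1] is the nilpotent radical of l. *)
Lemma radical1_trivial x : x \in radical_series br 1 -> rho x = 0.
Proof.
pose n := lker trace_form; pose R1 := radical_series br 1.
have sn : ideal n by exact: lker_trace_form_ideal.
have sR1 : ideal R1 by exact: submodule_radical_series.
have sT : ideal fullv by exact: submodule_full.
have [_ ssR1 minR1] := radical_seriesP br 0.
pose r := (R1 + n)%VS; have sr : ideal r by exact: submodule_add.
pose S := orthv trace_form r.
have sS : ideal S by exact: (submodule_orthv trace_form_skew).
have nr : (n <= r)%VS by exact: addvSr.
have nS : (n <= S)%VS by exact: ker_orthv.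
pose c := (r :&: S)%VS; have sc : ideal c by exact: submodule_cap.
(* By invariance, pairing [y, s] with z pairs y with [s, z], and S is an ideal orthogonal to r. *)
have rS y s : y \in r -> s \in S -> br y s \in n.
  move=> yr sS'; apply/mem_lker_trace_form => z.
  rewrite (lie_anti lie) linearN opp_lfunE trace_form_skew opprK trace_formC.
  have : br s z \in S by rewrite (lie_anti lie) memvN; exact: sS.
  by move=> /mem_orthv; apply.
(* Brackets of c lie in n, hence are central under rho, and being commutators they act nilpotently.
   The argument is then repeated for [l, c], which now commutes with c under rho. *)
have cc y z : y \in c -> z \in c -> rho (br y z) = 0.
  move=> yc zc; have [h1 h2] := bracket_spaceP c c.
  apply: (nil_ideal_trivial (bracket_space_ideal sc sc)); last exact: h1.
  move=> u uE; apply: (lnilpotent_bracket uE) => w _.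
  apply: trace_form_kernel_central; apply: (subvP (h2 _ _)) uE => a b.
  by rewrite !memv_cap => /andP[ar _] /andP[_ bS]; exact: rS.
have lc y z : z \in c -> rho (br y z) = 0.
  move=> zc; have [h1 h2] := bracket_spaceP fullv c.
  apply: (nil_ideal_trivial (bracket_space_ideal sT sc)); last by apply: h1 => //; exact: memvf.
  move=> u uE; apply: (lnilpotent_bracket uE) => w wc; apply: cc => //.
  by apply: (subvP (h2 _ _)) uE => a b _ bc; exact: sc.
have central y : y \in R1 -> (forall z, rho (br z y) = 0) -> rho y = 0.
  move=> yR cy; apply: central_nilpotent_trivial => //.
  by apply: lnilpotent_bracket (subvP radical1_derived _ yR) _ => z _; exact: cy.
(* Write y in c as a + w with a in R_1 and w in n. Then rho(a) is central because those of y and w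
   are, so it vanishes, and the trace form sees only w. *)
have cn : (c <= n)%VS.
  apply/subvP => y yc; have : y \in r by move: yc; rewrite memv_cap => /andP[].
  move=> /memv_addP[a aR [w wn e]]; apply/mem_lker_trace_form => z.
  have a0 : rho a = 0.
    apply: central => // t; have -> : a = y - w by rewrite e addrK.
    by rewrite !linearB /= lc // trace_form_kernel_central // subr0.
  rewrite e linearD add_lfunE /= trace_formE a0 comp_lfun0l trl0 add0r.
  by move/mem_lker_trace_form: wn; apply.
have cE : c = n by apply: subv_eq => //; exact: sub_capr.
(* Both sides are orthogonals: r + S of the intersection c = n, and the whole space of the kernel n
   of the form. *)
have rST : (r + S = fullv)%VS.
  have e : orthv trace_form c = (S + r)%VS.
    by rewrite /c orthv_cap //; [rewrite orthvK //; exact: trace_formC|exact: trace_formC].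
  rewrite addvC -e cE /n -orthvf orthvK //; [exact: trace_formC|exact: subvf].
have rn : r = n.
  (* Let M be maximal between n and r. Then l / (M + S) = r / M is simple and l / r is semisimple,
     so l / M is semisimple; hence R_1 lies in M, and so does r, a contradiction. *)
  apply: contrapT => nrn; have [M [sM nM Mr nMr ssM]] :=
    ex_maximal_submodule sn sr nr (nesym nrn).
  have rMS : (r :&: (M + S) = M)%VS.
    by rewrite capvC -vspace_modl // [(S :&: r)%VS]capvC -/c cE; apply/addv_idPl.
  have sMS : ideal (M + S)%VS by exact: submodule_add.
  have ss1 : ss_quotient br (M + S)%VS fullv.
    have <- : (r + (M + S) = fullv)%VS by rewrite addvA (addv_idPl Mr).
    by apply: ss_quotient_capl => //; rewrite rMS.
  have ss2 : ss_quotient br r fullv.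
    apply: (ss_quotient_sub _ _ _ _ _ ssR1) => //; [exact: addvSl|exact: subvf].
  have ss3 : ss_quotient br M fullv.
    by rewrite -rMS; apply: ss_quotient_capA => //; exact: subvf.
  apply: nMr; apply: subv_eq => //; apply: sub_addl => //.
  by apply: minR1 => //; exact: subvf.
move=> xR; apply: central => // z; apply: trace_form_kernel_central.
by rewrite -/n -rn; apply: (subvP (addvSl _ _)).
Qed.

End RadicalActsTrivially.

(** * The standard model *)

Section MultilinearMaps.
Variable R : realType.

Lemma lfun_lin1 (U W : vectType R) (h : 'Hom(U, W)) k (u v : U) :
  h (k *: u + v) = k *: h u + h v.
Proof. exact: linearP. Qed.

Lemma lfun_lin2 (U U' W : vectType R) (h : 'Hom(U, 'Hom(U', W))) k (u v : U) (x : U') :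
  h (k *: u + v) x = k *: h u x + h v x.
Proof. by rewrite linearP add_lfunE scale_lfunE. Qed.

Lemma lfun_lin3 (U U' U'' W : vectType R) (h : 'Hom(U, 'Hom(U', 'Hom(U'', W))))
  k (u v : U) (x : U') (y : U'') : h (k *: u + v) x y = k *: h u x y + h v x y.
Proof. by rewrite lfun_lin2 add_lfunE scale_lfunE. Qed.

Lemma lfun_lin0 (U W : vectType R) (h h' : 'Hom(U, W)) k (x : U) :
  (k *: h + h') x = k *: h x + h' x.
Proof. by rewrite add_lfunE scale_lfunE. Qed.

Lemma regular_scale (k : R) (x : R^o) : k *: x = k * x.
Proof. by []. Qed.

Definition lfunLE := (lfun_lin3, lfun_lin2, lfun_lin0, lfun_lin1).

Lemma lmod_comb (U : lmodType R) k (p q r p' q' r' : U) :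
  k *: p + p' + (k *: q + q') - (k *: r + r') = k *: (p + q - r) + (p' + q' - r').
Proof.
rewrite scalerBr scalerDr opprD [k *: p + p' + _]addrACA.
by rewrite [LHS]addrACA.
Qed.

End MultilinearMaps.

Section StandardModelTheory.
Variables (R : realType) (l a : vectType R).
Variables (br : 'Hom(l, 'End(l))) (rho : 'Hom(l, 'End(a))).
Variable form : 'Hom(a, dualv a).
Variables (alpha : 'Hom(l, 'Hom(l, a))) (gamma : 'Hom(l, 'Hom(l, dualv l))).
Hypothesis lie : lie_bracket br.
Hypothesis orth : orthogonal_module br rho form.
Hypothesis cocycle : quadratic_cocycle br rho form alpha gamma.

Local Notation d := (stdmodel l a).
Local Notation ad := (std_bracket br rho form alpha gamma).
Local Notation Bd := (std_form l form).
Implicit Types (u v w x y z : d).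

Lemma rho_rep X Y A : rho (br X Y) A = rho X (rho Y A) - rho Y (rho X A).
Proof. by case: orth => h _ _ _; exact: h. Qed.

Lemma formC A B : form A B = form B A.
Proof. by case: orth => _ h _ _; exact: h. Qed.

Lemma form_nondeg A : (forall B, form A B = 0) -> A = 0.
Proof. by case: orth => _ _ h _ hA; apply: h => [|B _]; rewrite ?memvf. Qed.

Lemma rho_skew X A B : form (rho X A) B = - form A (rho X B).
Proof. by case: orth => _ _ _ h; exact: h. Qed.

Lemma alpha_anti X Y : alpha X Y = - alpha Y X.
Proof.
case: cocycle => alt _ _ _; apply/eqP; rewrite -addr_eq0 addrC; apply/eqP.
have := alt (X + Y); rewrite !linearD /= !add_lfunE !alt addr0 add0r.
by [].
Qed.

Lemma gamma_anti12 X Y T : gamma X Y T = - gamma Y X T.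
Proof.
case: cocycle => _ alt _ _; apply/eqP; rewrite -addr_eq0 addrC; apply/eqP.
have h U W : gamma U U W = 0 by case: (alt U W).
have := h (X + Y) T; rewrite !linearD /= !add_lfunE !h addr0 add0r.
by [].
Qed.

Lemma gamma_anti23 X Y T : gamma X Y T = - gamma X T Y.
Proof.
case: cocycle => _ alt _ _; apply/eqP; rewrite -addr_eq0 addrC; apply/eqP.
have h U W : gamma W U U = 0 by case: (alt U W).
have := h (Y + T) X; rewrite !linearD /= !add_lfunE !h addr0 add0r.
by [].
Qed.

Lemma alpha_cocycle X Y T : ce_d2 br rho alpha X Y T = 0.
Proof. by case: cocycle => _ _ h _; exact: h. Qed.

Definition mkd (Z : dualv l) (A : a) (L : l) : d := (Z, A, L).

Lemma dP u v : u.1.1 = v.1.1 -> u.1.2 = v.1.2 -> u.2 = v.2 -> u = v.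
Proof. by case: u v => [[Z A] L] [[Z' A'] L'] /= -> -> ->. Qed.

Lemma d11P k u v : (k *: u + v).1.1 = k *: u.1.1 + v.1.1. Proof. by []. Qed.
Lemma d12P k u v : (k *: u + v).1.2 = k *: u.1.2 + v.1.2. Proof. by []. Qed.
Lemma d2P k u v : (k *: u + v).2 = k *: u.2 + v.2. Proof. by []. Qed.
Definition dPE := (d11P, d12P, d2P).

Lemma bracket_comp_linear k X Y W T A B C (Z1 Z2 Z3 : dualv l) :
  gamma X (k *: Y + W) T - form (k *: B + C) (alpha X T) + form A (alpha (k *: Y + W) T)
  - (k *: Z2 + Z3) (br X T) + Z1 (br (k *: Y + W) T) + form (rho T A) (k *: B + C)
  = k * (gamma X Y T - form B (alpha X T) + form A (alpha Y T) -
         Z2 (br X T) + Z1 (br Y T) + form (rho T A) B)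
    + (gamma X W T - form C (alpha X T) + form A (alpha W T) -
       Z3 (br X T) + Z1 (br W T) + form (rho T A) C).
Proof.
rewrite (lfun_lin2 (gamma _)) (lfun_lin2 form) (lfun_lin2 alpha) (lfun_lin2 br) lfun_lin0.
rewrite (lfun_lin1 (form A)) (lfun_lin1 (form (rho T _))) (lfun_lin1 Z1) !regular_scale.
ring.
Qed.

Lemma bracket_comp_linearl k X Y W T A B C (Z1 Z2 Z3 : dualv l) :
  gamma (k *: Y + W) X T - form A (alpha (k *: Y + W) T) + form (k *: B + C) (alpha X T)
  - Z1 (br (k *: Y + W) T) + (k *: Z2 + Z3) (br X T) + form (rho T (k *: B + C)) A
  = k * (gamma Y X T - form A (alpha Y T) + form B (alpha X T) -
         Z1 (br Y T) + Z2 (br X T) + form (rho T B) A)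
    + (gamma W X T - form A (alpha W T) + form C (alpha X T) -
       Z1 (br W T) + Z3 (br X T) + form (rho T C) A).
Proof.
rewrite (lfun_lin3 gamma) (lfun_lin1 (rho T)) !(lfun_lin2 form) (lfun_lin2 alpha).
rewrite (lfun_lin2 br) lfun_lin0 (lfun_lin1 (form A)) (lfun_lin1 Z1) !regular_scale.
ring.
Qed.

Lemma rho_term_linear A B : linear (fun L => form (rho L A) B : R^o).
Proof. by move=> k X Y; rewrite !lfunLE. Qed.

Lemma bracket_funE u v : [/\ (std_bracket_fun br rho form alpha gamma u v).2 = br u.2 v.2,
  (std_bracket_fun br rho form alpha gamma u v).1.2
    = alpha u.2 v.2 + rho u.2 v.1.2 - rho v.2 u.1.2 &
  forall T, (std_bracket_fun br rho form alpha gamma u v).1.1 T =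
    gamma u.2 v.2 T - form v.1.2 (alpha u.2 T) + form u.1.2 (alpha v.2 T)
    - v.1.1 (br u.2 T) + u.1.1 (br v.2 T) + form (rho T u.1.2) v.1.2].
Proof.
case: u v => [[Z1 A1] L1] [[Z2 A2] L2]; split=> // T /=.
rewrite !(add_lfunE, opp_lfunE, comp_lfunE) linfunE //; exact: rho_term_linear.
Qed.

Lemma bracket_fun_linear u : linear (std_bracket_fun br rho form alpha gamma u).
Proof.
move=> k v w.
have [e1 e2 e3] := bracket_funE u (k *: v + w).
have [f1 f2 f3] := bracket_funE u v; have [g1 g2 g3] := bracket_funE u w.
apply: dP; rewrite !dPE.
- apply/lfunP => T; rewrite [RHS]add_lfunE [in RHS]scale_lfunE e3 f3 g3.
  exact: bracket_comp_linear.
- rewrite e2 f2 g2 !dPE; move: (u.2) (v.2) (w.2) (u.1.2) (v.1.2) (w.1.2) => X Y W A B C.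
  rewrite (lfun_lin1 (alpha _)) (lfun_lin1 (rho _)) (lfun_lin2 rho).
  exact: lmod_comb.
- by rewrite e1 f1 g1 dPE linearP.
Qed.

Lemma bracket_fun_linearl v :
  linear (fun u => std_bracket_fun br rho form alpha gamma u v).
Proof.
move=> k u w.
have [e1 e2 e3] := bracket_funE (k *: u + w) v.
have [f1 f2 f3] := bracket_funE u v; have [g1 g2 g3] := bracket_funE w v.
apply: dP; rewrite !dPE.
- apply/lfunP => T; rewrite [RHS]add_lfunE [in RHS]scale_lfunE e3 f3 g3.
  exact: bracket_comp_linearl.
- rewrite e2 f2 g2 !dPE; move: (u.2) (v.2) (w.2) (u.1.2) (v.1.2) (w.1.2) => X Y W A B C.
  rewrite (lfun_lin2 alpha) (lfun_lin2 rho) (lfun_lin1 (rho _)).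
  exact: lmod_comb.
- by rewrite e1 f1 g1 dPE linearP add_lfunE scale_lfunE.
Qed.

Lemma std_bracketE u v : ad u v = std_bracket_fun br rho form alpha gamma u v.
Proof.
have lin x y : linfun (std_bracket_fun br rho form alpha gamma x) y
    = std_bracket_fun br rho form alpha gamma x y.
  exact: linfunE (bracket_fun_linear x) y.
rewrite /std_bracket linfunE ?lin // => k x y; apply/lfunP => w.
rewrite [RHS]add_lfunE [in RHS]scale_lfunE !lin; exact: (bracket_fun_linearl w).
Qed.

Lemma ad2 u v : (ad u v).2 = br u.2 v.2.
Proof. by rewrite std_bracketE; case: (bracket_funE u v). Qed.

Lemma ad12 u v : (ad u v).1.2 = alpha u.2 v.2 + rho u.2 v.1.2 - rho v.2 u.1.2.
Proof. by rewrite std_bracketE; case: (bracket_funE u v). Qed.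

Lemma ad11 u v T : (ad u v).1.1 T =
    gamma u.2 v.2 T - form v.1.2 (alpha u.2 T) + form u.1.2 (alpha v.2 T)
    - v.1.1 (br u.2 T) + u.1.1 (br v.2 T) + form (rho T u.1.2) v.1.2.
Proof. by rewrite std_bracketE; case: (bracket_funE u v). Qed.

Lemma std_formE u v : Bd u v = form u.1.2 v.1.2 + u.1.1 v.2 + v.1.1 u.2.
Proof.
have fE x y : std_form_fun form x y = form x.1.2 y.1.2 + x.1.1 y.2 + y.1.1 x.2.
  by case: x y => [[? ?] ?] [[? ?] ?].
have lin2 x : linear (std_form_fun form x : d -> R^o).
  move=> k y z; rewrite !fE !dPE.
  move: (x.2) (y.2) (z.2) (x.1.2) (y.1.2) (z.1.2) (x.1.1) (y.1.1) (z.1.1).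
  move=> X Y W A B C Z1 Z2 Z3.
  rewrite (lfun_lin1 (form _)) (lfun_lin1 Z1) lfun_lin0 !regular_scale; ring.
rewrite /std_form linfunE ?linfunE // => k x y; apply/lfunP => z.
rewrite [RHS]add_lfunE [in RHS]scale_lfunE !linfunE // !fE !dPE.
move: (x.2) (y.2) (z.2) (x.1.2) (y.1.2) (z.1.2) (x.1.1) (y.1.1) (z.1.1).
move=> X Y W A B C Z1 Z2 Z3.
rewrite (lfun_lin2 form) (lfun_lin1 Z3) lfun_lin0 !regular_scale; ring.
Qed.

Lemma BdC u v : Bd u v = Bd v u.
Proof. by rewrite !std_formE formC addrAC. Qed.

(** The terms of the l^*-component of the bracket are adjoint to those of the other two, so they
    cancel in pairs; the term in [gamma] cancels by antisymmetry in its last two arguments. *)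
Lemma Bd_skew x u v : Bd (ad x u) v = - Bd u (ad x v).
Proof.
rewrite !std_formE !ad2 !ad12 !ad11.
move: (x.2) (u.2) (v.2) (x.1.2) (u.1.2) (v.1.2) (x.1.1) (u.1.1) (v.1.1).
move=> X Y W A B C Z1 Z2 Z3.
rewrite !(linearD (form _)) !(linearN (form _)) !(linearD form) !(linearN form) /=.
rewrite !add_lfunE !opp_lfunE (gamma_anti23 X W) (lie_anti lie W Y) (linearN Z1) /=.
rewrite !rho_skew (alpha_anti W Y) (linearN (form A)) /=.
rewrite (formC B (alpha _ _)) (formC C (alpha _ _)) (formC B (rho W _)) rho_skew.
ring.
Qed.

Lemma ad_anti u v : ad u v = - ad v u.
Proof.
apply: dP.
- apply/lfunP => T; rewrite -[(- ad v u).1.1]/(- (ad v u).1.1) opp_lfunE !ad11.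
  move: (u.2) (v.2) (u.1.2) (v.1.2) (u.1.1) (v.1.1) => X Y A B Z1 Z2.
  by rewrite (gamma_anti12 X) (formC (rho T B)) !rho_skew; ring.
- rewrite -[RHS]/(- (ad v u).1.2) !ad12.
  move: (u.2) (v.2) (u.1.2) (v.1.2) => X Y A B.
  by rewrite (alpha_anti X) !opprD !opprK addrAC.
- by rewrite -[RHS]/(- (ad v u).2) !ad2 (lie_anti lie).
Qed.

Lemma Bd_nondeg u : (forall v, Bd u v = 0) -> u = 0.
Proof.
move=> h; apply: dP.
- apply/lfunP => T; have := h (mkd 0 0 T); rewrite std_formE /=.
  move: (u.2) (u.1.2) (u.1.1) => X A Z; rewrite linear0 !zero_lfunE.
  by rewrite add0r addr0.
- apply: form_nondeg => B; have := h (mkd 0 B 0); rewrite std_formE /=.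
  move: (u.2) (u.1.2) (u.1.1) => X A Z.
  by rewrite linear0 zero_lfunE !addr0.
- have h2 (Z : dualv l) : Z u.2 = 0.
    have := h (mkd Z 0 0); rewrite std_formE /=.
    by move: (u.2) (u.1.2) (u.1.1) => X A Z1; rewrite !linear0 !add0r.
  have [e|nz] := eqVneq u.2 0; first exact: e.
  have : u.2 \notin (0%VS : {vspace l}) by rewrite memv0.
  by move=> /ex_functional[Z [_ /eqP]]; rewrite h2.
Qed.

Lemma lker_Bd : lker Bd = 0%VS.
Proof. exact: nondegenerate_lker Bd_nondeg. Qed.

(** The l^*-component of the Jacobi identity for (Z, A, 0): it combines d alpha = 0 paired with A,
    the Jacobi identity of l under Z, and the representation property of rho. *)
Lemma jacobi_dual_comp X Y T A B C (Z : dualv l) :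
  form (rho Y A) (alpha X T)
  - (form A (alpha Y (br X T)) + Z (br Y (br X T)) + form (rho (br X T) A) C)
  - form (rho T B) (rho Y A)
  = form (rho X A) (alpha Y T)
    + (- form A (alpha X (br Y T)) - Z (br X (br Y T)) + form (rho (br Y T) B) A)
    + form (rho T (rho X A)) C
    + (form A (alpha (br X Y) T) + Z (br (br X Y) T)
       + form (rho T A) (alpha X Y + rho X C - rho Y B)).
Proof.
have := congr1 (form A) (alpha_cocycle X Y T); rewrite /ce_d2 linear0.
rewrite !(linearD (form _)) !(linearN (form _)) /=.
rewrite (alpha_anti Y (br X T)) (alpha_anti X (br Y T)) !(linearN (form A)) /=.
rewrite (lie_jacobi lie X Y T) (linearD Z) (linearN Z) /=.
rewrite (formC (rho T B)) (formC (rho (br Y T) B)) !rho_skew !rho_rep.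
rewrite !(linearD (form A)) !(linearN (form A)) /=.
lra.
Qed.

Lemma add11 u v T : (u + v).1.1 T = u.1.1 T + v.1.1 T.
Proof. exact: add_lfunE. Qed.

Lemma ad_l2 n y : n.2 = 0 -> (ad n y).2 = 0.
Proof. by move=> n0; rewrite ad2 n0 linear0 zero_lfunE. Qed.

Lemma ad_r2 n y : n.2 = 0 -> (ad y n).2 = 0.
Proof. by move=> n0; rewrite ad2 n0 linear0. Qed.

Lemma ad_l12 n y : n.2 = 0 -> (ad n y).1.2 = - rho y.2 n.1.2.
Proof.
move=> n0; rewrite ad12 n0; move: (y.2) (y.1.2) (n.1.2) => Y C A.
by rewrite linear0 zero_lfunE linear0 zero_lfunE !add0r.
Qed.

Lemma ad_r12 n y : n.2 = 0 -> (ad y n).1.2 = rho y.2 n.1.2.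
Proof.
move=> n0; rewrite ad12 n0; move: (y.2) (y.1.2) (n.1.2) => Y C A.
by rewrite linear0 (linear0 rho) zero_lfunE add0r subr0.
Qed.

Lemma ad_l11 n y T : n.2 = 0 -> (ad n y).1.1 T
  = form n.1.2 (alpha y.2 T) + n.1.1 (br y.2 T) + form (rho T n.1.2) y.1.2.
Proof.
move=> n0; rewrite ad11 n0.
move: (y.2) (y.1.2) (y.1.1) (n.1.2) (n.1.1) => Y C Z' A Z.
rewrite (linear0 gamma) !zero_lfunE (linear0 alpha) zero_lfunE (linear0 br) zero_lfunE.
by rewrite (linear0 (form C)) (linear0 Z') !subr0 add0r.
Qed.

Lemma ad_r11 n y T : n.2 = 0 -> (ad y n).1.1 T
  = - form n.1.2 (alpha y.2 T) - n.1.1 (br y.2 T) + form (rho T y.1.2) n.1.2.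
Proof.
move=> n0; rewrite ad11 n0.
move: (y.2) (y.1.2) (y.1.1) (n.1.2) (n.1.1) => Y C Z' A Z.
rewrite (linear0 (gamma Y)) zero_lfunE (linear0 alpha) zero_lfunE (linear0 br) zero_lfunE.
by rewrite (linear0 (form C)) (linear0 Z') !addr0 add0r.
Qed.

(* The Jacobi identity with one argument in the ideal l^* + a; it does not
   involve gamma. *)
Lemma ad_jacobi_partial x n y : n.2 = 0 -> ad x (ad n y) = ad (ad x n) y + ad n (ad x y).
Proof.
move=> n0; have n1 := ad_l2 y n0; have n2 := ad_r2 x n0.
apply: dP.
- apply/lfunP => T; rewrite add11 (ad_r11 x T n1) (ad_l11 y T n2).
  rewrite (ad_l11 (ad x y) T n0) (ad_l12 y n0) (ad_l11 y _ n0) (ad_r12 x n0).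
  rewrite (ad_r11 x _ n0) ad12 ad2.
  move: (x.2) (x.1.2) (n.1.2) (n.1.1) (y.2) (y.1.2) => X B A Z Y C.
  have := jacobi_dual_comp X Y T A B C Z.
  rewrite (linearN form) opp_lfunE (linearN (form (rho T B))) /= => e.
  rewrite opprK addrC addrA; move: e; lra.
- rewrite -[RHS]/((ad (ad x n) y).1.2 + (ad n (ad x y)).1.2).
  rewrite (ad_r12 x n1) (ad_l12 y n2) (ad_l12 (ad x y) n0) (ad_l12 y n0) (ad_r12 x n0) ad2.
  move: (x.2) (n.1.2) (y.2) => X A Y.
  by rewrite rho_rep linearN opprB addKr.
- by rewrite -[RHS]/((ad (ad x n) y).2 + (ad n (ad x y)).2) (ad_r2 x n1) (ad_l2 y n2) (ad_l2 _ n0) addr0.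
Qed.

(** * Ideals, socle and radical series of the standard model *)

Local Notation Soc k := (socle_series ad k).
Local Notation Rd k := (radical_series ad k).
Local Notation Rl k := (radical_series br k).
Local Notation Il := (std_dual_ideal l a).
Local Notation ideal := (submodule ad).

Definition proj_l : 'Hom(d, l) := linfun (fun u : d => u.2).
Definition proj_a : 'Hom(d, a) := linfun (fun u : d => u.1.2).
Definition proj_dual : 'Hom(d, dualv l) := linfun (fun u : d => u.1.1).

Lemma proj_lE u : proj_l u = u.2.
Proof. by rewrite /proj_l linfunE // => k x y; rewrite d2P. Qed.

Lemma proj_aE u : proj_a u = u.1.2.
Proof. by rewrite /proj_a linfunE // => k x y; rewrite d12P. Qed.

Lemma proj_dualE u : proj_dual u = u.1.1.
Proof. by rewrite /proj_dual linfunE // => k x y; rewrite d11P. Qed.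

(** The ideal l^* + a, written as the kernel of d -> l so that transport along this map applies. *)
Local Notation Ip := (lker proj_l).

Lemma mem_Ip u : (u \in Ip) = (u.2 == 0).
Proof. by rewrite memv_ker proj_lE. Qed.

Lemma mem_Il u : (u \in Il) <-> u.1.2 = 0 /\ u.2 = 0.
Proof.
have h Z : linfun (fun Z : dualv l => (Z, 0, 0) : d) Z = mkd Z 0 0.
  rewrite linfunE // => k x y; apply: dP => //=; first by rewrite scaler0 addr0.
  by rewrite scaler0 addr0.
rewrite /std_dual_ideal; split.
  by move=> /memv_imgP[Z _ ->]; rewrite h.
move=> [e1 e2]; have -> : u = linfun (fun Z : dualv l => (Z, 0, 0) : d) u.1.1.
  by rewrite h; apply: dP.
by rewrite memv_img // memvf.
Qed.

Lemma Il_Ip : (Il <= Ip)%VS.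
Proof. by apply/subvP => u /mem_Il[_ e]; rewrite mem_Ip e. Qed.

Lemma orth_Il : orthv Bd Il = Ip.
Proof.
apply: subv_eq; apply/subvP => u.
  move=> /mem_orthv h; rewrite mem_Ip; apply/eqP; apply: contrapT => /eqP nz.
  have : u.2 \notin (0%VS : {vspace l}) by rewrite memv0.
  move=> /ex_functional[Z [_ /eqP]]; apply.
  have := h (mkd Z 0 0); rewrite std_formE /= => e; rewrite -[RHS]e ?linear0 ?add0r //.
  by apply/mem_Il.
rewrite mem_Ip => /eqP u0; apply/mem_orthv => v /mem_Il[e1 e2].
by rewrite std_formE u0 e1 e2 !linear0 !addr0.
Qed.

Lemma orth_Ip : orthv Bd Ip = Il.
Proof. by rewrite -orth_Il orthvK ?lker_Bd ?sub0v //; exact: BdC. Qed.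

Lemma ideal_Ip : ideal Ip.
Proof. by move=> x v; rewrite !mem_Ip => /eqP v0; rewrite ad_r2. Qed.

Lemma ideal_Il : ideal Il.
Proof. by rewrite -orth_Ip; apply: submodule_orthv Bd_skew _ ideal_Ip. Qed.

Lemma orth_Rd k : orthv Bd (Rd k) = Soc k.
Proof. exact: (orthv_radical_series BdC Bd_skew lker_Bd). Qed.

Lemma orth_Soc k : orthv Bd (Soc k) = Rd k.
Proof. by rewrite -orth_Rd orthvK ?lker_Bd ?sub0v //; exact: BdC. Qed.

Lemma orth2 U : orthv Bd (orthv Bd U) = U.
Proof. by rewrite orthvK ?lker_Bd ?sub0v //; exact: BdC. Qed.

Lemma orth_cap U W : orthv Bd (U :&: W) = (orthv Bd U + orthv Bd W)%VS.
Proof. by rewrite orthv_cap ?lker_Bd ?sub0v //; exact: BdC. Qed.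

Lemma ideal_Soc k : ideal (Soc k).
Proof. exact: submodule_socle_series. Qed.

Lemma ideal_Rd k : ideal (Rd k).
Proof. exact: submodule_radical_series. Qed.

Lemma proj_l_fh x : exists X, forall v, proj_l (ad x v) = br X (proj_l v).
Proof. by exists x.2 => v; rewrite !proj_lE ad2. Qed.

Lemma proj_l_hf X : exists x, forall v, proj_l (ad x v) = br X (proj_l v).
Proof. by exists (mkd 0 0 X) => v; rewrite !proj_lE ad2. Qed.

Lemma limg_proj_l : limg proj_l = fullv.
Proof.
apply: subv_eq; first exact: subvf.
apply/subvP => X _; have -> : X = proj_l (mkd 0 0 X) by rewrite proj_lE.
by rewrite memv_img // memvf.
Qed.

Lemma proj_l_Rd k : (proj_l @: Rd k)%VS = Rl k.
Proof. exact: (limg_radical_series proj_l_fh proj_l_hf _ limg_proj_l). Qed.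

Lemma mem_Rl_lift k K : K \in Rl k -> exists2 u, u \in Rd k & u.2 = K.
Proof.
by rewrite -proj_l_Rd => /memv_imgP[u uR e]; exists u; rewrite // e proj_lE.
Qed.

Lemma Rd_Rl k u : u \in Rd k -> u.2 \in Rl k.
Proof. by move=> uR; rewrite -proj_l_Rd -proj_lE memv_img. Qed.

(** S_k is the orthogonal of R_k(d), which projects onto R_k(l). Equations in the dual of R_k(l) are
    therefore equations in l^* modulo S_k. *)
Lemma Il_Soc k u : u \in Il -> (u \in Soc k) <-> forall K, K \in Rl k -> u.1.1 K = 0.
Proof.
move=> /mem_Il[e1 e2]; rewrite -orth_Rd; split.
  move=> /mem_orthv h K /mem_Rl_lift[v vR <-]; have := h v vR.
  by rewrite std_formE e1 e2 !linear0 zero_lfunE add0r addr0.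
move=> h; apply/mem_orthv => v /Rd_Rl vR.
by rewrite std_formE e1 e2 !linear0 zero_lfunE add0r addr0 h.
Qed.

(** The projection to a is equivariant on l^* + a but not on d, so the comparison passes through
    [subvs_of Ip]. *)
Lemma Ip_Il_semisimple : ss_quotient ad Il Ip <-> semisimple rho.
Proof.
rewrite semisimpleE; pose f := sub_act ad Ip; pose h := (proj_a \o sub_incl Ip)%VF.
have hE (w : subvs_of Ip) : h w = (vsval w).1.2 by rewrite /h comp_lfunE sub_inclE proj_aE.
have w2 (w : subvs_of Ip) : (vsval w).2 = 0.
  by have := subvsP w; rewrite mem_Ip => /eqP.
have step x (w : subvs_of Ip) : h (f x w) = rho x.2 (h w).
  by rewrite !hE /f sub_actE; [rewrite ad_r12|exact: ideal_Ip].
have fh x : exists X, forall w : subvs_of Ip, h (f x w) = rho X (h w).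
  by exists x.2 => w; exact: step.
have hf X : exists x, forall w : subvs_of Ip, h (f x w) = rho X (h w).
  by exists (mkd 0 0 X) => w; rewrite step.
have [eq1 eq2] : (forall x, exists x', forall v : subvs_of Ip, sub_incl Ip (f x v)
    = ad x' (sub_incl Ip v)) /\ (forall x', exists x, forall v : subvs_of Ip,
    sub_incl Ip (f x v) = ad x' (sub_incl Ip v)).
  by split=> x; exists x => v; apply: sub_act_equivariant; exact: ideal_Ip.
have sk : submodule f (lker h).
  by rewrite -(lpreim0 h); apply: (submodule_preim fh); exact: submodule_0.
have hfull : limg h = fullv.
  apply: subv_eq; first exact: subvf.
  apply/subvP => A _; have uI : mkd 0 A 0 \in Ip by rewrite mem_Ip.
  have -> : A = h (vsproj Ip (mkd 0 A 0)) by rewrite hE vsprojK.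
  by rewrite memv_img // memvf.
have hker : (h @: lker h = 0)%VS by apply/eqP; rewrite -lkerE subvv.
have inclker : (sub_incl Ip @: lker h = Il)%VS.
  apply: subv_eq; apply/subvP => u.
    move=> /memv_imgP[w]; rewrite memv_ker hE => /eqP e ->.
    by rewrite sub_inclE; apply/mem_Il.
  move=> uI; have uP := subvP Il_Ip u uI.
  rewrite -(vsprojK uP) -sub_inclE memv_img // memv_ker hE vsprojK //.
  by case/mem_Il: uI => ->.
have -> : ss_quotient ad Il Ip <-> ss_quotient f (lker h) fullv.
  have -> : ss_quotient ad Il Ip <->
      ss_quotient ad (sub_incl Ip @: lker h)%VS (sub_incl Ip @: fullv)%VS.
    by rewrite inclker limg_sub_incl.
  split.
    apply: (ss_quotient_preim eq1 eq2) => //; [exact: submodule_full| |exact: subvf].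
    by rewrite lker_sub_incl sub0v.
  apply: (ss_quotient_img eq1 eq2) => //; [exact: submodule_full| |exact: subvf].
  by rewrite lker_sub_incl sub0v.
have -> : ss_quotient rho 0%VS fullv <->
    ss_quotient rho (h @: lker h)%VS (h @: fullv)%VS by rewrite hker hfull.
split.
  by apply: (ss_quotient_img fh hf) => //; [exact: submodule_full|exact: subvf].
by apply: (ss_quotient_preim fh hf) => //; [exact: submodule_full|exact: subvf].
Qed.

Lemma mem_center u : (u \in lker ad) <-> forall x, ad x u = 0.
Proof.
rewrite memv_ker; split=> [/eqP e x|h].
  by rewrite ad_anti e zero_lfunE oppr0.
by apply/eqP/lfunP => x; rewrite ad_anti h zero_lfunE oppr0.
Qed.

(** A complement X of [T :&: N] in T satisfies [d, X] <= X :&: N = 0, so it is central. *)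
Lemma ss_trivial_quotient T N : ideal T -> ideal N -> ss_quotient ad 0%VS T ->
  (forall x t, t \in T -> ad x t \in N) -> (T <= N + lker ad)%VS.
Proof.
move=> sT sN hs hN.
have [|||X [sX _ XT e c]] := hs (T :&: N)%VS.
- exact: submodule_cap.
- exact: sub0v.
- exact: capvSl.
rewrite -e; apply: addvS; first exact: capvSr.
apply/subvP => u uX; apply/mem_center => x; apply/eqP; rewrite -memv0 -c.
have uT := subvP XT u uX.
by rewrite !memv_cap (subvP XT) ?sX // hN.
Qed.

Lemma Ip_Il_trivial n u : n \in Ip -> u \in Il -> ad n u = 0.
Proof.
rewrite mem_Ip => /eqP n0 /mem_Il[e1 e2]; apply: dP.
- apply/lfunP => T; rewrite ad_l11 // e1 e2.
  move: (n.1.2) (n.1.1) => A Z.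
  by rewrite (linear0 alpha) (linear0 br) !zero_lfunE (linear0 (form A)) linear0 linear0 !addr0.
- by rewrite ad_l12 // e2 linear0 zero_lfunE oppr0.
- by rewrite ad_l2.
Qed.

Lemma Ip_Ip_Il n u : n \in Ip -> u \in Ip -> ad n u \in Il.
Proof.
rewrite !mem_Ip => /eqP n0 /eqP u0; apply/mem_Il.
by rewrite ad_l2 // ad_l12 // u0 linear0 zero_lfunE oppr0.
Qed.

(* The ideal l^* + a is nilpotent, so it acts trivially on the socle. *)
Lemma Ip_socle_trivial n s : n \in Ip -> s \in Soc 1 -> ad n s = 0.
Proof.
move=> nI sS; have [_ ssS _] := socle_seriesP ad 0.
pose P (U : {vspace d}) := forall n s, n \in Ip -> s \in Soc 1 -> ad n s \in U.
have [h1 h2] : P (least P) /\ forall W, P W -> (least P <= W)%VS.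
  apply: (@leastP _ _ P fullv); first by move=> *; exact: memvf.
  by move=> U W hU hW n' s' n'I s'S; rewrite memv_cap hU ?hW.
set Q := least P in h1 h2.
have sQ : ideal Q.
  move=> x; pose P' v := ad x v \in Q.
  have memP v : v \in subspace P' <-> P' v.
    apply: mem_subspace; rewrite /P'; first by rewrite linear0 mem0v.
    by move=> k u w hu hw; rewrite linearP memvD ?memvZ.
  move=> v vQ; apply/memP; apply: (subvP (h2 _ _) v vQ) => n' s' n'I s'S; apply/memP.
  rewrite /P' ad_jacobi_partial; last by move: n'I; rewrite mem_Ip => /eqP.
  by rewrite memvD ?h1 //; [exact: ideal_Ip|exact: ideal_Soc].
have QS : (Q <= Soc 1)%VS by apply: h2 => n' s' _ s'S; exact: ideal_Soc.
have QIp : (Q <= Ip)%VS.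
  by apply: h2 => n' s' n'I _; rewrite ad_anti memvN; exact: ideal_Ip.
have [|X [sX _ XS e c]] := ssS Q sQ _ QS; first exact: sub0v.
(* Q = [Ip, S_1] has a complement in S_1 on which Ip acts trivially, so Q = [Ip, Q]; iterating this,
   Q falls into Ip, then into l^*, then into 0. *)
have QE (U : {vspace d}) : (forall n q, n \in Ip -> q \in Q -> ad n q \in U) -> (Q <= U)%VS.
  move=> hU; apply: h2 => n' s' n'I; rewrite -e => /memv_addP[q qQ [x xX ->]].
  have x0 : ad n' x = 0.
    have : ad n' x \in (Q :&: X)%VS by rewrite memv_cap sX // h1 //; exact: (subvP XS).
    by rewrite c memv0 => /eqP.
  by rewrite linearD /= x0 addr0; exact: hU.
have QI : (Q <= Il)%VS.
  by apply: QE => n' q n'I /(subvP QIp) qI; exact: Ip_Ip_Il.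
have Q0 : (Q <= 0)%VS.
  by apply: QE => n' q n'I /(subvP QI) qI; rewrite Ip_Il_trivial // mem0v.
by apply/eqP; rewrite -memv0; apply: (subvP Q0); exact: h1.
Qed.

(** Commuting with a forces the a-component of t to be invariant, so [d, t] lies in l^* and
    [ss_trivial_quotient] applies. *)
Lemma socle_Ip : (Soc 1 :&: Ip <= (lker ad :&: Ip) + Il)%VS.
Proof.
have [_ ssS _] := socle_seriesP ad 0.
have sT : ideal (Soc 1 :&: Ip)%VS by apply: submodule_cap; [exact: ideal_Soc|exact: ideal_Ip].
have ssT : ss_quotient ad 0%VS (Soc 1 :&: Ip)%VS.
  apply: (ss_quotient_sub _ _ _ _ _ ssS) => //; [exact: submodule_0|exact: sub0v|exact: capvSl].
have le : (Soc 1 :&: Ip <= Il + lker ad)%VS.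
  apply: ss_trivial_quotient => // [|x t]; first exact: ideal_Il.
  rewrite memv_cap => /andP[tS]; rewrite mem_Ip => /eqP t0.
  apply/mem_Il; rewrite ad_r2 // ad_r12 //; split=> //.
  apply: form_nondeg => B; rewrite rho_skew.
  have nI : mkd 0 B 0 \in Ip by rewrite mem_Ip.
  have := congr1 (fun u : d => u.1.1 x.2) (Ip_socle_trivial nI tS).
  rewrite /= ad_l11 //= t0; move: (x.2) (t.1.2) => X A.
  rewrite (linear0 alpha) (linear0 br) !zero_lfunE (linear0 (form B)) !add0r.
  by rewrite rho_skew formC rho_skew opprK => ->; rewrite ?oppr0.
apply/subvP => t tT; have /memv_addP[i iI [z zC e]] := subvP le t tT.
rewrite e addrC; apply: memv_add => //; rewrite memv_cap zC /=.
have -> : z = t - i by rewrite e addrC addKr.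
by move: tT; rewrite memv_cap => /andP[_ tI]; rewrite memvB // (subvP Il_Ip).
Qed.

(** Commuting with l^* forces the l-component of t to be central in l, so [d, t] lies in l^* + a. *)
Lemma socle_center : (Soc 1 <= Ip + lker ad)%VS.
Proof.
have [_ ssS _] := socle_seriesP ad 0.
apply: ss_trivial_quotient => //; [exact: ideal_Soc|exact: ideal_Ip|].
move=> x t tS; rewrite mem_Ip ad2; apply/eqP; apply: contrapT => /eqP nz.
have : br x.2 t.2 \notin (0%VS : {vspace l}) by rewrite memv0.
move=> /ex_functional[Z [_ /eqP]]; apply.
have nI : mkd Z 0 0 \in Ip by rewrite mem_Ip.
have := congr1 (fun u : d => u.1.1 x.2) (Ip_socle_trivial nI tS).
rewrite /= ad_l11 //=; move: (x.2) (t.2) (t.1.2) => X K A.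
rewrite (linear0 form) zero_lfunE (linear0 (rho X)) (linear0 form) zero_lfunE add0r addr0.
by move=> h; rewrite (lie_anti lie X) (linearN Z) /= h zero_lfunE oppr0.
Qed.

Lemma center_socle : (lker ad <= Soc 1)%VS.
Proof.
have [_ _ m1] := socle_seriesP ad 0.
apply: m1; last first.
  apply: ss_quotient_trivial; first exact: sub0v.
  by move=> x v /mem_center ->; rewrite mem0v.
- exact: sub0v.
- by move=> x v /mem_center ->; rewrite mem0v.
Qed.

Lemma Bd_Ip u v : u \in Ip -> v \in Ip -> Bd u v = form u.1.2 v.1.2.
Proof.
rewrite !mem_Ip => /eqP u0 /eqP v0; rewrite std_formE u0 v0.
by rewrite !linear0 !addr0.
Qed.

(** On l^* + a the form of d is pulled back from that of a, with radical l^*; this expresses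
    non-degeneracy in a inside the lattice of d. *)
Lemma nondegenerate_proj (T : {vspace d}) : (T <= Ip)%VS ->
  nondegenerate_on form (proj_a @: T)%VS <-> ((T + Il) :&: orthv Bd T <= Il)%VS.
Proof.
move=> TI; split=> h.
  apply/subvP => v; rewrite memv_cap => /andP[/memv_addP[t tT [z zI e]] /mem_orthv ho].
  have [z1 z2] : z.1.2 = 0 /\ z.2 = 0 by apply/mem_Il.
  have tI := subvP TI t tT.
  have vI : v \in Ip by rewrite e memvD // (subvP Il_Ip).
  apply/mem_Il; split; last by move: vI; rewrite mem_Ip => /eqP.
  have vt : v.1.2 = t.1.2 by rewrite e -[LHS]/(t.1.2 + z.1.2) z1 addr0.
  apply: h; first by rewrite vt -proj_aE memv_img.
  move=> _ /memv_imgP[w wT ->]; rewrite proj_aE -Bd_Ip //; last exact: (subvP TI).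
  exact: ho.
move=> _ /memv_imgP[t tT ->]; rewrite proj_aE => ht.
suff : t \in Il by move=> /mem_Il[].
apply: (subvP h); rewrite memv_cap (subvP (addvSl _ _) t tT) /=.
apply/mem_orthv => w wT; rewrite Bd_Ip; try exact: (subvP TI).
by apply: ht; rewrite -proj_aE memv_img.
Qed.

(** The equations (i) and (ii) say that (Z0, -A0, L0) is central in d. *)
Lemma cond_A0E : cond_A0 br rho form alpha gamma <-> (lker ad <= Ip)%VS.
Proof.
split=> [h|h L0].
  apply/subvP => u /mem_center cu; rewrite mem_Ip; apply/eqP; apply: h.
    rewrite memv_cap !memv_ker; apply/andP; split; apply/eqP/lfunP => y.
      have := congr1 snd (cu (mkd 0 0 y)); rewrite ad2 /= => e.
      by rewrite (lie_anti lie) e oppr0 zero_lfunE.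
    have := congr1 (fun v : d => v.1.2) (cu (mkd 0 y 0)); rewrite /= ad12 /=.
    move: (u.2) (u.1.2) => K A; rewrite (linear0 alpha) (linear0 rho) !zero_lfunE.
    by rewrite !add0r => /eqP; rewrite oppr_eq0 => /eqP.
  exists (- u.1.2), u.1.1 => L; split.
    have := congr1 (fun v : d => v.1.2) (cu (mkd 0 0 L)); rewrite /= ad12 /=.
    move: (u.2) (u.1.2) => K A; rewrite linear0 subr0 => /eqP.
    by rewrite addr_eq0 => /eqP->; rewrite linearN.
  apply/lfunP => T; have := congr1 (fun v : d => v.1.1 T) (cu (mkd 0 0 L)).
  rewrite /= ad11 /= [RHS]zero_lfunE add_lfunE opp_lfunE !comp_lfunE.
  move: (u.2) (u.1.2) (u.1.1) => K A Z.
  rewrite (linear0 form) (linear0 (rho T)) (linear0 form) !zero_lfunE (linearN form) opp_lfunE.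
  by rewrite !addr0 opprK => /eqP; rewrite -addrA -opprD subr_eq0 => /eqP.
rewrite memv_cap !memv_ker => /andP[/eqP bL /eqP rL] [A0 [Z0 hL]].
have bL' X : br X L0 = 0 by rewrite (lie_anti lie) bL zero_lfunE oppr0.
suff : mkd Z0 (- A0) L0 \in lker ad.
  by move=> /(subvP h); rewrite mem_Ip => /eqP.
apply/mem_center => x; apply: dP.
- apply/lfunP => T; rewrite ad11 /=; have [_ e] := hL x.2; rewrite e.
  have [eT _] := hL T.
  move: (x.2) (x.1.2) (x.1.1) {hL e} => X B Z.
  rewrite add_lfunE opp_lfunE !comp_lfunE bL zero_lfunE (linear0 Z) zero_lfunE.
  rewrite (linearN form) opp_lfunE opprK (linearN (form (rho T B))) /= rho_skew -eT.
  by rewrite (alpha_anti L0) (linearN (form B)) /=; ring.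
- rewrite ad12 /= rL; have [e _] := hL x.2; rewrite e.
  move: (x.2) (x.1.2) => X B.
  by rewrite linearN subrr zero_lfunE subr0.
- by rewrite ad2 /= bL'.
Qed.

Lemma mem_invariants A : (A \in invariants rho) <-> forall X, rho X A = 0.
Proof.
have := @greatestP _ _ (fun U : {vspace a} => forall X B, B \in U -> rho X B = 0) 0%VS.
case=> [X B|U W hU hW X B|h1 h2].
- by rewrite memv0 => /eqP->; rewrite linear0.
- by move=> /memv_addP[C CU [D DW ->]]; rewrite linearD /= hU // hW // addr0.
split=> [AI X|h]; first exact: h1 AI.
rewrite memvE; apply: h2 => X B /vlineP[k ->].
by rewrite linearZ /= h scaler0.
Qed.

Lemma act_imageP : (forall X A, rho X A \in act_image rho) /\
  forall U : {vspace a}, (forall X A, rho X A \in U) -> (act_image rho <= U)%VS.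
Proof.
apply: (@leastP _ _ (fun U : {vspace a} => forall X A, rho X A \in U) fullv).
  by move=> X A; exact: memvf.
by move=> U W hU hW X A; rewrite memv_cap hU hW.
Qed.

Lemma act_image_submodule : submodule rho (act_image rho).
Proof. by case: act_imageP => h _ X A _; exact: h. Qed.

Lemma invariants_submodule : submodule rho (invariants rho).
Proof. by move=> X A /mem_invariants ->; rewrite mem0v. Qed.

Lemma invariants_decomposition : semisimple rho ->
  (invariants rho + act_image rho = fullv)%VS /\
  (invariants rho :&: act_image rho = 0)%VS.
Proof.
move=> ssr; have [h1 h2] := act_imageP; split.
  have [W [sW e c]] := ssr _ act_image_submodule.
  apply: subv_eq; first exact: subvf.
  rewrite -{1}e addvC; apply: addvS => //.
  apply/subvP => A AW; apply/mem_invariants => X; apply/eqP.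
  by rewrite -memv0 -c memv_cap h1 sW.
have [W [sW e c]] := ssr _ invariants_submodule.
have le : (act_image rho <= W)%VS.
  apply: h2 => X A; have : A \in fullv by exact: memvf.
  rewrite -e => /memv_addP[u /mem_invariants hu [w wW ->]].
  by rewrite linearD /= hu add0r; exact: sW.
apply: subv_eq; last exact: sub0v.
by rewrite -c; exact: capvS.
Qed.

Lemma alpha_0E X Y : alpha_0 rho alpha X Y
  = daddv_pi (invariants rho) (act_image rho) (alpha X Y).
Proof.
rewrite /alpha_0 linfunE ?comp_lfunE // => k u v.
by rewrite linearP comp_lfunDr -comp_lfunZr.
Qed.

Lemma alpha_1E X Y : alpha_1 rho alpha X Y
  = daddv_pi (act_image rho) (invariants rho) (alpha X Y).
Proof.
rewrite /alpha_1 linfunE ?comp_lfunE // => k u v.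
by rewrite linearP comp_lfunDr -comp_lfunZr.
Qed.

Lemma alpha_decomposition : semisimple rho -> alpha = alpha_0 rho alpha + alpha_1 rho alpha.
Proof.
move=> /invariants_decomposition[e c]; apply/lfunP => X; apply/lfunP => Y.
by rewrite !add_lfunE alpha_0E alpha_1E daddv_pi_add // e memvf.
Qed.

Lemma form_invariant_image A B : A \in invariants rho -> B \in act_image rho -> form A B = 0.
Proof.
move=> /mem_invariants hA BI; have [_ h2] := act_imageP.
have /mem_orthv : A \in orthv form (act_image rho).
  rewrite memvE; apply: orthv_sub formC _ _ _; apply: h2 => X C.
  apply/mem_orthv => _ /vlineP[k ->].
  by rewrite rho_skew linearZ /= hA scaler0 linear0 oppr0.
exact.
Qed.

Lemma lker_form : lker form = 0%VS.
Proof. exact: nondegenerate_lker form_nondeg. Qed.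

Lemma orth_form2 (U : {vspace a}) : orthv form (orthv form U) = U.
Proof. by rewrite orthvK ?lker_form ?sub0v //; exact: formC. Qed.

Lemma nondegenerate_onE (U : {vspace a}) :
  nondegenerate_on form U <-> (U :&: orthv form U = 0)%VS.
Proof.
split=> [h|h v vU hv].
  apply: subv_eq; last exact: sub0v.
  apply/subvP => v; rewrite memv_cap memv0 => /andP[vU /mem_orthv ho].
  by apply/eqP; exact: h.
apply/eqP; rewrite -memv0 -h memv_cap vU /=; exact/mem_orthv.
Qed.

(** By skewness the invariants are the orthogonal of rho(l)a, which meets them in 0. *)
Lemma invariants_nondegenerate : semisimple rho ->
  (invariants rho :&: orthv form (invariants rho) = 0)%VS.
Proof.
move=> /invariants_decomposition[_ c]; rewrite -{2}[invariants rho]orth_form2.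
suff e : orthv form (act_image rho) = invariants rho by rewrite -e !orth_form2 e.
apply: subv_eq.
  apply/subvP => A /mem_orthv hA; apply/mem_invariants => X.
  apply: form_nondeg => B; rewrite rho_skew hA ?oppr0 //.
  by case: act_imageP => h _; exact: h.
apply/subvP => A AI; apply/mem_orthv => B BI; exact: form_invariant_image.
Qed.

(** In a non-degenerate N, a subspace and its orthogonal within N have the same intersection with
    their respective orthogonals. *)
Lemma nondegenerate_relative_orth (N U : {vspace a}) : (N :&: orthv form N = 0)%VS ->
  (U <= N)%VS -> nondegenerate_on form U <-> nondegenerate_on form (N :&: orthv form U)%VS.
Proof.
move=> N0 UN; rewrite !nondegenerate_onE.
suff -> : ((N :&: orthv form U) :&: orthv form (N :&: orthv form U)
           = U :&: orthv form U)%VS by [].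
rewrite orthv_cap ?lker_form ?sub0v //; last exact: formC.
rewrite orth_form2 [(N :&: orthv form U)%VS]capvC -capvA [(N :&: (_ + U))%VS]capvC.
rewrite [(orthv form N + U)%VS]addvC -vspace_modl // [(orthv form N :&: N)%VS]capvC N0.
by rewrite addv0 capvC.
Qed.

Lemma ext2_mapE (W : vectType R) (b : 'Hom(l, 'Hom(l, W))) (w : ext2 l) :
  ext2_map b w = \sum_(p : ext2_index l)
      (w p : R) *: b (vbasis {:l})`_(val p).1 (vbasis {:l})`_(val p).2.
Proof.
rewrite /ext2_map linfunE // => k u v; rewrite scaler_sumr -big_split /=.
by apply: eq_bigr => p _; rewrite !ffunE scalerDl scalerA.
Qed.

Definition ext2_delta (p : ext2_index l) : ext2 l :=
  [ffun q => ((q == p)%:R : R^o)].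

Lemma ext2_map_delta (W : vectType R) (b : 'Hom(l, 'Hom(l, W))) p :
  ext2_map b (ext2_delta p) = b (vbasis {:l})`_(val p).1 (vbasis {:l})`_(val p).2.
Proof.
rewrite ext2_mapE (bigD1 p) //= ffunE eqxx scale1r big1 ?addr0 // => q /negPf nq.
by rewrite ffunE nq scale0r.
Qed.

Lemma alpha_0_ker_sub : (alpha_0_ker br rho alpha <= invariants rho)%VS.
Proof.
apply/subvP => _ /memv_imgP[w _ ->]; rewrite ext2_mapE.
by apply: memv_suml => p _; rewrite memvZ // alpha_0E memv_pi.
Qed.

Lemma form_alpha_0 A X Y : semisimple rho -> A \in invariants rho ->
  form A (alpha X Y) = form A (alpha_0 rho alpha X Y).
Proof.
move=> ssr AI.
have -> : alpha X Y = alpha_0 rho alpha X Y + alpha_1 rho alpha X Y.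
  by rewrite {1}(alpha_decomposition ssr) !add_lfunE.
have h : form A (alpha_1 rho alpha X Y) = 0.
  by apply: form_invariant_image => //; rewrite alpha_1E memv_pi.
by rewrite (linearD (form A)) /= h addr0.
Qed.

(** (Z, A, 0) is central if and only if A is invariant and <A, alpha(X, Y)> = - Z([X, Y]). Such a Z
    exists exactly when A is orthogonal to alpha_0 of the kernel of the bracket. *)
Lemma proj_a_center : semisimple rho ->
  (proj_a @: (lker ad :&: Ip) = invariants rho :&: orthv form (alpha_0_ker br rho alpha))%VS.
Proof.
move=> ssr; apply: subv_eq; apply/subvP => A.
  move=> /memv_imgP[u + ->]; rewrite proj_aE memv_cap mem_Ip => /andP[/mem_center cu /eqP u0].
  have uI : u.1.2 \in invariants rho.
    apply/mem_invariants => X; have := congr1 (fun v : d => v.1.2) (cu (mkd 0 0 X)).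
    by rewrite /= ad_r12.
  rewrite memv_cap uI /=; apply/mem_orthv => B /memv_imgP[w + ->].
  rewrite memv_ker => /eqP w0; rewrite ext2_mapE linear_sum /=.
  have e X Y : form u.1.2 (alpha_0 rho alpha X Y) = - u.1.1 (br X Y).
    rewrite -form_alpha_0 //; have := congr1 (fun v : d => v.1.1 Y) (cu (mkd 0 0 X)).
    rewrite /= ad_r11 //=; move: (u.1.2) (u.1.1) => A1 Z1.
    rewrite (linear0 (rho Y)) (linear0 form) !zero_lfunE addr0 => /eqP.
    by rewrite subr_eq0 => /eqP <-; rewrite opprK.
  under eq_bigr do rewrite linearZ /= e -linearN -linearZ /=.
  by rewrite -linear_sum; under eq_bigr do rewrite scalerN;
    rewrite sumrN linearN -ext2_mapE w0 linear0 oppr0.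
rewrite memv_cap => /andP[AI /mem_orthv ho].
(* Since A is orthogonal to alpha_0(ker), pairing with A factors through the bracket; -s is the
   required Z. *)
have [s hs] : exists s : dualv l, forall w : ext2 l,
    (form A \o ext2_map (alpha_0 rho alpha))%VF w = s (ext2_map br w).
  apply: lfun_factor; apply/subvP => w wk; rewrite memv_ker comp_lfunE.
  by apply/eqP; apply: ho; rewrite memv_img.
have e X Y : form A (alpha X Y) = s (br X Y).
  rewrite form_alpha_0 //; set b := alpha_0 rho alpha in hs *.
  have banti X' Y' : b X' Y' = - b Y' X'.
    by rewrite /b !alpha_0E alpha_anti linearN.
  (* The exterior square has coordinates i < j only; the other pairs follow by antisymmetry. *)
  have eb (i j : 'I_(\dim {:l})) : form A (b (vbasis {:l})`_i (vbasis {:l})`_j)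
      = s (br (vbasis {:l})`_i (vbasis {:l})`_j).
    have lt (i' j' : 'I_(\dim {:l})) : (i' < j')%N ->
      form A (b (vbasis {:l})`_i' (vbasis {:l})`_j') = s (br (vbasis {:l})`_i' (vbasis {:l})`_j').
      move=> ij; pose p : ext2_index l := exist _ (i', j') ij.
      by have := hs (ext2_delta p); rewrite comp_lfunE !ext2_map_delta.
    have [ij|ji|/val_inj <-] := ltngtP i j; first exact: lt.
      by rewrite banti (lie_anti lie) (linearN (form A)) (linearN s) /= lt.
    have -> : b (vbasis {:l})`_i (vbasis {:l})`_i = 0.
      have /eqP := banti (vbasis {:l})`_i (vbasis {:l})`_i.
      by rewrite -addr_eq0 -mulr2n -scaler_nat scaler_eq0 pnatr_eq0 /= => /eqP.
    by have -> : br (vbasis {:l})`_i (vbasis {:l})`_i = 0; [case: lie|rewrite !linear0].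
  move: X; apply: vbasis_ind => [|k U V hU hV|i].
  - by rewrite (linear0 b) (linear0 br) !zero_lfunE !linear0.
  - by rewrite !lfun_lin2 (lfun_lin1 (form A)) (lfun_lin1 s) hU hV.
  move: Y; apply: vbasis_ind => [|k U V hU hV|j]; last exact: eb.
  - by rewrite (linear0 (b _)) (linear0 (br _)) !linear0.
  - by rewrite !lfun_lin1 hU hV.
have uC : mkd (- s) A 0 \in (lker ad :&: Ip)%VS.
  rewrite memv_cap mem_Ip eqxx andbT; apply/mem_center => x; apply: dP.
  - apply/lfunP => T; rewrite ad_r11 //= !opp_lfunE e; move: (x.2) (x.1.2) => X B.
    move/mem_invariants: AI => hA.
    by rewrite rho_skew hA linear0 oppr0 addr0 opprK addNr zero_lfunE.
  - by rewrite ad_r12 //=; move/mem_invariants: AI => ->.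
  - by rewrite ad_r2.
by have := memv_img proj_a uC; rewrite proj_aE.
Qed.

Lemma cond_B0E : semisimple rho -> cond_B0 br rho form alpha <->
  ((lker ad :&: Ip + Il) :&: orthv Bd (lker ad :&: Ip) <= Il)%VS.
Proof.
move=> ssr; rewrite -nondegenerate_proj ?capvSr // proj_a_center //.
apply: nondegenerate_relative_orth; first exact: invariants_nondegenerate.
exact: alpha_0_ker_sub.
Qed.

(** Solving the equations for b amounts to lifting b to an ideal T in l^* + a with T :&: l^* inside
    S_k; the dictionary is <Phi(K), A> = Z(K) for (Z, A, 0) in T and K in R_k(l). *)
Lemma b_E k : (0 < k)%N -> semisimple rho ->
  b_ br rho form alpha k = (proj_a @: (Soc k.+1 :&: Ip))%VS.
Proof.
move=> k0 ssr; have [leS ssS maxS] := socle_seriesP ad k.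
have ssI := proj2 Ip_Il_semisimple ssr.
have rho0 X A : X \in Rl k -> rho X A = 0.
  move=> XR; rewrite (@radical1_trivial _ _ _ br rho lie) ?zero_lfunE //.
    by move=> X' Y v; exact: rho_rep.
  exact: (subvP (radical_series_homo _ k0)).
have RlI X Y : Y \in Rl k -> br X Y \in Rl k by exact: submodule_radical_series.
have sTI : ideal (Soc k.+1 :&: Ip)%VS.
  by apply: submodule_cap; [exact: ideal_Soc|exact: ideal_Ip].
apply: greatest_eq.
  split.
    move=> X _ /memv_imgP[t tT ->]; rewrite proj_aE.
    have -> : rho X t.1.2 = proj_a (ad (mkd 0 0 X) t).
      by move: tT; rewrite memv_cap mem_Ip => /andP[_ /eqP t0]; rewrite proj_aE ad_r12.
    by rewrite memv_img // sTI.
  (* Lifting b modulo the part S_k of l^* makes Z a function of A on R_k. *)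
  have ssN : ss_quotient ad (Soc k :&: Il)%VS (Soc k.+1 :&: Ip)%VS.
    have h1 := ss_quotient_cap (@ideal_Soc k) (@ideal_Soc k.+1) ideal_Ip leS ssS.
    have h2 := ss_quotient_cap ideal_Il ideal_Ip (@ideal_Soc k.+1) Il_Ip ssI.
    rewrite [(Ip :&: _)%VS]capvC in h2.
    have -> : (Soc k :&: Il = (Soc k :&: Ip) :&: (Il :&: Soc k.+1))%VS.
      apply: subv_eq; apply/subvP => u; rewrite !memv_cap.
        move=> /andP[uS uI]; rewrite uS uI (subvP Il_Ip) // (subvP leS) //.
      by move=> /andP[/andP[-> _] /andP[-> _]].
    apply: ss_quotient_capA => //.
    - by apply: submodule_cap; [exact: ideal_Soc|exact: ideal_Ip].
    - by apply: submodule_cap; [exact: ideal_Il|exact: ideal_Soc].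
    - by apply: capvS.
    - by rewrite capvC; apply: capvS => //; exact: Il_Ip.
  have [|||T [sT NT TS eT cT]] := ssN (Soc k.+1 :&: Il)%VS.
  - by apply: submodule_cap; [exact: ideal_Soc|exact: ideal_Il].
  - exact: capvS.
  - by apply: capvS => //; exact: Il_Ip.
  have pT : (proj_a @: T = proj_a @: (Soc k.+1 :&: Ip))%VS.
    rewrite -eT limgD; apply/esym/addv_idPr; apply/subvP => _ /memv_imgP[u + ->].
    by rewrite memv_cap proj_aE => /andP[_ /mem_Il[-> _]]; rewrite mem0v.
  have [s hs] := ex_section proj_a T.
  have formI : lker form == 0%VS by rewrite lker_form.
  pose ev : 'Hom(l, dualv a) :=
    linfun (fun X => linfun (fun A => (proj_dual (s A) : dualv l) X : R^o)).
  have evE X A : ev X A = (s A).1.1 X.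
    have lin2 (Y : l) : linear (fun A => (proj_dual (s A) : dualv l) Y : R^o).
      by move=> c B C; rewrite !linearP add_lfunE scale_lfunE.
    rewrite /ev linfunE ?linfunE ?proj_dualE // => c Y1 Y2; apply/lfunP => B.
    by rewrite add_lfunE scale_lfunE !linfunE // linearP.
  have formV (phi : dualv a) : form (form^-1%VF phi) = phi.
    have [A <-] : exists A, form A = phi.
      apply: (form_represent formC) => A; rewrite lker_form memv0 => /eqP->.
      by rewrite linear0.
    by rewrite lker0_lfunK.
  (* Phi(K) represents the functional A |-> Z(K), with Z the l^*-component of the lift s A. *)
  exists (form^-1 \o ev \o sub_incl (Rl k))%VF => L K B KR Bb.
  have PhiE X : X \in Rl k -> forall C,
      form ((form^-1 \o ev \o sub_incl (Rl k))%VF (vsproj (Rl k) X)) C = (s C).1.1 X.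
    by move=> XR C; rewrite !comp_lfunE sub_inclE vsprojK // formV evE.
  rewrite -pT in Bb; have [sB eB] := hs B Bb; rewrite proj_aE in eB.
  have sIp u : u \in T -> u.2 = 0.
    by move=> /(subvP TS); rewrite memv_cap mem_Ip => /andP[_ /eqP].
  have rB : rho L B = (ad (mkd 0 0 L) (s B)).1.2 by rewrite (ad_r12 _ (sIp _ sB)) /= eB.
  have rBb : rho L B \in (proj_a @: T)%VS by rewrite rB -proj_aE memv_img // sT.
  have [sB' eB'] := hs _ rBb; rewrite proj_aE in eB'.
  (* Two lifts of the same vector to T differ by an element of S_k in l^*, which vanishes on
     R_k(l). *)
  have same : (s (rho L B)).1.1 K = (ad (mkd 0 0 L) (s B)).1.1 K.
    pose w := s (rho L B) - ad (mkd 0 0 L) (s B).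
    have wT : w \in T by rewrite memvB // sT.
    have wI : w \in Il.
      apply/mem_Il; split; last exact: sIp.
      by rewrite -[LHS]/((s (rho L B)).1.2 - (ad (mkd 0 0 L) (s B)).1.2) eB' rB subrr.
    have : w \in (Soc k.+1 :&: Il :&: T)%VS.
      by rewrite !memv_cap wI wT; move/(subvP TS): wT; rewrite memv_cap => /andP[->].
    rewrite cT memv_cap => /andP[wS _].
    have /(_ K KR) := proj1 (Il_Soc k wI) wS.
    rewrite -[w.1.1]/((s (rho L B)).1.1 - (ad (mkd 0 0 L) (s B)).1.1).
    by rewrite add_lfunE opp_lfunE => /eqP; rewrite subr_eq0 => /eqP.
  rewrite (linearB form) add_lfunE opp_lfunE /= rho_skew !PhiE ?RlI // same.
  rewrite (ad_r11 _ K (sIp _ sB)) /= eB; move: ((s B).1.1) => Z.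
  by rewrite (linear0 (rho K)) (linear0 form) zero_lfunE addr0 (formC B); ring.
move=> b [sb [Phi hPhi]].
(* Z is prescribed on R_k(l) and free elsewhere, so T meets l^* inside S_k. *)
pose P u := [/\ u.2 = 0, u.1.2 \in b
  & forall K, K \in Rl k -> u.1.1 K = form (Phi (vsproj (Rl k) K)) u.1.2].
have memP u : (u \in subspace P) <-> P u.
  apply: mem_subspace; first by split=> // [|K _]; rewrite ?mem0v // zero_lfunE linear0.
  move=> c x y [x1 x2 x3] [y1 y2 y3]; split.
  - by rewrite d2P x1 y1 scaler0 addr0.
  - by rewrite d12P memvD ?memvZ.
  - move=> K KR; rewrite d11P d12P add_lfunE scale_lfunE x3 // y3 //.
    by rewrite [RHS]linearP.
set T := subspace P in memP.
have TIp : (T <= Ip)%VS by apply/subvP => u /memP[e _ _]; rewrite mem_Ip e.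
have sT : ideal T.
  move=> x u /memP[u0 ub uZ]; apply/memP; split; first by rewrite ad_r2.
    by rewrite ad_r12 //; exact: sb.
  move=> K KR; rewrite ad_r11 // ad_r12 //.
  have := hPhi x.2 K u.1.2 KR ub; rewrite (uZ _ (RlI _ _ KR)).
  move: (x.2) (x.1.2) (u.1.2) => X B A; rewrite (linearB form) add_lfunE opp_lfunE /= => e.
  (* The bracket has a further term <rho(K)B, A>, absent from (B_k); it vanishes as K lies in
     R_1(l). *)
  by rewrite (rho0 K B KR) (linear0 form) zero_lfunE addr0 (formC A) e rho_skew; ring.
have bT : (b <= proj_a @: T)%VS.
  apply/subvP => B Bb.
  pose u := mkd ((form B \o Phi \o linfun (vsproj (Rl k)))%VF) B 0.
  have uT : u \in T.
    apply/memP; split=> //= K KR.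
    by rewrite !comp_lfunE [linfun _ _]lfunE /= formC.
  by have := memv_img proj_a uT; rewrite proj_aE.
apply: subv_trans bT _; apply: limgS; apply: sub_capr => //.
have TI : (T :&: Il <= Soc k)%VS.
  apply/subvP => u; rewrite memv_cap => /andP[/memP[_ _ uZ] uI].
  apply/(Il_Soc k uI) => K KR; rewrite uZ //.
  by case/mem_Il: uI => -> _; rewrite linear0.
apply: subv_trans (addvSl _ (Soc k)) _; apply: maxS.
- by apply: submodule_add => //; exact: ideal_Soc.
- exact: addvSr.
apply: ss_quotient_capl => //; first exact: ideal_Soc.
(* T modulo T :&: l^* embeds in the semisimple module a, and T :&: l^* lies in S_k, so T lies in
   S_(k+1). *)
have h := ss_quotient_cap ideal_Il ideal_Ip sT Il_Ip ssI.
rewrite (capv_idPr TIp) in h.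
apply: (ss_quotient_sub _ _ _ _ _ h) => //.
- by apply: submodule_cap => //; exact: ideal_Soc.
- by apply: sub_capr; [exact: capvSr|rewrite capvC].
- exact: capvSl.
Qed.

Lemma cond_BE k : (0 < k)%N -> semisimple rho -> cond_B br rho form alpha k <->
  ((Soc k.+1 :&: Ip + Il) :&: orthv Bd (Soc k.+1 :&: Ip) <= Il)%VS.
Proof.
by move=> k0 ssr; rewrite /cond_B b_E // nondegenerate_proj // capvSr.
Qed.

(** The socle of l is a semisimple l-module under the restricted adjoint action, to which
    [radical1_trivial] applies. *)
Lemma radical1_socle_trivial K X : K \in socle br -> X \in Rl 1 -> br X K = 0.
Proof.
move=> KS XR; have [sS ssS _] := socleP br.
pose f := sub_act br (socle br).
have flin : linear f.
  move=> c Y1 Y2; apply/lfunP => w; apply: subvs_inj.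
  rewrite lfun_lin0 [RHS]linearP /f sub_actE // lfun_lin2.
  by rewrite -!(sub_actE _ _ sS).
have fE : fun_of_lfun (linfun f) = f by apply/funext => Y; exact: linfunE.
have := @radical1_trivial R l _ br (linfun f) lie.
rewrite fE => /(_ _ _ X XR) h.
have : f X = 0.
  apply: h.
    move=> Y1 Y2 w; apply: subvs_inj.
    by rewrite linearB /= !sub_actE // lie_jacobi.
  by apply/semisimple_sub.
move=> /(congr1 (fun h : 'End(subvs_of (socle br)) => vsval (h (vsproj (socle br) K)))).
by rewrite /f sub_actE // vsprojK // zero_lfunE linear0.
Qed.

Lemma rho_Rl1 X A : semisimple rho -> X \in Rl 1 -> rho X A = 0.
Proof.
move=> ssr XR; rewrite (@radical1_trivial _ _ _ br rho lie) ?zero_lfunE //.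
by move=> X' Y v; exact: rho_rep.
Qed.

(* Condition (A_k) says that no ideal of l other than 0 lifts to d modulo the
   part S_k of l^*: the lift is the graph of (Phi_2, - Phi_1). *)
Lemma cond_A_of_lift k (W : {vspace d}) (I : {vspace l}) :
  ideal W -> (W :&: Ip <= Soc k :&: Il)%VS -> (proj_l @: W)%VS = I ->
  submodule br I -> (I <= Rl k)%VS ->
  exists (Phi1 : 'Hom(subvs_of I, a)) (Phi2 : 'Hom(subvs_of I, dualv (subvs_of (Rl k)))),
    forall L K, K \in I ->
       alpha L K = rho L (Phi1 (vsproj I K)) - Phi1 (vsproj I (br L K)) /\
       (forall X, X \in Rl k ->
          gamma L K X =
            - form (Phi1 (vsproj I K)) (alpha L X)
            + Phi2 (vsproj I K) (vsproj (Rl k) (br L X))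
            + Phi2 (vsproj I (br L K)) (vsproj (Rl k) X)).
Proof.
move=> sW WN WI sI IR; have [s hs] := ex_section proj_l W; rewrite WI in hs.
pose Phi1 := (- (proj_a \o s \o sub_incl I))%VF.
pose Phi2 := (dual_restr (Rl k) \o proj_dual \o s \o sub_incl I)%VF.
have Phi1E K : K \in I -> Phi1 (vsproj I K) = - (s K).1.2.
  by move=> KI; rewrite /Phi1 opp_lfunE !comp_lfunE sub_inclE vsprojK // proj_aE.
have Phi2E K X : K \in I -> X \in Rl k ->
    Phi2 (vsproj I K) (vsproj (Rl k) X) = (s K).1.1 X.
  move=> KI XR; rewrite /Phi2 !comp_lfunE sub_inclE vsprojK // dual_restrE vsprojK //.
  by rewrite proj_dualE.
exists Phi1, Phi2 => L K KI.
have brI : br L K \in I by exact: sI.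
have [sW1 e1] := hs K KI; have [sW2 e2] := hs _ brI; rewrite !proj_lE in e1 e2.
(* The defect of equivariance of the section lies in S_k and l^*. Its a-component being 0 is (i),
   its l^*-component vanishing on R_k(l) is (ii). *)
pose w := ad (mkd 0 0 L) (s K) - s (br L K).
have wI : w \in (Soc k :&: Il)%VS.
  apply: (subvP WN); rewrite memv_cap memvB ?sW //= mem_Ip.
  by rewrite -[w.2]/((ad (mkd 0 0 L) (s K)).2 - (s (br L K)).2) ad2 /= e1 e2 subrr.
move: wI; rewrite memv_cap => /andP[wS wI]; have [w1 _] := proj1 (mem_Il w) wI.
split.
  move: w1; rewrite -[w.1.2]/((ad (mkd 0 0 L) (s K)).1.2 - (s (br L K)).1.2) ad12 /= e1.
  rewrite !Phi1E // (linear0 (rho K)) subr0 (linearN (rho L)) /= => /eqP.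
  by rewrite subr_eq0 => /eqP <-; rewrite opprK addrC addrK.
move=> X XR; have /(_ X XR) := proj1 (Il_Soc k wI) wS.
rewrite -[w.1.1]/((ad (mkd 0 0 L) (s K)).1.1 - (s (br L K)).1.1) add_lfunE opp_lfunE.
rewrite ad11 /= e1 Phi1E // !Phi2E //; last by apply: submodule_radical_series XR.
move: ((s K).1.2) ((s K).1.1) ((s (br L K)).1.1) => A Z Z'.
rewrite (linear0 form) !zero_lfunE (linear0 (rho X)) (linear0 form) zero_lfunE.
rewrite (linearN form) opp_lfunE; lra.
Qed.

(** The ideal W consists of the (Z, -Phi1(K), K) with Z = Phi2(K) on R_k(l). The bracket terms not
    covered by (i) and (ii) contain rho(K), rho(X) or [X, K] with X in R_k(l); they vanish since
    R_1(l) acts trivially on a and on the socle. As W meets l^* + a inside S_k and W / (W :&: Ip) =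
    I is semisimple, W lies in S_(k+1). *)
Lemma lift_of_cond_A k (I : {vspace l}) (Phi1 : 'Hom(subvs_of I, a))
    (Phi2 : 'Hom(subvs_of I, dualv (subvs_of (Rl k)))) :
  (0 < k)%N -> semisimple rho -> submodule br I -> (I <= socle br :&: Rl k)%VS ->
  (forall L K, K \in I ->
       alpha L K = rho L (Phi1 (vsproj I K)) - Phi1 (vsproj I (br L K)) /\
       (forall X, X \in Rl k ->
          gamma L K X =
            - form (Phi1 (vsproj I K)) (alpha L X)
            + Phi2 (vsproj I K) (vsproj (Rl k) (br L X))
            + Phi2 (vsproj I (br L K)) (vsproj (Rl k) X))) ->
  exists W : {vspace d}, [/\ ideal W, (W <= Soc k.+1)%VS & (proj_l @: W)%VS = I].
Proof.
move=> k0 ssr sI ISR hPhi.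
have IS := subv_trans ISR (capvSl _ _); have IR := subv_trans ISR (capvSr _ _).
have R1 X : X \in Rl k -> X \in Rl 1 by exact: (subvP (radical_series_homo _ k0)).
pose P u := [/\ u.2 \in I, u.1.2 = - Phi1 (vsproj I u.2)
  & forall X, X \in Rl k -> u.1.1 X = Phi2 (vsproj I u.2) (vsproj (Rl k) X)].
have vlin c (X Y : l) : vsproj I (c *: X + Y) = c *: vsproj I X + vsproj I Y.
  exact: linearP.
have memP u : (u \in subspace P) <-> P u.
  apply: mem_subspace.
    split=> [||X _]; first exact: mem0v.
      by rewrite -[(0 : d).2]/(0 : l) (linear0 (vsproj I)) (linear0 Phi1) oppr0.
    rewrite -[(0 : d).2]/(0 : l) -[(0 : d).1.1]/(0 : dualv l).
    by rewrite (linear0 (vsproj I)) (linear0 Phi2) !zero_lfunE.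
  move=> c x y [x1 x2 x3] [y1 y2 y3]; split.
  - by rewrite d2P memvD ?memvZ.
  - by rewrite d12P d2P vlin (lfun_lin1 Phi1) x2 y2 scalerN opprD.
  - by move=> X XR; rewrite d11P d2P lfun_lin0 vlin (lfun_lin2 Phi2) x3 // y3.
set W := subspace P in memP.
have sW : ideal W.
  move=> x u /memP[uI uA uZ]; apply/memP; split; first by rewrite ad2; exact: sI.
    rewrite ad12 ad2 uA; have [-> _] := hPhi x.2 _ uI.
    rewrite (rho_Rl1 _ ssr (R1 _ (subvP IR _ uI))) subr0.
    by rewrite linearN addrAC subrr add0r.
  move=> X XR; rewrite ad11 ad2 uA; have [_ /(_ X XR) ->] := hPhi x.2 _ uI.
  have [eX _] := hPhi X _ uI.
  have brX : br x.2 X \in Rl k by exact: submodule_radical_series.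
  rewrite uZ // (alpha_anti u.2) eX.
  have uX : br X u.2 = 0 by apply: radical1_socle_trivial; [exact: (subvP IS)|exact: R1].
  rewrite (lie_anti lie u.2) uX !(rho_Rl1 _ ssr (R1 _ XR)).
  move: (Phi1 _) (x.2) (x.1.2) (x.1.1) => A L B Z.
  rewrite (linear0 (vsproj _)) (linear0 Phi1) subr0 !oppr0 (linear0 (form B)) (linear0 Z).
  rewrite (linear0 form) zero_lfunE (linearN form) opp_lfunE; ring.
have WI : (proj_l @: W)%VS = I.
  apply: subv_eq; apply/subvP => K.
    by move=> /memv_imgP[u /memP[uI _ _] ->]; rewrite proj_lE.
  move=> KI; pose u := mkd (Phi2 (vsproj I K) \o linfun (vsproj (Rl k)))%VF
    (- Phi1 (vsproj I K)) K.
  have uW : u \in W.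
    by apply/memP; split=> //= X _; rewrite comp_lfunE [linfun _ _]lfunE.
  by have := memv_img proj_l uW; rewrite proj_lE.
exists W; split=> //.
have WN : (W :&: Ip <= Soc k)%VS.
  apply/subvP => u; rewrite memv_cap mem_Ip => /andP[/memP[_ uA uZ] /eqP u0].
  rewrite u0 !linear0 ?oppr0 in uA.
  have uI : u \in Il by apply/mem_Il; split.
  apply/(Il_Soc k uI) => X XR; rewrite uZ // u0.
  by rewrite (linear0 (vsproj _)) (linear0 Phi2) zero_lfunE.
have [sS ssS _] := socleP br.
have ssI : ss_quotient br 0%VS I.
  by apply: (ss_quotient_sub _ _ _ _ _ ssS) => //; [exact: submodule_0|exact: sub0v].
have ssW : ss_quotient ad Ip (W + Ip)%VS.
  apply: (ss_quotient_preim proj_l_fh proj_l_hf).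
  - exact: ideal_Ip.
  - by apply: submodule_add => //; exact: ideal_Ip.
  - exact: subvv.
  - exact: addvSr.
  have -> : (proj_l @: Ip = 0)%VS by apply/eqP; rewrite -lkerE subvv.
  rewrite limgD WI; have -> : (proj_l @: Ip = 0)%VS by apply/eqP; rewrite -lkerE subvv.
  by rewrite addv0.
have ssW2 := ss_quotient_addr sW ideal_Ip ssW.
have [leS _ maxS] := socle_seriesP ad k.
apply: subv_trans (addvSl _ (Soc k)) _; apply: maxS.
- by apply: submodule_add => //; exact: ideal_Soc.
- exact: addvSr.
apply: ss_quotient_capl => //; first exact: ideal_Soc.
apply: (ss_quotient_sub _ _ _ _ _ ssW2) => //.
- by apply: submodule_cap => //; exact: ideal_Soc.
- by apply: sub_capr => //; exact: capvSl.
- exact: capvSl.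
Qed.

(** * The canonical ideal and the layers of the two series *)

Lemma canonical_idealP :
  (forall k, (0 < k)%N -> (Rd k :&: Soc k <= canonical_ideal ad)%VS) /\
  forall U, (forall k, (0 < k)%N -> (Rd k :&: Soc k <= U)%VS) ->
    (canonical_ideal ad <= U)%VS.
Proof.
apply: (@leastP _ _ (fun U => forall k, (0 < k)%N -> (Rd k :&: Soc k <= U)%VS) fullv).
  by move=> k _; exact: subvf.
by move=> U W hU hW k k0; apply: sub_capr; [exact: hU|exact: hW].
Qed.

Definition layers n : {vspace d} := (\sum_(k < n) (Rd k :&: Soc k.+1))%VS.

(* The chains R_k and S_k generate a distributive lattice. *)
Lemma sub_layers (U : {vspace d}) :
  (forall k, (0 < k)%N -> (U <= Rd k + Soc k)%VS) -> exists n, (U <= layers n)%VS.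
Proof.
move=> hU; have [n Rn] := radical_series_eq0 ad.
exists n; rewrite -[layers n]addv0 -Rn; elim: n {Rn} => [|n IH].
  by rewrite /layers big_ord0 add0v subvf.
have layS : (layers n <= Soc n.+1)%VS.
  apply/subv_sumP => k _; apply: subv_trans (capvSr _ _) _.
  by apply: socle_series_homo; rewrite ltnS ltnW.
have [RS _ _] := radical_seriesP ad n.
(* Two applications of the modular law, using layers n <= S_(n+1) and R_(n+1) <= R_n, split off the
   next layer and leave R_(n+1). *)
apply: (@subv_trans _ _ ((layers n + Rd n) :&: (Soc n.+1 + Rd n.+1))%VS).
  by apply: sub_capr => //; rewrite addvC; exact: hU.
rewrite -vspace_modl; last by apply: subv_trans layS (addvSl _ _).
rewrite [(Rd n :&: _)%VS]capvC [(Soc _ + _)%VS]addvC -vspace_modl //.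
rewrite /layers big_ord_recr /= -addvA addvS // [(Rd n :&: _)%VS]capvC.
by rewrite addvC.
Qed.

Lemma ideal_layer k : ideal (Rd k :&: Soc k.+1)%VS.
Proof. by apply: submodule_cap; [exact: ideal_Rd|exact: ideal_Soc]. Qed.

(** Modulo R_k :&: S_k a layer is part of S_(k+1) / S_k; in [layer_semisimple_rad], modulo R_(k+1)
    :&: S_(k+1), it is part of R_k / R_(k+1). *)
Lemma layer_semisimple k (N : {vspace d}) : ideal N -> (Rd k :&: Soc k <= N)%VS ->
  ss_quotient ad N (Rd k :&: Soc k.+1 + N)%VS.
Proof.
move=> sN le; have [leS ssS _] := socle_seriesP ad k.
have h := ss_quotient_cap (@ideal_Soc k) (@ideal_Soc k.+1) (@ideal_Rd k) leS ssS.
rewrite ![(Soc _ :&: Rd k)%VS]capvC in h.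
apply: ss_quotient_capl => //; first exact: ideal_layer.
apply: (ss_quotient_sub _ _ _ _ _ h) => //.
- by apply: submodule_cap => //; exact: ideal_layer.
- exact: ideal_layer.
- by apply: sub_capr => //; exact: capvS.
- exact: capvSl.
Qed.

Lemma layer_semisimple_rad k (N : {vspace d}) : ideal N -> (Rd k.+1 :&: Soc k.+1 <= N)%VS ->
  ss_quotient ad N (Rd k :&: Soc k.+1 + N)%VS.
Proof.
move=> sN le; have [leR ssR _] := radical_seriesP ad k.
have h := ss_quotient_cap (@ideal_Rd k.+1) (@ideal_Rd k) (@ideal_Soc k.+1) leR ssR.
apply: ss_quotient_capl => //; first exact: ideal_layer.
apply: (ss_quotient_sub _ _ _ _ _ h) => //.
- by apply: submodule_cap => //; exact: ideal_layer.
- exact: ideal_layer.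
- by apply: sub_capr => //; exact: capvS.
- exact: capvSl.
Qed.

(** Invariance of the form. Regularity thus says that the centre of d is isotropic. *)
Lemma derived_orth : derived ad = orthv Bd (lker ad).
Proof.
have [h1 h2] : (forall x y, ad x y \in derived ad) /\
    forall U : {vspace d}, (forall x y, ad x y \in U) -> (derived ad <= U)%VS.
  apply: (@leastP _ _ (fun U : {vspace d} => forall x y, ad x y \in U) fullv).
    by move=> x y; exact: memvf.
  by move=> U W hU hW x y; rewrite memv_cap hU hW.
apply: subv_eq.
  apply: h2 => x y; apply/mem_orthv => u /mem_center cu.
  by rewrite Bd_skew cu linear0 oppr0.
rewrite -(orth2 (derived ad)); apply: orthvS; apply/subvP => u /mem_orthv hu.
apply/mem_center => x; apply: Bd_nondeg => v; rewrite Bd_skew hu ?oppr0 //.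
Qed.

(** * From a balanced extension to the conditions *)

Section Balanced.
Hypothesis bal : balanced br rho form alpha gamma.

Lemma balanced_layer j : (0 < j)%N -> (Rd j :&: Soc j <= Il)%VS.
Proof. by move=> j0; rewrite bal; case: canonical_idealP => h _; exact: h. Qed.

Lemma balanced_sub_Ip (W : {vspace d}) :
  (forall j, (0 < j)%N -> (W <= Rd j + Soc j)%VS) -> (W <= Ip)%VS.
Proof.
move=> hW; rewrite -orth_Il; apply: (orthv_sub BdC); rewrite bal.
case: canonical_idealP => _; apply=> j j0; have := orthvS Bd (hW j j0).
by apply: subv_trans; rewrite orthvD orth_Rd orth_Soc capvC.
Qed.

Lemma balanced_Ip_sub j : (0 < j)%N -> (Ip <= Rd j + Soc j)%VS.
Proof.
move=> j0; rewrite -orth_Il; have := orthvS Bd (balanced_layer j0).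
by rewrite orth_cap orth_Rd orth_Soc addvC.
Qed.

(** l^* + a lies in a sum of layers, each of which is semisimple modulo l^* because R_(k+1) :&:
    S_(k+1) is contained in l^*. *)
Lemma balanced_semisimple : semisimple rho.
Proof.
apply/Ip_Il_semisimple; have [n hn] := sub_layers (@balanced_Ip_sub).
have h : ss_quotient ad Il (Il + layers n)%VS.
  apply: ss_quotient_big => [|k|k]; [exact: ideal_Il|exact: ideal_layer|].
  by rewrite addvC; apply: layer_semisimple_rad; [exact: ideal_Il|exact: balanced_layer].
apply: (ss_quotient_sub _ _ _ _ _ h); first exact: ideal_Il.
- exact: ideal_Ip.
- exact: subvv.
- exact: Il_Ip.
- by apply: subv_trans hn (addvSr _ _).
Qed.

Lemma balanced_center : (lker ad <= Ip)%VS.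
Proof.
apply: balanced_sub_Ip => j j0; apply: subv_trans center_socle _.
apply: subv_trans (addvSr _ _); exact: socle_series_homo.
Qed.

(** Each R_j :&: S_j lies in S_(k+1) or in R_(k+1) according to the size of j, so l^* splits along
    the two. *)
Lemma balanced_nondegenerate k :
  ((Soc k.+1 :&: Ip + Il) :&: orthv Bd (Soc k.+1 :&: Ip) <= Il)%VS.
Proof.
have split_Il : (Il <= Il :&: Soc k.+1 + Il :&: Rd k.+1)%VS.
  rewrite {1}bal; case: canonical_idealP => _; apply=> j j0.
  have le := balanced_layer j0; have [jk|kj] := leqP j k.+1.
    apply: subv_trans (addvSl _ _); apply: sub_capr => //.
    by apply: subv_trans (capvSr _ _) _; exact: socle_series_homo.
  apply: subv_trans (addvSr _ _); apply: sub_capr => //.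
  by apply: subv_trans (capvSl _ _) _; apply: radical_series_homo; exact: ltnW.
rewrite orth_cap orth_Soc orth_Ip; apply/subvP => x; rewrite memv_cap.
move=> /andP[/memv_addP[s sS [z1 z1I e1]] /memv_addP[r rR [z2 z2I e2]]].
have /memv_addP[a1 a1S [b1 b1R f1]] := subvP split_Il z1 z1I.
have /memv_addP[a2 a2S [b2 b2R f2]] := subvP split_Il z2 z2I.
move: a1S b1R a2S b2R sS; rewrite !memv_cap => /andP[a1I a1S] /andP[b1I b1R].
move=> /andP[a2I a2S] /andP[b2I b2R] /andP[sS _].
(* Sorting the two expressions of x puts this element into both S_(k+1) and R_(k+1), hence into
   l^*. *)
have e : s + a1 - a2 = r + b2 - b1.
  apply/eqP; rewrite subr_eq addrAC eq_sym subr_eq eq_sym -[s + a1 + b1]addrA -f1 -e1 e2 f2.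
  by rewrite [a2 + b2]addrC addrA.
have yI : s + a1 - a2 \in Il.
  apply: (subvP (balanced_layer (ltn0Sn k))); rewrite memv_cap {1}e.
  by rewrite !memvB ?memvD.
have -> : x = (s + a1 - a2) + (a2 + b1).
  by rewrite e1 f1 addrA addrA subrK.
by rewrite memvD // memvD.
Qed.

Lemma balanced_cond_A0 : cond_A0 br rho form alpha gamma.
Proof. by apply/cond_A0E; exact: balanced_center. Qed.

(** Within l^* + a, socle and centre agree modulo l^* by [socle_Ip], so the socle statement for k =
    0 carries over to the centre. *)
Lemma balanced_cond_B0 : cond_B0 br rho form alpha.
Proof.
apply/cond_B0E; first exact: balanced_semisimple.
apply: subv_trans (balanced_nondegenerate 0).
have CS : (lker ad :&: Ip <= Soc 1 :&: Ip)%VS by apply: capvS => //; exact: center_socle.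
have CI : (lker ad :&: Ip + Il <= Ip)%VS by apply: sub_addl; [exact: capvSr|exact: Il_Ip].
apply: sub_capr; first by apply: subv_trans (capvSl _ _) _; exact: addvS.
apply: (@subv_trans _ _ (orthv Bd (lker ad :&: Ip + Il))%VS).
  rewrite orthvD orth_Il; apply: sub_capr; first exact: capvSr.
  exact: subv_trans (capvSl _ _) CI.
apply: orthvS; exact: socle_Ip.
Qed.

(** The lift W of I lies in S_(k+1), hence in S_j for j > k; for j <= k it lies in R_j + Ip, because
    I is in R_k(l). So W is in every R_j + S_j, hence in Ip, and I = 0. *)
Lemma balanced_cond_A k : (0 < k)%N -> cond_A br rho form alpha gamma k.
Proof.
move=> k0 I sI ISR [Phi1 [Phi2 hPhi]].
have [W [sW WS WI]] := lift_of_cond_A k0 balanced_semisimple sI ISR hPhi.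
suff WIp : (W <= Ip)%VS by rewrite -WI; apply/eqP; rewrite -lkerE.
apply: balanced_sub_Ip => j j0; have [kj|jk] := ltnP k j.
  by apply: subv_trans WS _; apply: subv_trans (addvSr _ _); exact: socle_series_homo.
apply: (@subv_trans _ _ (Rd j + Ip)%VS); last first.
  by apply: sub_addl; [exact: addvSl|exact: balanced_Ip_sub].
rewrite -(@limgK _ _ _ proj_l (Rd j + Ip)%VS) ?addvSr // limgD proj_l_Rd.
apply/subvP => u uW; rewrite -memv_preim; apply: (subvP (addvSl _ _)).
apply: (subvP (radical_series_homo br jk)); apply: (subvP (capvSr (socle br) _)).
by apply: (subvP ISR); rewrite -WI memv_img.
Qed.

Lemma balanced_cond_B k : (0 < k)%N -> cond_B br rho form alpha k.
Proof.
move=> k0; apply/cond_BE => //; [exact: balanced_semisimple|exact: balanced_nondegenerate].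
Qed.

End Balanced.

(** * From the conditions to a balanced extension *)

Section Conditions.
Variable m : nat.
Hypothesis Rm : Rl m.+1 = 0%VS.
Hypothesis ssr : semisimple rho.
Hypothesis A0 : cond_A0 br rho form alpha gamma.
Hypothesis B0 : cond_B0 br rho form alpha.
Hypothesis AB : forall k, (1 <= k <= m)%N ->
  cond_A br rho form alpha gamma k /\ cond_B br rho form alpha k.

Lemma Rd_sub_Ip k : (m < k)%N -> (Rd k <= Ip)%VS.
Proof.
move=> mk; apply/subvP => u /Rd_Rl /(subvP (radical_series_homo br mk)).
by rewrite Rm memv0 mem_Ip.
Qed.

(** Half of an alternating induction, resting on (A_k); [conditions_layer_Il] is the other half and
    rests on (B_k). *)
Lemma conditions_layer_Ip k : (Rd k :&: Soc k <= Il)%VS -> (Rd k :&: Soc k.+1 <= Ip)%VS.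
Proof.
move=> le; have [mk|km] := ltnP m k.
  by apply: subv_trans (capvSl _ _) _; exact: Rd_sub_Ip.
case: k le km => [|k] le km.
  apply: subv_trans (capvSr _ _) _; apply: subv_trans socle_center _.
  by apply: sub_addl => //; apply/cond_A0E.
have [Ak _] := AB (k := k.+1) km; set j := k.+1 in le km Ak *.
pose N := (Soc j :&: Il)%VS; pose W := (Rd j :&: Soc j.+1 + N)%VS.
have sN : ideal N by apply: submodule_cap; [exact: ideal_Soc|exact: ideal_Il].
have sW : ideal W by apply: submodule_add => //; exact: ideal_layer.
have ssW : ss_quotient ad N W.
  by apply: layer_semisimple => //; apply: sub_capr => //; exact: capvSr.
have NIp : (N <= Ip)%VS by apply: subv_trans (capvSr _ _) Il_Ip.
(* T is a complement of the part of W in l^* + a, so it has the same image in l as W and lifts that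
   image modulo S_k in l^*; (A_k) makes the image 0. *)
have [|||T [sT NT TW eT cT]] := ssW (W :&: Ip)%VS.
- by apply: submodule_cap => //; exact: ideal_Ip.
- by apply: sub_capr => //; exact: addvSr.
- exact: capvSl.
have pIp : (proj_l @: Ip = 0)%VS by apply/eqP; rewrite -lkerE subvv.
have pN : (proj_l @: N = 0)%VS by apply/eqP; rewrite -lkerE.
have pW : (proj_l @: T = proj_l @: W)%VS.
  rewrite -eT limgD.
  have -> : (proj_l @: (W :&: Ip) = 0)%VS by apply/eqP; rewrite -lkerE capvSr.
  by rewrite add0v.
have TN : (T :&: Ip <= Soc j :&: Il)%VS.
  rewrite -/N -cT; apply: sub_capr; last exact: capvSl.
  by apply: capvS.
have sI : submodule br (proj_l @: T)%VS by exact: (submodule_img proj_l_hf).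
have IR : (proj_l @: T <= Rl j)%VS.
  by rewrite pW limgD pN addv0 -proj_l_Rd; apply: limgS; exact: capvSl.
have IS : (proj_l @: T <= socle br)%VS.
  have [_ _ maxS] := socleP br; apply: maxS => //.
  have := ss_quotient_add sN sW ideal_Ip (addvSr _ _) ssW.
  move=> /(ss_quotient_img proj_l_fh proj_l_hf).
  have -> : (proj_l @: (N + Ip) = 0)%VS by rewrite limgD pN pIp addv0.
  have -> : (proj_l @: (W + Ip) = proj_l @: T)%VS by rewrite limgD pIp addv0 pW.
  apply.
  - by apply: submodule_add => //; exact: ideal_Ip.
  - by apply: submodule_add => //; exact: ideal_Ip.
  - exact: addvSr.
  - by apply: addvS => //; exact: addvSr.
have I0 : (proj_l @: T = 0)%VS.
  by apply: Ak => //; [exact: sub_capr|exact: (cond_A_of_lift sT TN erefl sI IR)].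
apply: subv_trans (addvSl _ N) _; rewrite lkerE; apply/eqP.
by rewrite -/W -pW.
Qed.

(** R_(k+1) :&: S_(k+1) lies both in T = S_(k+1) :&: Ip and in the orthogonal of T, so
    non-degeneracy of the projection of T to a pushes it into l^*. *)
Lemma conditions_layer_Il k : (Rd k :&: Soc k.+1 <= Ip)%VS -> (Rd k.+1 :&: Soc k.+1 <= Il)%VS.
Proof.
move=> le; have [leR _ _] := radical_seriesP ad k.
have leW : (Rd k.+1 :&: Soc k.+1 <= Soc k.+1 :&: Ip)%VS.
  apply: sub_capr; first exact: capvSr.
  by apply: subv_trans le; apply: capvS.
have RdO : (Rd k.+1 <= orthv Bd (Soc k.+1 :&: Ip))%VS.
  by rewrite -orth_Soc; apply: orthvS; exact: capvSl.
(* For k > m the ideal l^* lies in S_k, so l^* + a lies in S_(k+1) by semisimplicity; its orthogonal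
   l^* then contains R_(k+1). *)
have [mk|km] := ltnP m k.
  have IlS : (Il <= Soc k)%VS.
    by rewrite -orth_Rd -orth_Ip; apply: orthvS; exact: Rd_sub_Ip.
  have [_ _ maxS] := socle_seriesP ad k.
  have IpS : (Ip <= Soc k.+1)%VS.
    apply: subv_trans (addvSl _ (Soc k)) _; apply: maxS.
    - by apply: submodule_add; [exact: ideal_Ip|exact: ideal_Soc].
    - exact: addvSr.
    apply: ss_quotient_capl; [exact: ideal_Ip|exact: ideal_Soc|].
    apply: (ss_quotient_sub _ _ _ _ _ (proj2 Ip_Il_semisimple ssr)).
    - by apply: submodule_cap; [exact: ideal_Ip|exact: ideal_Soc].
    - exact: ideal_Ip.
    - by apply: sub_capr => //; exact: Il_Ip.
    - exact: capvSl.
    - exact: subvv.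
  apply: subv_trans (capvSl _ _) _; apply: subv_trans RdO _.
  by rewrite (capv_idPr IpS) orth_Ip.
case: k km le leR leW RdO => [|k] km le leR leW RdO.
  apply: subv_trans (proj1 (cond_B0E ssr) B0); apply: sub_capr.
    exact: subv_trans leW socle_Ip.
  apply: subv_trans (capvSl _ _) _; apply: subv_trans RdO _; apply: orthvS.
  by apply: capvS => //; exact: center_socle.
have [_ Bk] := AB (k := k.+1) km.
apply: subv_trans (proj1 (cond_BE (ltn0Sn k) ssr) Bk); apply: sub_capr.
  exact: subv_trans leW (addvSl _ _).
exact: subv_trans (capvSl _ _) RdO.
Qed.

Lemma conditions_layers k : (Rd k :&: Soc k <= Il)%VS.
Proof.
elim: k => [|k IH]; first by rewrite capv0 sub0v.
by apply: conditions_layer_Il; exact: conditions_layer_Ip.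
Qed.

(** For the inclusion of l^* in i(d), pass to orthogonals: that of i(d) is inside a sum of layers,
    and these all lie in l^* + a. *)
Lemma conditions_balanced : balanced br rho form alpha gamma.
Proof.
have [h1 h2] := canonical_idealP; apply: subv_eq; last first.
  by apply: h2 => k _; exact: conditions_layers.
have [|n hn] := @sub_layers (orthv Bd (canonical_ideal ad)).
  move=> j j0; have := orthvS Bd (h1 j j0).
  by rewrite orth_cap orth_Rd orth_Soc addvC.
rewrite -(orth2 (canonical_ideal ad)) -orth_Ip; apply: orthvS.
apply: subv_trans hn _; apply/subv_sumP => k _.
by apply: conditions_layer_Ip; exact: conditions_layers.
Qed.

End Conditions.

Lemma balancedE m : Rl m.+1 = 0%VS -> balanced br rho form alpha gamma <->
  [/\ semisimple rho, cond_A0 br rho form alpha gamma, cond_B0 br rho form alpha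
    & forall k, (1 <= k <= m)%N ->
        cond_A br rho form alpha gamma k /\ cond_B br rho form alpha k].
Proof.
move=> Rm; split=> [bal|[ssr A0 B0 AB]]; last exact: conditions_balanced Rm ssr A0 B0 AB.
split; [exact: balanced_semisimple|exact: balanced_cond_A0|exact: balanced_cond_B0|].
by move=> k /andP[k0 _]; split; [exact: balanced_cond_A|exact: balanced_cond_B].
Qed.

(* Both sides say that the a-component of the centre vanishes. *)
Lemma cond_B0'E : semisimple rho -> cond_A0 br rho form alpha gamma ->
  (cond_B0' br rho alpha <->
   cond_B0 br rho form alpha /\ (lker ad <= derived ad)%VS).
Proof.
move=> ssr /cond_A0E CI; have N0 := invariants_nondegenerate ssr.
have pC : (proj_a @: lker ad = invariants rho :&: orthv form (alpha_0_ker br rho alpha))%VS.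
  by rewrite -proj_a_center // (capv_idPl CI).
rewrite derived_orth; split=> [e|[B0 iso]].
  rewrite /cond_B0 e; split; first by apply/nondegenerate_onE.
  (* The centre now has zero a-component, so it lies in l^* and is isotropic. *)
  rewrite e N0 in pC; apply/subvP => u uC; apply/mem_orthv => v vC.
  rewrite Bd_Ip ?(subvP CI) //; have : proj_a u \in (0 : {vspace a})%VS by rewrite -pC memv_img.
  by rewrite memv0 proj_aE => /eqP->; rewrite linear0 zero_lfunE.
have UN := alpha_0_ker_sub.
have /nondegenerate_relative_orth-/(_ _ UN) nd := N0.
have {nd} /nondegenerate_onE nd := proj1 nd B0.
(* This space is non-degenerate by (B_0), and isotropic as the projection of an isotropic centre. *)
have i0 : (invariants rho :&: orthv form (alpha_0_ker br rho alpha) = 0)%VS.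
  rewrite -[RHS]nd; apply/esym/capv_idPl; rewrite -pC; apply/subvP => _ /memv_imgP[u uC ->].
  apply/mem_orthv => _ /memv_imgP[v vC ->]; rewrite !proj_aE -Bd_Ip ?(subvP CI) //.
  by have /mem_orthv := subvP iso u uC; apply.
apply: subv_eq => //.
(* Orthogonals turn this into a = invariants^perp + alpha_0(ker); cutting with the non-degenerate
   invariants leaves alpha_0(ker) alone. *)
have := congr1 (orthv form) i0.
rewrite orthv_cap ?lker_form ?sub0v //; last exact: formC.
rewrite orth_form2 orthv0 => eT.
have : (invariants rho <= (alpha_0_ker br rho alpha + orthv form (invariants rho))
   :&: invariants rho)%VS by rewrite addvC eT capfv.
by rewrite -vspace_modl // [(orthv form _ :&: _)%VS]capvC N0 addv0.
Qed.

End StandardModelTheory.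

Theorem theorem4p1 (R : realType) (l a : vectType R)
    (br : 'Hom(l, 'End(l))) (rho : 'Hom(l, 'End(a)))
    (form : 'Hom(a, dualv a))
    (alpha : 'Hom(l, 'Hom(l, a))) (gamma : 'Hom(l, 'Hom(l, dualv l)))
    (m : nat) :
  lie_bracket br ->
  orthogonal_module br rho form ->
  quadratic_cocycle br rho form alpha gamma ->
  radical_series br m.+1 = 0%VS ->
  [/\ semisimple rho ->
        [/\ (invariants rho + act_image rho = fullv)%VS,
            (invariants rho :&: act_image rho = 0)%VS
          & alpha = alpha_0 rho alpha + alpha_1 rho alpha],
      balanced br rho form alpha gamma <->
        [/\ semisimple rho,
            cond_A0 br rho form alpha gamma,
            cond_B0 br rho form alpha
          & forall k, (1 <= k <= m)%N ->
              cond_A br rho form alpha gamma k /\ cond_B br rho form alpha k]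
    & regularly_balanced br rho form alpha gamma <->
        [/\ semisimple rho,
            cond_A0 br rho form alpha gamma,
            cond_B0' br rho alpha
          & forall k, (1 <= k <= m)%N ->
              cond_A br rho form alpha gamma k /\ cond_B br rho form alpha k]].
Proof.
move=> lie orth coc Rm; have balE := balancedE lie orth coc Rm.
split=> //.
  move=> ssr; have [e c] := invariants_decomposition ssr.
  by split=> //; exact: alpha_decomposition.
split=> [[/balE[ssr A0 B0 AB] reg]|[ssr A0 B0' AB]].
  by split=> //; apply/(cond_B0'E lie orth coc ssr A0).
have [B0 reg] := proj1 (cond_B0'E lie orth coc ssr A0) B0'.
by split=> //; apply/balE.
Qed.
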